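(* Let $Z_1,\dots,Z_n$ be i.i.d. with distribution $Q$ on a measurable space $\mathcal Z$, $Z\sim Q$, let $\psi:\mathcal Z\to\mathbb R^r$ be measurable with $\int\|\psi\|^2dQ<\infty$ and $\theta=\int\psi\,dQ$. Let $u_1,u_2,\dots$ be a sequence of measurable real functions on $\mathcal Z$ and let $m_n\to\infty$. Put $u_n=(u_1,\dots,u_{m_n})^\top$ and suppose that for each $n$, $\int\|u_n\|^2dQ<\infty$, $\int u_n\,dQ=0$, and $W_n=\int u_nu_n^\top dQ$ is nonsingular, and that the sequence $(W_n)$ is regular. Let $\bar W_n=\frac1n\sum_{j=1}^nu_n(Z_j)u_n(Z_j)^\top$. Assume (i) $\max_{1\le j\le n}\|u_n(Z_j)\|=o_p(m_n^{-3/2}n^{1/2})$; (ii) $|\bar W_n-W_n|_o=o_p(m_n^{-1})$; (iii) $\frac1n\sum_{j=1}^n\big(\psi(Z_j)u_n(Z_j)^\top-E[\psi(Z_j)u_n(Z_j)^\top]\big)=o_p(m_n^{-1/2})$. Then, with probability tending to one, there is a unique $\tilde\zeta_n\in\mathbb R^{m_n}$ with $1+u_n(Z_j)^\top\tilde\zeta_n>0$ for all $j$ and $\frac1n\sum_{j=1}^nu_n(Z_j)/(1+u_n(Z_j)^\top\tilde\zeta_n)=0$, and the estimator $$\tilde\theta_n=\frac1n\sum_{j=1}^n\frac{\psi(Z_j)}{1+u_n(Z_j)^\top\tilde\zeta_n}$$ satisfies, as $n\to\infty$, $\tilde\theta_n=\bar\psi-\bar\varphi_0+o_p(n^{-1/2})$,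 where $\varphi_0=\Pi(\psi\mid[u_\infty])$ and $\bar\varphi_0=\frac1n\sum_j\varphi_0(Z_j)$, $\bar\psi=\frac1n\sum_j\psi(Z_j)$. Consequently, if $\Sigma_0=\mathrm{Var}(\psi(Z))-\mathrm{Var}(\varphi_0(Z))$ is nonsingular, then $\sqrt n(\tilde\theta_n-\theta)\Rightarrow N(0,\Sigma_0)$.
   Context: A sequence of $m_n\times m_n$ dispersion matrices $W_n$ is called regular if $0<\inf_n\inf_{\|a\|=1}a^\top W_na\le\sup_n\sup_{\|a\|=1}a^\top W_na<\infty$. $|A|_o$ denotes the spectral (operator) norm. $[u_\infty]$ denotes the closed linear span in $L_2(Q)$ of $u_1,u_2,\dots$, and $\Pi(\psi\mid[u_\infty])$ is the componentwise orthogonal projection in $L_2(Q)$ of $\psi$ onto it. *)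

(* Defs.v *)
From HB Require Import structures.
From mathcomp Require Import all_boot all_order all_algebra.
From mathcomp Require Import all_classical all_reals all_analysis.
Set Implicit Arguments. Unset Strict Implicit. Unset Printing Implicit Defensive.
Import Order.TTheory GRing.Theory Num.Theory.
Import numFieldNormedType.Exports.
Local Open Scope classical_set_scope.
Local Open Scope ring_scope.

Definition vnorm {R : realType} {k : nat} (v : 'cV[R]_k) : R :=
  Num.sqrt (\sum_(i < k) v i 0 ^+ 2).

Definition frob {R : realType} {p q : nat} (A : 'M[R]_(p, q)) : R :=
  Num.sqrt (\sum_(i < p) \sum_(j < q) A i j ^+ 2).

Definition opnorm {R : realType} {p q : nat} (A : 'M[R]_(p, q)) : R :=
  sup [set vnorm (A *m x) | x in [set x : 'cV[R]_q | vnorm x = 1]].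

Definition regular_seq {R : realType} (m : nat -> nat)
    (W : forall n, 'M[R]_(m n)) : Prop :=
  exists c C : R, 0 < c /\
    forall n (a : 'cV[R]_(m n)), vnorm a = 1 ->
      c <= (a^T *m W n *m a) 0 0 <= C.

Definition iid {R : realType} {d dz : measure_display}
    {Omega : measurableType d} {Zt : measurableType dz}
    (P : probability Omega R) (Q : probability Zt R)
    (Zs : nat -> Omega -> Zt) : Prop :=
  (forall j, measurable_fun setT (Zs j)) /\
  (forall j (A : set Zt), measurable A -> P (Zs j @^-1` A) = Q A) /\
  (forall (s : seq nat) (A : nat -> set Zt), uniq s ->
     (forall j, measurable (A j)) ->
     P (\big[setI/setT]_(j <- s) (Zs j @^-1` A j))
     = (\prod_(j <- s) P (Zs j @^-1` A j))%E).

(* X_n = o_p(a_n): for every eps > 0, the outer probability of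
   {|X_n| > eps a_n} tends to 0 *)
Definition o_p {R : realType} {d : measure_display} {Omega : measurableType d}
    (P : probability Omega R) (X : nat -> Omega -> R) (a : nat -> R) : Prop :=
  forall eps : R, 0 < eps -> forall delta : R, 0 < delta ->
    exists N, forall n, (N <= n)%N ->
      exists A : set Omega, measurable A /\
        [set w | eps * a n < `|X n w|] `<=` A /\ (P A < delta%:E)%E.

(* the events E_n occur with probability tending to one (inner probability) *)
Definition wpto {R : realType} {d : measure_display} {Omega : measurableType d}
    (P : probability Omega R) (E : nat -> set Omega) : Prop :=
  forall delta : R, 0 < delta ->
    exists N, forall n, (N <= n)%N ->
      exists B : set Omega, measurable B /\ B `<=` E n /\
        ((1 - delta)%:E < P B)%E.

Definition L2 {R : realType} {dz : measure_display} {Zt : measurableType dz}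
    (Q : probability Zt R) (f : Zt -> R) : Prop :=
  measurable_fun setT f /\ Q.-integrable setT (fun z => (f z ^+ 2)%:E).

Definition EQ {R : realType} {dz : measure_display} {Zt : measurableType dz}
    (Q : probability Zt R) (f : Zt -> R) : R :=
  fine (\int[Q]_z (f z)%:E).

(* g = Pi(f | [u_infty]) : g lies in the closed linear span in L2(Q) of
   u_0, u_1, ... and f - g is orthogonal to every u_i *)
Definition is_proj {R : realType} {dz : measure_display} {Zt : measurableType dz}
    (Q : probability Zt R) (u : nat -> Zt -> R) (f g : Zt -> R) : Prop :=
  L2 Q g /\
  (forall eps : R, 0 < eps -> exists (k : nat) (c : 'I_k -> R),
      (\int[Q]_z ((g z - \sum_(i < k) c i * u i z) ^+ 2)%:E < eps%:E)%E) /\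
  (forall i, EQ Q (fun z => (f z - g z) * u i z) = 0).

(* the vector u_n(z) = (u_1(z), ..., u_{m_n}(z))^T  (u is 0-indexed) *)
Definition uvec {R : realType} {Zt : Type} (u : nat -> Zt -> R) (k : nat)
    (z : Zt) : 'cV[R]_k := \col_(i < k) u i z.

Definition fvec {R : realType} {Zt : Type} {r : nat} (f : 'I_r -> Zt -> R)
    (z : Zt) : 'cV[R]_r := \col_(k < r) f k z.

(* Iterated Lebesgue integral over R^r (equal to the integral over R^r
   for integrable functions, by Fubini) *)
Definition vcons {R : Type} {r : nat} (x : R) (y : 'I_r -> R) : 'I_r.+1 -> R :=
  fun i => match unlift ord0 i with Some j => y j | None => x end.

Definition iter_int {R : realType} : forall r : nat, (('I_r -> R) -> R) -> R :=
  fix go (r : nat) : (('I_r -> R) -> R) -> R :=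
  match r with
  | 0 => fun F => F (fun _ => 0)
  | r'.+1 => fun F =>
      Rintegral (@lebesgue_measure R) setT
        (fun x : R => go r' (fun y => F (vcons x y)))
  end.

Definition gauss_dens {R : realType} {r : nat} (S : 'M[R]_r) (x : 'cV[R]_r) : R :=
  (Num.sqrt ((2 * pi) ^+ r * \det S))^-1 *
  expR (- ((x^T *m invmx S *m x) 0 0) / 2).

Definition gauss_expect {R : realType} {r : nat} (S : 'M[R]_r)
    (h : 'cV[R]_r -> R) : R :=
  @iter_int R r (fun x => h (\col_(i < r) x i) * gauss_dens S (\col_(i < r) x i)).

Definition bounded_cont {R : realType} {r : nat} (h : 'cV[R]_r -> R) : Prop :=
  (exists M : R, forall x, `|h x| <= M) /\
  (forall x (eps : R), 0 < eps -> exists delta : R, 0 < delta /\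
     forall y, vnorm (y - x) < delta -> `|h y - h x| < eps).

Definition conv_gauss {R : realType} {d : measure_display}
    {Omega : measurableType d} {r : nat} (P : probability Omega R)
    (X : nat -> Omega -> 'cV[R]_r) (S : 'M[R]_r) : Prop :=
  forall h : 'cV[R]_r -> R, bounded_cont h ->
    ((fun n => \int[P]_w (h (X n w))%:E) @ \oo --> (gauss_expect S h)%:E)%E.

Definition Wmat {R : realType} {dz : measure_display} {Zt : measurableType dz}
    (Q : probability Zt R) (u : nat -> Zt -> R) (k : nat) : 'M[R]_k :=
  \matrix_(i < k, j < k) EQ Q (fun z => u i z * u j z).

Definition Wbar {R : realType} {Omega Zt : Type} (u : nat -> Zt -> R)
    (Zs : nat -> Omega -> Zt) (k n : nat) (w : Omega) : 'M[R]_k :=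
  n%:R^-1 *: \sum_(j < n) (uvec u k (Zs j w) *m (uvec u k (Zs j w))^T).

Definition cross_dev {R : realType} {d dz : measure_display}
    {Omega : measurableType d} {Zt : measurableType dz}
    (Q : probability Zt R) {r : nat} (psi : 'I_r -> Zt -> R)
    (u : nat -> Zt -> R) (Zs : nat -> Omega -> Zt) (k n : nat) (w : Omega)
    : 'M[R]_(r, k) :=
  n%:R^-1 *: \sum_(j < n)
    (fvec psi (Zs j w) *m (uvec u k (Zs j w))^T
     - \matrix_(a < r, i < k) EQ Q (fun z => psi a z * u i z)).

Definition zcond {R : realType} {Omega Zt : Type} (u : nat -> Zt -> R)
    (Zs : nat -> Omega -> Zt) (k n : nat) (w : Omega) (zeta : 'cV[R]_k) : Prop :=
  (forall j : 'I_n, 0 < 1 + ((uvec u k (Zs j w))^T *m zeta) 0 0) /\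
  n%:R^-1 *: \sum_(j < n)
     ((1 + ((uvec u k (Zs j w))^T *m zeta) 0 0)^-1 *: uvec u k (Zs j w)) = 0.

Definition est_form {R : realType} {Omega Zt : Type} {r : nat}
    (psi : 'I_r -> Zt -> R) (u : nat -> Zt -> R)
    (Zs : nat -> Omega -> Zt) (k n : nat) (w : Omega) (zeta : 'cV[R]_k)
    : 'cV[R]_r :=
  n%:R^-1 *: \sum_(j < n)
     ((1 + ((uvec u k (Zs j w))^T *m zeta) 0 0)^-1 *: fvec psi (Zs j w)).

Definition smean {R : realType} {Omega Zt : Type} {r : nat}
    (f : 'I_r -> Zt -> R) (Zs : nat -> Omega -> Zt) (n : nat) (w : Omega)
    : 'cV[R]_r :=
  n%:R^-1 *: \sum_(j < n) fvec f (Zs j w).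

Definition mean_vec {R : realType} {dz : measure_display}
    {Zt : measurableType dz} (Q : probability Zt R) {r : nat}
    (f : 'I_r -> Zt -> R) : 'cV[R]_r :=
  \col_(k < r) EQ Q (f k).

Definition cov_mat {R : realType} {dz : measure_display}
    {Zt : measurableType dz} (Q : probability Zt R) {r : nat}
    (f : 'I_r -> Zt -> R) : 'M[R]_r :=
  \matrix_(k < r, l < r)
    (EQ Q (fun z => f k z * f l z) - EQ Q (f k) * EQ Q (f l)).

(* Main.v *)
Require Import Defs.
From HB Require Import structures.
From mathcomp Require Import all_boot all_order all_algebra.
From mathcomp Require Import all_classical all_reals all_analysis.
From mathcomp Require Import measurable_realfun ring lra.
Import Order.TTheory GRing.Theory Num.Theory.
Import numFieldNormedType.Exports.
Local Open Scope classical_set_scope.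
Local Open Scope ring_scope.
Set Implicit Arguments. Unset Strict Implicit. Unset Printing Implicit Defensive.

(* On the event where (i)-(iii) hold with a small constant, the estimating
   equation reads zeta = Wbar^-1 (ubar + R zeta) with
   R zeta = n^-1 sum_j u_j (u_j . zeta)^2 / (1 + u_j . zeta), by
   1/(1+x) = 1 - x + x^2/(1+x).  Its right-hand side is a contraction of a
   ball of radius O((m_n/n)^(1/2)), because max_j |u_j| times that radius is
   o(1/m_n); uniqueness is the monotonicity of the equation.  Replacing zeta by
   W^-1 ubar in the estimator costs o(n^-1/2) and leaves psi-bar minus the
   empirical mean of the L2-projection of psi onto span(u_1, ..., u_{m_n}); the
   projections converge to phi0 in L2, so by Chebyshev their empirical means
   differ from that of phi0 by o_p(n^-1/2).

   The central limit theorem is obtained by Lindeberg's replacement method in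
   Trotter's operator form: iterated averaging operators h |-> E h(. + n^-1/2 V)
   are compared with Gaussian ones on a class of functions with Lipschitz second
   derivatives, reached from bounded Lipschitz h by mollification; bounded
   continuous h follow by inf-convolution.  Gaussian operators are identified
   with integrals against the density by induction on the dimension, through
   Schur complements. *)

(** * Euclidean vectors *)

(** Since $m_n$ grows, no estimate may hide a dimension constant. A remainder $n^{-1}\sum_j F_j u_j$
    is therefore tested against itself, which costs only the largest eigenvalue of [wbar];
    estimating it through the norms $\|u_j\|$ would cost the trace, which may be of order $m_n$. The
    radius $(m_n/n)^{1/2}$ comes from $E\|\bar u\|^2=\mathrm{tr}(W_n)/n$. The tilting equation is
    treated deterministically, for one sample, with fixed constants and a small parameter [e].
    Probability enters through the intersection of six events: (i)-(iii), and Markov bounds for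
    $\bar u$, for the mean of $\|\psi\|^2$ and for the projection error. In the limit theorem two
    features shape the test class: one constant must survive all iterated averages, so that the
    errors add up, and the remainder must be integrable under second moments only. A Gaussian law is
    a list of vectors whose one-dimensional operators commute and obey exact stability, so the
    Gaussian side does not depend on $n$; the list that matches the density consists of Cholesky
    columns. *)

Definition dotv {R : realType} {k : nat} (x y : 'cV[R]_k) : R :=
  \sum_(i < k) x i 0 * y i 0.

Section vectors.
Variable R : realType.

Lemma dotvE k (x y : 'cV[R]_k) : (x^T *m y) 0 0 = dotv x y.
Proof. by rewrite mxE; apply: eq_bigr => i _; rewrite mxE. Qed.

Lemma dotvC k (x y : 'cV[R]_k) : dotv x y = dotv y x.
Proof. by apply: eq_bigr => i _; rewrite mulrC. Qed.

Lemma dotvDl k (x y z : 'cV[R]_k) : dotv (x + y) z = dotv x z + dotv y z.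
Proof.
by rewrite /dotv -big_split; apply: eq_bigr => i _; rewrite mxE mulrDl.
Qed.

Lemma dotvDr k (x y z : 'cV[R]_k) : dotv z (x + y) = dotv z x + dotv z y.
Proof. by rewrite dotvC dotvDl !(dotvC z). Qed.

Lemma dotvZl k a (x y : 'cV[R]_k) : dotv (a *: x) y = a * dotv x y.
Proof.
by rewrite /dotv mulr_sumr; apply: eq_bigr => i _; rewrite mxE mulrA.
Qed.

Lemma dotvZr k a (x y : 'cV[R]_k) : dotv x (a *: y) = a * dotv x y.
Proof. by rewrite dotvC dotvZl dotvC. Qed.

Lemma dotvNl k (x y : 'cV[R]_k) : dotv (- x) y = - dotv x y.
Proof. by rewrite -scaleN1r dotvZl mulN1r. Qed.

Lemma dotvNr k (x y : 'cV[R]_k) : dotv x (- y) = - dotv x y.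
Proof. by rewrite dotvC dotvNl dotvC. Qed.

Lemma dotv0r k (x : 'cV[R]_k) : dotv x 0 = 0.
Proof. by rewrite /dotv big1 // => i _; rewrite mxE mulr0. Qed.

Lemma dotv0l k (x : 'cV[R]_k) : dotv 0 x = 0.
Proof. by rewrite dotvC dotv0r. Qed.

Lemma dotv_suml k (I : Type) (s : seq I) (P : pred I) (F : I -> 'cV[R]_k) y :
  dotv (\sum_(i <- s | P i) F i) y = \sum_(i <- s | P i) dotv (F i) y.
Proof.
elim/big_rec2 : _ => [|i a b _ <-]; first exact: dotv0l.
by rewrite dotvDl.
Qed.

Lemma dotvv_ge0 k (x : 'cV[R]_k) : 0 <= dotv x x.
Proof. by apply: sumr_ge0 => i _; rewrite -expr2 sqr_ge0. Qed.

Lemma vnorm_ge0 k (x : 'cV[R]_k) : 0 <= vnorm x.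
Proof. exact: sqrtr_ge0. Qed.

Lemma sqr_vnorm k (x : 'cV[R]_k) : vnorm x ^+ 2 = dotv x x.
Proof.
by rewrite /vnorm sqr_sqrtr//; apply: sumr_ge0 => i _; exact: sqr_ge0.
Qed.

Lemma vnorm0 k : vnorm (0 : 'cV[R]_k) = 0.
Proof.
by rewrite /vnorm big1 ?sqrtr0// => i _; rewrite mxE expr0n.
Qed.

Lemma vnorm_eq0 k (x : 'cV[R]_k) : vnorm x = 0 -> x = 0.
Proof.
move=> x0; have := sqr_vnorm x; rewrite x0 expr0n/= => /esym/eqP.
rewrite psumr_eq0; last by move=> i _; rewrite -expr2 sqr_ge0.
move=> /allP h; apply/colP => i; rewrite mxE.
have := h i (mem_index_enum _); rewrite /= mulf_eq0 orbb => /eqP//.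
Qed.

Lemma vnormZ k a (x : 'cV[R]_k) : vnorm (a *: x) = `|a| * vnorm x.
Proof.
rewrite /vnorm -sqrtr_sqr -sqrtrM ?sqr_ge0//; congr Num.sqrt.
by rewrite mulr_sumr; apply: eq_bigr => i _; rewrite mxE exprMn.
Qed.

Lemma vnormN k (x : 'cV[R]_k) : vnorm (- x) = vnorm x.
Proof. by rewrite -scaleN1r vnormZ normrN1 mul1r. Qed.

Lemma vnormB k (x y : 'cV[R]_k) : vnorm (x - y) = vnorm (y - x).
Proof. by rewrite -vnormN opprB. Qed.

Lemma cauchy_schwarz k (x y : 'cV[R]_k) : `|dotv x y| <= vnorm x * vnorm y.
Proof.
rewrite -ler_sqr ?nnegrE ?mulr_ge0 ?vnorm_ge0// exprMn !sqr_vnorm real_normK ?num_real//.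
have [y0|yn0] := eqVneq (dotv y y) 0.
  have -> : y = 0 by apply: vnorm_eq0; apply/eqP; rewrite -sqrf_eq0 sqr_vnorm y0.
  by rewrite !dotv0r expr0n mulr0.
have yp : 0 < dotv y y by rewrite lt_def yn0 dotvv_ge0.
have := dotvv_ge0 (dotv y y *: x - dotv x y *: y).
rewrite !(dotvDl, dotvDr, dotvZl, dotvZr, dotvNl, dotvNr) (dotvC y x) => h.
rewrite -(ler_pM2r yp); lra.
Qed.

Lemma dotv_le k (x y : 'cV[R]_k) : dotv x y <= vnorm x * vnorm y.
Proof. exact: le_trans (ler_norm _) (cauchy_schwarz x y). Qed.

Lemma vnormD k (x y : 'cV[R]_k) : vnorm (x + y) <= vnorm x + vnorm y.
Proof.
rewrite -ler_sqr ?nnegrE ?addr_ge0 ?vnorm_ge0// sqrrD !sqr_vnorm.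
rewrite !(dotvDl, dotvDr) (dotvC y x); have := dotv_le x y; lra.
Qed.

Lemma vnorm_sum k (I : Type) (s : seq I) (P : pred I) (F : I -> 'cV[R]_k) :
  vnorm (\sum_(i <- s | P i) F i) <= \sum_(i <- s | P i) vnorm (F i).
Proof.
elim/big_rec2 : _ => [|i a b _ h]; first by rewrite vnorm0.
by rewrite (le_trans (vnormD _ _))// lerD2l.
Qed.

Lemma ler_coord_vnorm k (x : 'cV[R]_k) i : `|x i 0| <= vnorm x.
Proof.
rewrite -ler_sqr ?nnegrE ?vnorm_ge0// sqr_vnorm real_normK ?num_real//.
rewrite /dotv (bigD1 i)//= -expr2 lerDl.
by apply: sumr_ge0 => j _; rewrite -expr2 sqr_ge0.
Qed.

Lemma vnorm_le_sum k (x : 'cV[R]_k) : vnorm x <= \sum_i `|x i 0|.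
Proof.
have S0 : 0 <= \sum_i `|x i 0| by apply: sumr_ge0.
rewrite -ler_sqr ?nnegrE ?vnorm_ge0// sqr_vnorm expr2 mulr_suml.
apply: ler_sum => i _; rewrite -expr2 -real_normK ?num_real// expr2.
by rewrite ler_wpM2l// (bigD1 i)//= lerDl sumr_ge0.
Qed.

Lemma sqr_frob p q (A : 'M[R]_(p, q)) : frob A ^+ 2 = \sum_i \sum_j A i j ^+ 2.
Proof.
rewrite /frob sqr_sqrtr//.
by apply: sumr_ge0 => i _; apply: sumr_ge0 => j _; exact: sqr_ge0.
Qed.

Lemma frob_ge0 p q (A : 'M[R]_(p, q)) : 0 <= frob A.
Proof. exact: sqrtr_ge0. Qed.

Lemma vnorm_mulmx_frob p q (A : 'M[R]_(p, q)) (x : 'cV[R]_q) :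
  vnorm (A *m x) <= frob A * vnorm x.
Proof.
rewrite -ler_sqr ?nnegrE ?mulr_ge0 ?vnorm_ge0 ?frob_ge0// exprMn sqr_frob.
rewrite sqr_vnorm mulr_suml; apply: ler_sum => i _.
have -> : (A *m x) i 0 = dotv (row i A)^T x.
  by rewrite mxE; apply: eq_bigr => j _; rewrite !mxE.
rewrite -expr2 -real_normK ?num_real//.
have -> : \sum_j A i j ^+ 2 = vnorm (row i A)^T ^+ 2.
  by rewrite sqr_vnorm; apply: eq_bigr => j _; rewrite !mxE.
by rewrite -exprMn ler_sqr ?nnegrE ?mulr_ge0 ?vnorm_ge0// cauchy_schwarz.
Qed.

(** The Frobenius norm bounds the set under the supremum, so a normalised vector lies below it. The
    zero vector is separate, which also covers dimension 0. *)
Lemma vnorm_mulmx_opnorm p q (A : 'M[R]_(p, q)) (x : 'cV[R]_q) :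
  vnorm (A *m x) <= opnorm A * vnorm x.
Proof.
have [x0|x0] := eqVneq (vnorm x) 0.
  by rewrite x0 (vnorm_eq0 x0) mulmx0 vnorm0 mulr0.
have xp : 0 < vnorm x by rewrite lt_def x0 vnorm_ge0.
rewrite -ler_pdivrMr// -[X in _ / X]ger0_norm ?vnorm_ge0// mulrC -normfV.
rewrite -vnormZ scalemxAr; apply: ub_le_sup; last first.
  exists ((vnorm x)^-1 *: x) => //=.
  by rewrite vnormZ normfV ger0_norm ?vnorm_ge0// mulVf.
exists (frob A) => _ /= [y y1 <-].
by rewrite -[leRHS]mulr1 -y1 vnorm_mulmx_frob.
Qed.

End vectors.

(** * Averaging operators *)

(* Column vectors carry no measurable structure here; Borel measurability on
   R^r is expressed through [r.-tuple R]. *)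
Definition meas_col {R : realType} {r : nat} (h : 'cV[R]_r -> R) : Prop :=
  measurable_fun setT (fun t : r.-tuple R => h (\col_i tnth t i)).

Definition bdd {R : realType} {T : Type} (M : R) (h : T -> R) : Prop :=
  forall x, `|h x| <= M.

Definition lip {R : realType} {r : nat} (L : R) (h : 'cV[R]_r -> R) : Prop :=
  forall x y, `|h x - h y| <= L * vnorm (x - y).

Definition cmeas {R : realType} {d} {T : measurableType d} {r : nat}
  (V : T -> 'cV[R]_r) := forall i, measurable_fun setT (fun w => V w i 0).

Section meascol.
Context {R : realType}.

Lemma meas_col_comp r d (T : measurableType d) (h : 'cV[R]_r -> R)
    (V : T -> 'cV[R]_r) :
  meas_col h -> cmeas V -> measurable_fun setT (fun w => h (V w)).
Proof.
move=> mh mV.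
have -> : (fun w => h (V w)) =
    (fun t : r.-tuple R => h (\col_i tnth t i)) \o
    (fun w => [tuple V w i 0 | i < r]).
  apply/funext => w /=; congr h; apply/colP => i.
  by rewrite mxE tnth_mktuple.
apply: measurableT_comp => //; apply/measurable_fun_tnthP => i.
have -> : (@tnth r R ^~ i \o (fun w => [tuple V w i 0 | i < r])) =
  fun w => V w i 0 by apply/funext => w /=; rewrite tnth_mktuple.
exact: mV.
Qed.

Lemma cmeas_col r : @cmeas R _ (r.-tuple R) r (fun t => \col_i tnth t i).
Proof.
move=> i; rewrite (_ : (fun _ => _) = @tnth r R ^~ i); first exact: measurable_tnth.
by apply/funext => t; rewrite mxE.
Qed.

Lemma cmeasD r d (T : measurableType d) (V W : T -> 'cV[R]_r) :
  cmeas V -> cmeas W -> cmeas (fun w => V w + W w).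
Proof.
move=> mV mW i; under eq_fun do rewrite mxE.
exact: measurable_funD.
Qed.

Lemma cmeas_cst r d (T : measurableType d) (v : 'cV[R]_r) :
  cmeas (fun _ : T => v).
Proof. by move=> i; exact: measurable_cst. Qed.

Lemma cmeasZ r d (T : measurableType d) (V : T -> 'cV[R]_r) (a : T -> R) :
  cmeas V -> measurable_fun setT a -> cmeas (fun w => a w *: V w).
Proof.
move=> mV ma i; under eq_fun do rewrite mxE.
exact: measurable_funM.
Qed.

Lemma cmeas_sum r d (T : measurableType d) (I : Type) (s : seq I)
    (V : I -> T -> 'cV[R]_r) :
  (forall i, cmeas (V i)) -> cmeas (fun w => \sum_(i <- s) V i w).
Proof.
move=> mV; elim: s => [|i s ih].
  by under eq_fun do rewrite big_nil; exact: cmeas_cst.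
by under eq_fun do rewrite big_cons; exact: cmeasD.
Qed.

Lemma cmeas_comp r d d' (T : measurableType d) (T' : measurableType d')
    (V : T -> 'cV[R]_r) (g : T' -> T) :
  cmeas V -> measurable_fun setT g -> cmeas (fun w => V (g w)).
Proof. by move=> mV mg i; exact: (measurableT_comp (mV i) mg). Qed.

Lemma meas_col_shift r (h : 'cV[R]_r -> R) v : meas_col h ->
  meas_col (fun x => h (v + x)).
Proof.
move=> mh; apply: meas_col_comp mh _; apply: cmeasD; first exact: cmeas_cst.
exact: cmeas_col.
Qed.

Definition econt r (h : 'cV[R]_r -> R) :=
  forall x (eps : R), 0 < eps -> exists delta : R, 0 < delta /\
     forall y, vnorm (y - x) < delta -> `|h y - h x| < eps.

(** Rounding every coordinate down to a grid of mesh [1/(k+1)] gives a function with countably many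
    values, each taken on a measurable box; by continuity these functions converge pointwise to
    [h]. *)
Lemma econt_meas_col r (h : 'cV[R]_r -> R) : econt h -> meas_col h.
Proof.
move=> ch.
pose D (k : nat) (z : r.-tuple int) : 'cV[R]_r :=
  \col_i ((tnth z i)%:~R / k.+1%:R).
pose fl (k : nat) (t : r.-tuple R) : r.-tuple int :=
  [tuple Num.floor (tnth t i * k.+1%:R) | i < r].
apply: (@measurable_fun_cvg _ _ _ _ (fun k t => h (D k (fl k t)))).
- move=> k _ Y mY; rewrite setTI.
  pose F (z : r.-tuple int) : set (r.-tuple R) :=
    if h (D k z) \in Y then
      [set t | forall i, tnth t i \in `[(tnth z i)%:~R / k.+1%:R, (tnth z i + 1)%:~R / k.+1%:R[ ]
    else set0.
  have flP t (z : r.-tuple int) : fl k t = z <->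
      forall i, tnth t i \in `[(tnth z i)%:~R / k.+1%:R, (tnth z i + 1)%:~R / k.+1%:R[.
    have k0 : 0 < k.+1%:R :> R by rewrite ltr0n.
    split.
      move=> <- i; rewrite in_itv/= tnth_mktuple ler_pdivrMr// ltr_pdivlMr//.
      by rewrite floor_le floorD1_gt.
    move=> H; apply: eq_from_tnth => i; rewrite tnth_mktuple.
    have := H i; rewrite in_itv/= ler_pdivrMr// ltr_pdivlMr// => ?.
    exact/Num.Theory.floor_def.
  have -> : (fun t => h (D k (fl k t))) @^-1` Y = \bigcup_z F z.
    apply/seteqP; split=> t /=.
      move=> Yt; exists (fl k t) => //; rewrite /F mem_set//=.
      by apply/flP.
    move=> [z _]; rewrite /F; case: ifPn => // /set_mem Yz /= /flP tz.
    by rewrite tz.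
  apply: (@countable_bigcupT_measurable _ _ (r.-tuple int : countType) F (countableP _)).
  move=> z; rewrite /F; case: ifPn => // _.
  have -> : [set t : r.-tuple R | forall i, tnth t i \in `[(tnth z i)%:~R / k.+1%:R, (tnth z i + 1)%:~R / k.+1%:R[]
     = \bigcap_(i in [set: 'I_r]) ((@tnth r R)^~ i @^-1` `[(tnth z i)%:~R / k.+1%:R, (tnth z i + 1)%:~R / k.+1%:R[).
    by apply/seteqP; split=> t /= H i; [move=> _; exact: H|exact: (H i I)].
  apply: fin_bigcap_measurable => // i _; rewrite -[X in measurable X]setTI.
  by apply: measurable_tnth.
- move=> t _; apply/cvgrPdist_lt => e e0.
  have [dl [dl0 H]] := ch (\col_i tnth t i) e e0.
  near=> k; rewrite distrC; apply: H.
  apply: (le_lt_trans (vnorm_le_sum _)).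
  apply: (@le_lt_trans _ _ (\sum_(i < r) k.+1%:R^-1)).
    apply: ler_sum => i _; rewrite !mxE tnth_mktuple.
    have k0 : 0 < k.+1%:R :> R by rewrite ltr0n.
    have a := floor_le (tnth t i * k.+1%:R).
    have b := floorD1_gt (tnth t i * k.+1%:R).
    rewrite intrD in b.
    have a' : (Num.floor (tnth t i * k.+1%:R))%:~R / k.+1%:R <= tnth t i.
      by rewrite ler_pdivrMr.
    have b' : tnth t i <= ((Num.floor (tnth t i * k.+1%:R))%:~R + 1) / k.+1%:R.
      by rewrite ler_pdivlMr// ltW.
    rewrite mulrDl mul1r in b'.
    have i0 : 0 < k.+1%:R^-1 :> R by rewrite invr_gt0.
    rewrite ler_distlC b' andbT lerBlDr (le_trans a')//.
    by rewrite lerDl ltW.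
  rewrite sumr_const card_ord -[X in X < _]mulr_natl ltr_pdivrMr ?ltr0n//.
  rewrite mulrC -ltr_pdivrMr//.
  apply: (@lt_trans _ _ k%:R); last by rewrite ltr_nat.
  by near: k; exact: nbhs_infty_gtr.
Unshelve. all: by end_near. Qed.

Lemma lip_econt r L (h : 'cV[R]_r -> R) : lip L h -> econt h.
Proof.
move=> Lh x e e0; exists (e / (`|L| + 1)).
have L1 : 0 < `|L| + 1 by rewrite ltr_wpDl.
split=> [|y]; first by rewrite divr_gt0.
rewrite ltr_pdivlMr// => H; apply: le_lt_trans H.
apply: le_trans (Lh y x) _; rewrite mulrC ler_wpM2l ?vnorm_ge0//.
by rewrite (le_trans (ler_norm _))// lerDl.
Qed.

Lemma lip_meas_col r L (h : 'cV[R]_r -> R) : lip L h -> meas_col h.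
Proof. by move/lip_econt/econt_meas_col. Qed.

Lemma bdd_integrable d (T : measurableType d) (mu : probability T R) M
    (g : T -> R) : measurable_fun setT g -> bdd M g ->
  mu.-integrable setT (EFin \o g).
Proof.
move=> mg Mg; apply: measurable_bounded_integrable => //.
  by apply: (@le_lt_trans _ _ 1%E); [exact: probability_le1|exact: ltry].
exists M; split; first exact: num_real.
by move=> x Mx t _ /=; rewrite (le_trans (Mg t))// ltW.
Qed.

Lemma Rint_prob_cst d (T : measurableType d) (mu : probability T R) (c : R) :
  \int[mu]_x c = c.
Proof.
rewrite Rintegral_cst// -[RHS]mulr1; congr (_ * _).
by rewrite -[RHS]/(fine 1%E); congr fine; exact: probability_setT.
Qed.

Lemma Rint_le_bdd d (T : measurableType d) (mu : probability T R) M
    (g : T -> R) : measurable_fun setT g -> bdd M g ->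
  `|\int[mu]_x g x| <= M.
Proof.
move=> mg Mg; have ig := bdd_integrable mu mg Mg.
apply: (le_trans (le_normr_Rintegral _ ig)) => //.
have -> : M = \int[mu]_x M :> R.
  by rewrite Rint_prob_cst.
apply: le_Rintegral => //.
- exact: integrable_norm.
- exact: finite_measure_integrable_cst.
Qed.

Section average.
Context d (T : measurableType d) (mu : probability T R) (r : nat).
Variable V : T -> 'cV[R]_r.
Hypothesis mV : cmeas V.

Definition avg (h : 'cV[R]_r -> R) : 'cV[R]_r -> R :=
  fun x => \int[mu]_t h (x + V t).

Lemma avg_integrand (h : 'cV[R]_r -> R) x : meas_col h ->
  measurable_fun setT (fun t => h (x + V t)).
Proof.
by move=> mh; apply: meas_col_comp mh _; apply: cmeasD => //; exact: cmeas_cst.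
Qed.

Lemma avg_integrable M (h : 'cV[R]_r -> R) x : meas_col h -> bdd M h ->
  mu.-integrable setT (EFin \o (fun t => h (x + V t))).
Proof.
move=> mh bh; apply: (@bdd_integrable _ _ _ M); first exact: avg_integrand.
by move=> t; exact: bh.
Qed.

Lemma avg_bdd M h : meas_col h -> bdd M h -> bdd M (avg h).
Proof.
move=> mh bh x; apply: Rint_le_bdd; first exact: avg_integrand.
by move=> t; exact: bh.
Qed.

Lemma avg_lip M L h : bdd M h -> lip L h -> lip L (avg h).
Proof.
move=> bh lh x y; have mh := lip_meas_col lh.
rewrite -RintegralB//; [|exact: (avg_integrable _ mh bh)..].
apply: Rint_le_bdd; first by apply: measurable_funB; exact: avg_integrand.
by move=> t; rewrite (le_trans (lh _ _))// opprD addrACA subrr addr0.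
Qed.

Lemma avg_meas M h : meas_col h -> bdd M h -> meas_col (avg h).
Proof.
move=> mh bh; rewrite /meas_col /avg.
pose f := fun p : (r.-tuple R) * T => h (\col_i tnth p.1 i + V p.2).
have mf : measurable_fun setT f.
  apply: meas_col_comp mh _; apply: cmeasD.
    by apply: (cmeas_comp (@cmeas_col r)); exact: measurable_fst.
  by apply: (cmeas_comp mV); exact: measurable_snd.
(* Adding [M] makes the integrand nonnegative, so Tonelli's theorem gives measurability of the
   partial integral. The same shift reduces bounded functions to nonnegative ones in several later
   proofs. *)
pose F t := (\int[mu]_z (f (t, z) + M)%:E)%E.
have mF : measurable_fun setT F.
  apply: (@measurable_fun_fubini_tonelli_F _ _ _ _ _ mu (fun p => (f p + M)%:E)).
    by apply/measurable_EFinP; apply: measurable_funD => //; exact: measurable_cst.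
  by move=> p; rewrite lee_fin -lerBlDr sub0r; have := bh (\col_i tnth p.1 i + V p.2); rewrite ler_norml => /andP[].
have -> : (fun t : r.-tuple R => \int[mu]_z h (\col_i tnth t i + V z)) =
          (fun t => fine (F t) - M).
  apply/funext => t; rewrite -[X in _ - X](Rint_prob_cst mu).
  have i1 := avg_integrable (\col_i tnth t i) mh bh.
  have i2 : mu.-integrable setT (EFin \o (fun=> M)).
    exact: finite_measure_integrable_cst.
  rewrite -[fine _]/(\int[mu]_z (f (t, z) + M)) RintegralD// addrK.
  by [].
apply: measurable_funB; last exact: measurable_cst.
by apply: measurableT_comp.
Qed.

Lemma avgD M M' h h' x : meas_col h -> meas_col h' -> bdd M h -> bdd M' h' ->
  avg (fun x => h x + h' x) x = avg h x + avg h' x.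
Proof.
by move=> mh mh' bh bh'; rewrite /avg RintegralD//; apply: avg_integrable; eauto.
Qed.

Lemma avgB M M' h h' x : meas_col h -> meas_col h' -> bdd M h -> bdd M' h' ->
  avg (fun x => h x - h' x) x = avg h x - avg h' x.
Proof.
by move=> mh mh' bh bh'; rewrite /avg RintegralB//; apply: avg_integrable; eauto.
Qed.

Lemma avgZ M c h x : meas_col h -> bdd M h ->
  avg (fun x => c * h x) x = c * avg h x.
Proof.
by move=> mh bh; rewrite /avg RintegralZl//; apply: avg_integrable; eauto.
Qed.

Lemma avg_shift h v x : avg (fun y => h (y + v)) x = avg h (x + v).
Proof. by rewrite /avg; congr fine; apply: eq_integral => t _; rewrite addrAC. Qed.

Lemma avg_le M M' h h' e : meas_col h -> meas_col h' -> bdd M h -> bdd M' h' ->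
  (forall x, `|h x - h' x| <= e) -> forall x, `|avg h x - avg h' x| <= e.
Proof.
move=> mh mh' bh bh' hh' x; rewrite -(avgB _ mh mh' bh bh').
apply: Rint_le_bdd => //.
by apply: measurable_funB; exact: avg_integrand.
Qed.

Lemma avg_cvg M (h : nat -> 'cV[R]_r -> R) g x :
  (forall k, meas_col (h k)) -> (forall k, bdd M (h k)) ->
  (forall y, h k y @[k --> \oo] --> g y) ->
  avg (h k) x @[k --> \oo] --> avg g x.
Proof.
move=> mh bh hg.
have mg : measurable_fun setT (fun t => g (x + V t)).
  apply: (@measurable_fun_cvg _ _ _ _ (fun k t => h k (x + V t))) => [k|t _].
    exact: avg_integrand.
  exact: hg.
have M0 : mu.-integrable setT (EFin \o (fun=> M)).
  exact: finite_measure_integrable_cst.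
have [] := @dominated_convergence _ _ R mu setT measurableT
  (fun k t => (h k (x + V t))%:E) (fun t => (g (x + V t))%:E) (fun=> M%:E).
- by move=> k; apply/measurable_EFinP; exact: avg_integrand.
- exact/measurable_EFinP.
- by apply/aeW => t _; apply/fine_cvgP; split; [exact: nearW|exact: hg].
- exact: M0.
- by apply/aeW => t k _; rewrite lee_fin; exact: bh.
move=> ig _ c.
have E : (\int[mu]_t (g (x + V t))%:E)%E = (avg g x)%:E.
  by rewrite /avg /Rintegral fineK//; exact: integrable_fin_num.
by rewrite E in c; exact: (fine_cvg c).
Qed.

End average.

(** Fubini on the product measure; boundedness gives joint integrability. This is why the Gaussian
    operators commute. *)
Lemma avgC d d' (T : measurableType d) (T' : measurableType d')
    (mu : probability T R) (nu : probability T' R) r (V : T -> 'cV[R]_r)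
    (W : T' -> 'cV[R]_r) M h x : cmeas V -> cmeas W -> meas_col h -> bdd M h ->
  avg mu V (avg nu W h) x = avg nu W (avg mu V h) x.
Proof.
move=> mV mW mh bh.
pose f := fun p : T * T' => (h (x + V p.1 + W p.2))%:E.
have mf : measurable_fun setT f.
  apply/measurable_EFinP; apply: meas_col_comp mh _.
  apply: cmeasD; last by apply: (cmeas_comp mW); exact: measurable_snd.
  apply: cmeasD; first exact: cmeas_cst.
  by apply: (cmeas_comp mV); exact: measurable_fst.
have If : (mu \x nu)%E.-integrable setT f.
  apply: ((@integrable12ltyP _ _ _ _ _ mu nu f mf).2).
  apply: (@le_lt_trans _ _ (\int[mu]_t (M%:E))%E).
    apply: ge0_le_integral => //.
    - by move=> t _; exact: integral_ge0.
    - apply: (@measurable_fun_fubini_tonelli_F _ _ _ _ _ nu (abse \o f)) => //.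
        exact: measurableT_comp.
      by move=> p; exact: abse_ge0.
    - move=> t _; apply: (@le_trans _ _ (\int[nu]_t (M%:E))%E).
        apply: ge0_le_integral => //.
        + by apply: measurableT_comp => //; apply: (measurableT_comp mf); exact: measurable_pair1.
        + by move=> s _; rewrite lee_fin; exact: bh.
      by rewrite integral_cst//= (_ : nu setT = 1%E) ?mule1//; exact: probability_setT.
  rewrite integral_cst//= (_ : mu setT = 1%E) ?mule1 ?ltry//; exact: probability_setT.
have E1 := integral12_prod_meas1 If.
have E2 := integral21_prod_meas1 If.
rewrite /avg; transitivity (fine (\int[mu \x nu]_z f z)%E).
  rewrite -E1; congr fine; apply: eq_integral => t _; rewrite /fubini_F /f /=.
  rewrite /Rintegral fineK//; apply: integrable_fin_num => //.
  by apply: (avg_integrable nu mW _ mh bh).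
rewrite -E2; congr fine; apply: eq_integral => t _; rewrite /fubini_G /f /=.
under eq_integral do rewrite addrAC.
rewrite /Rintegral fineK//; apply: integrable_fin_num => //.
by apply: (avg_integrable mu mV _ mh bh).
Qed.

End meascol.

(** * Smoothing *)

Section calculus.
Context {R : realType}.

(** Turns the uniform remainder estimates, in which smoothness is expressed below, into genuine
    derivatives, to which the mean value theorem applies. *)
Lemma quad_is_derive (f : R -> R) x d C :
  (forall t, `|f (x + t) - f x - t * d| <= C * t ^+ 2) -> is_derive x (1 : R) f d.
Proof.
move=> H.
have C0 : 0 <= C by have := H 1; rewrite expr1n mulr1; apply: le_trans.
have cv : (h^-1 *: ((f \o shift x) (h *: (1 : R)) - f x)) @[h --> 0^'] --> d.
  apply/cvgrPdist_le => e e0; near=> h.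
  have h0 : h != 0 by near: h; exact: nbhs_dnbhs_neq.
  have he : `|h| < e / (C + 1) by near: h; apply: dnbhs0_lt; rewrite divr_gt0// ltr_wpDl.
  have -> : d - h^-1 *: ((f \o shift x) (h *: (1 : R)) - f x) =
      - (h^-1 * (f (x + h) - f x - h * d)).
    rewrite [_ *: _](_ : _ = h^-1 * (f (x + h) - f x)).
      by rewrite !mulrBr mulKf//; ring.
    by rewrite /= /GRing.scale/= mulr1 [h + x]addrC.
  rewrite normrN normrM normfV ler_pdivrMl ?normr_gt0//.
  rewrite (le_trans (H h))// -real_normK ?num_real// expr2 mulrCA.
  rewrite ler_pM2l ?normr_gt0//.
  rewrite ltr_pdivlMr ?ltr_wpDl// in he.
  by rewrite mulrC; apply: le_trans (ltW he); rewrite mulrDr mulr1 lerDl.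
split; first by apply/cvg_ex; exists d.
exact: cvg_lim cv.
Unshelve. all: by end_near. Qed.

Lemma mvt_abs (f df : R -> R) (C a b : R) : a <= b ->
  (forall s, a <= s <= b -> is_derive s (1 : R) f (df s)) ->
  (forall s, a <= s <= b -> `|df s| <= C) -> `|f b - f a| <= C * (b - a).
Proof.
move=> ab fd fC.
have [||c cab ->] := @MVT_segment _ f df a b ab.
- by move=> s; rewrite in_itv/= => /andP[/ltW as' /ltW sb]; apply: fd; rewrite as' sb.
- apply: derivable_within_continuous => s; rewrite in_itv/= => sab.
  by case: (fd _ sab).
rewrite in_itv/= in cab.
by rewrite normrM (ger0_norm (x := b - a)) ?subr_ge0// ler_wpM2r ?subr_ge0// fC.
Qed.

(** Mean value inequality for [s |-> f s - s * df x], whose derivative is at most [L * |t|] between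
    [x] and [x + t]. The window []-T, T[] matches [primitive_window], where the primitive starts at
    [- T] and is differentiable inside a bounded interval. *)
Lemma is_derive_quad (f df : R -> R) (L T : R) x t :
  (forall s, - T < s < T -> is_derive s (1 : R) f (df s)) ->
  (forall s s', `|df s - df s'| <= L * `|s - s'|) ->
  - T < x < T -> - T < x + t < T ->
  `|f (x + t) - f x - t * df x| <= L * t ^+ 2.
Proof.
move=> fd dfL /andP[Tx xT] /andP[Txt xtT].
have L0 : 0 <= L by have := dfL 1 0; rewrite subr0 normr1 mulr1; exact: le_trans.
pose k s := f s - s * df x.
have kd s : - T < s < T -> is_derive s (1 : R) k (df s - df x).
  move=> sT; rewrite /k.
  have H : is_derive s (1 : R) (fun s => df x * s) (df x *: 1).
    exact: (@is_deriveZ _ _ _ id).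
  rewrite [X in _ - X](_ : df x = df x *: 1); last by rewrite /GRing.scale/= mulr1.
  under eq_fun do rewrite [_ * df x]mulrC.
  have := fd _ sT; move=> ?; exact: (@is_deriveB _ _ _ f (fun s => df x * s)).
have -> : f (x + t) - f x - t * df x = k (x + t) - k x by rewrite /k; ring.
have [t0|t0] := leP 0 t.
  have := @mvt_abs k (fun s => df s - df x) (L * t) x (x + t).
  rewrite expr2 mulrA (_ : x + t - x = t); last by ring.
  apply; [by rewrite lerDl|move=> s|].
    by move=> /andP[s1 s2]; apply: kd; rewrite (lt_le_trans Tx)//= (le_lt_trans s2).
  move=> s /andP[s1 s2]; rewrite (le_trans (dfL _ _))// ler_wpM2l//.
  by rewrite ger0_norm ?subr_ge0// lerBlDl.
have := @mvt_abs k (fun s => df s - df x) (L * - t) (x + t) x.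
rewrite (_ : L * - t * (x - (x + t)) = L * t ^+ 2); last by ring.
rewrite distrC; apply; [by rewrite gerDl ltW|move=> s|].
  by move=> /andP[s1 s2]; apply: kd; rewrite (lt_le_trans Txt)//= (le_lt_trans s2).
move=> s /andP[s1 s2]; rewrite (le_trans (dfL _ _))// ler_wpM2l//.
by rewrite distrC ger0_norm ?subr_ge0// lerBlDl -lerBlDr opprK.
Qed.

Lemma lip_continuous (g : R -> R) L :
  (forall s s', `|g s - g s'| <= L * `|s - s'|) -> continuous g.
Proof.
move=> gL x; apply/cvgrPdist_lt => e e0; near=> y.
rewrite (le_lt_trans (gL _ _))//.
rewrite (@le_lt_trans _ _ ((`|L| + 1) * `|x - y|))//.
  by rewrite ler_wpM2r// (le_trans (ler_norm _))// lerDl.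
rewrite -ltr_pdivlMl ?ltr_wpDl// mulrC.
near: y; apply: cvgr_dist_lt => //; last by rewrite divr_gt0// ltr_wpDl.
Unshelve. all: by end_near. Qed.

Lemma primitive_window (g : R -> R) (T : R) : 0 < T -> continuous g ->
  exists G : R -> R, forall x, - T < x < T -> is_derive x (1 : R) G (g x).
Proof.
move=> T0 cg.
pose G x := \int[lebesgue_measure]_(t in `[(- T), x]) g t; exists G => x /andP[Tx xT].
have ig : lebesgue_measure.-integrable `[(- T), T] (EFin \o g).
  apply: continuous_compact_integrable; first exact: segment_compact.
  exact: continuous_subspaceT.
have [dG G'] : derivable G x 1 /\ derive1 G x = g x.
  exact: (continuous_FTC1_closed xT ig Tx (cg x)).
by apply: (DeriveDef dG); rewrite -G' derive1E.
Qed.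

Lemma Rintegral_uniform01 (h : R -> R) (M : R) :
  measurable_fun setT h -> bdd M h ->
  \int[uniform_prob (@ltr01 R)]_y h y = \int[lebesgue_measure]_(y in `[0, 1]) h y.
Proof.
move=> mh bh; have M0 : 0 <= M by exact: le_trans (bh 0).
pose U : probability _ R := uniform_prob (@ltr01 R); rewrite -/U.
have i1 : U.-integrable setT (EFin \o h) by exact: (bdd_integrable U mh bh).
have i2 : U.-integrable setT (EFin \o (fun=> M)).
  exact: finite_measure_integrable_cst.
have mu1 : (@lebesgue_measure R) `[0, 1]%classic = 1%E by rewrite lebesgue_measure_itv/= lte01 oppr0 adde0.
have j2 : (@lebesgue_measure R).-integrable `[0, 1] (EFin \o (fun=> M)).
  apply: measurable_bounded_integrable => //; first by rewrite [X in (X < _)%E]mu1 ltry.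
  exists M; split; first exact: num_real.
  by move=> x Mx t _ /=; rewrite ger0_norm// ltW.
have j1 : (@lebesgue_measure R).-integrable `[0, 1] (EFin \o h).
  apply: measurable_bounded_integrable => //; first by rewrite [X in (X < _)%E]mu1 ltry.
    exact: measurable_funTS.
  exists M; split; first exact: num_real.
  by move=> x Mx t _ /=; rewrite (le_trans (bh _))// ltW.
have E : \int[U]_y (h y + M) = \int[lebesgue_measure]_(y in `[0, 1]) (h y + M).
  rewrite /Rintegral integral_uniform; first by rewrite subr0 invr1 mul1e.
    by apply/measurable_EFinP; apply: measurable_funD => //; exact: measurable_cst.
  by move=> y; rewrite lee_fin -lerBlDr sub0r; have := bh y; rewrite ler_norml => /andP[].
rewrite RintegralD// RintegralD// Rint_prob_cst Rintegral_cst// in E.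
by move: E; rewrite [X in fine X]mu1 mulr1 => /addIr.
Qed.

(** With [G' = g], the average equals [(G (sg + t) - G t) / sg]. Its derivative at [t = 0] is the
    difference quotient of [g], and each of the two endpoints contributes an error [L * t ^+ 2],
    divided by [sg]. *)
Lemma uniform_average_deriv (g : R -> R) (M L sg t : R) : 0 < sg ->
  (forall s s', `|g s - g s'| <= L * `|s - s'|) -> bdd M g ->
  `|\int[uniform_prob (@ltr01 R)]_y g (sg * y + t) -
    \int[uniform_prob (@ltr01 R)]_y g (sg * y) - t * ((g sg - g 0) / sg)|
  <= 2 * L / sg * t ^+ 2.
Proof.
move=> sg0 gL gM.
have cg := lip_continuous gL.
(* The window contains every point [sg * y + s] with [0 <= y <= 1] and [|s| <= |t|]. *)
pose T := sg + `|t| + 1.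
have T0 : 0 < T by rewrite ltr_wpDl// addr_ge0// ltW.
have [G Gd] := primitive_window T0 cg.
have tT := ler_norm t; have tT' := ler_norm (- t); rewrite normrN in tT'.
have E (s : R) : `|s| <= `|t| -> \int[uniform_prob (@ltr01 R)]_y g (sg * y + s) = (G (sg + s) - G s) / sg.
  move=> st; have sT := ler_norm s; have sT' := ler_norm (- s); rewrite normrN in sT'.
  have cgs : continuous (fun y => g (sg * y + s)).
    apply: (@lip_continuous _ (L * sg)) => u v; rewrite (le_trans (gL _ _))//.
    rewrite (_ : _ - _ = sg * (u - v)); last by ring.
    by rewrite normrM (gtr0_norm sg0) mulrA.
  rewrite (@Rintegral_uniform01 _ M); last 2 first.
  - exact: continuous_measurable_fun.
  - by move=> y; exact: gM.
  pose F y := sg^-1 * G (sg * y + s).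
  have Fd (y : R) : 0 <= y <= 1 -> is_derive y (1 : R) F (g (sg * y + s)).
    move=> /andP[y0 y1].
    have d1 : is_derive (sg * y + s) (1 : R) G (g (sg * y + s)).
      apply: Gd; rewrite /T; apply/andP; split; last first.
        rewrite -addrA ler_ltD//; first by rewrite ger_pMr.
        by rewrite (le_lt_trans sT)// ltr_pwDr.
      rewrite ltrNl opprD -addrA ler_ltD//; first by rewrite lerNl (@le_trans _ _ 0)// ?oppr_le0 ?mulr_ge0// ltW.
      by rewrite (le_lt_trans sT')// ltr_pwDr.
    have d2 : is_derive y (1 : R) (fun y => sg * y + s) sg.
      rewrite [X in is_derive _ _ _ X](_ : sg = sg *: 1 + 0); last by rewrite addr0 /GRing.scale/= mulr1.
      apply: is_deriveD; exact: (@is_deriveZ _ _ _ id).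
    have d3 := @is_derive1_comp _ G (fun y => sg * y + s) y _ _ d1 d2.
    have d4 := @is_deriveZ _ _ _ _ sg^-1 y 1 _ d3.
    rewrite [X in is_derive _ _ _ X](_ : _ = sg^-1 *: (g (sg * y + s) * sg))//.
    by rewrite /GRing.scale/= mulrCA mulVf ?mulr1// gt_eqF.
  have cF : {within `[0, 1], continuous F}.
    apply: derivable_within_continuous => y; rewrite in_itv/= => /Fd[]//.
  rewrite /Rintegral (@continuous_FTC2 _ (fun y => g (sg * y + s)) F)//.
  - by rewrite /F /= mulr1 mulr0 add0r -mulrBr mulrC.
  - exact: continuous_subspaceT.
  - have [_ F0 F1] := (continuous_within_itvP F ltr01).1 cF.
    split => // y; rewrite in_itv/= => /andP[/ltW y0 /ltW y1].
    by have [] := Fd y; rewrite ?y0.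
  - move=> y; rewrite in_itv/= => /andP[/ltW y0 /ltW y1].
    have [|_ dFE] := Fd y; first by rewrite y0 y1.
    by rewrite derive1E dFE.
have E0 : \int[uniform_prob (@ltr01 R)]_y g (sg * y) = (G sg - G 0) / sg.
  have := E 0; rewrite normr0 normr_ge0 addr0 => /(_ isT) <-.
  by apply: eq_Rintegral => y _; rewrite addr0.
rewrite E// E0.
have A (a : R) : a = 0 \/ a = sg -> `|G (a + t) - G a - t * g a| <= L * t ^+ 2.
  move=> ha; apply: (is_derive_quad (T := T)) => //.
  - by case: ha => ->; rewrite /T; apply/andP; split; lra.
  - by case: ha => ->; rewrite /T; apply/andP; split; lra.
have A0 := A 0 (or_introl erefl); have A1 := A sg (or_intror erefl).
rewrite add0r in A0.
rewrite (_ : _ - _ - _ = sg^-1 * ((G (sg + t) - G sg - t * g sg) - (G t - G 0 - t * g 0))); last first.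
  by field; rewrite gt_eqF.
rewrite normrM (gtr0_norm (x := sg^-1)) ?invr_gt0//.
rewrite (_ : 2 * L / sg * t ^+ 2 = sg^-1 * (L * t ^+ 2 + L * t ^+ 2)); last by ring.
by rewrite ler_wpM2l ?invr_ge0 ?(ltW sg0)// (le_trans (ler_normB _ _))// lerD.
Qed.

End calculus.

Section smoothing.
Context {R : realType} {r : nat}.
Implicit Types (f g h : 'cV[R]_r -> R) (i j : 'I_r).

Definition bvec i : 'cV[R]_r := delta_mx i 0.

Lemma vnorm_bvec i : vnorm (bvec i) = 1.
Proof.
rewrite /vnorm (bigD1 i)//= mxE !eqxx expr1n big1 ?addr0 ?sqrtr1// => j ji.
by rewrite mxE (negbTE ji) expr0n.
Qed.

(* [g] is the [i]-th partial derivative of [f], with a uniform quadratic remainder. *)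
Definition pderiv i f g (C : R) :=
  forall x t, `|f (x + t *: bvec i) - f x - t * g x| <= C * t ^+ 2.

Definition blip f := (exists M, bdd M f) /\ (exists L, lip L f).

(** The set [I] of controlled directions is a parameter because mollification proceeds one
    coordinate at a time and enlarges it by one direction at each stage. *)
Fixpoint smooth (I : pred 'I_r) (n : nat) f : Prop :=
  if n is n'.+1 then
    blip f /\ forall i, I i -> exists g C, pderiv i f g C /\ smooth I n' g
  else blip f.

Definition jvec (sg : R) i (y : measurableTypeR R) := (sg * y) *: bvec i.

(* Averaging over a segment of direction [i] gains one derivative: the [i]-th
   partial derivative of [jop sg i h] is the difference quotient [dop sg i h]. *)
Definition jop (sg : R) i h := avg (uniform_prob (@ltr01 R)) (jvec sg i) h.

Definition dop (sg : R) i h x := (h (x + sg *: bvec i) - h x) / sg.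

Lemma cmeas_jvec sg i : cmeas (jvec sg i).
Proof.
apply: cmeasZ; first exact: cmeas_cst.
by apply: measurable_funM => //; exact: measurable_cst.
Qed.

Lemma blip_jop sg i h : blip h -> blip (jop sg i h).
Proof.
move=> [[M bh] [L lh]]; split; [exists M|exists L].
  by apply: (avg_bdd _ (cmeas_jvec sg i)) => //; exact: lip_meas_col lh.
exact: (avg_lip _ (cmeas_jvec sg i) bh lh).
Qed.

Lemma blip_dop sg i h : blip h -> blip (dop sg i h).
Proof.
move=> [[M bh] [L lh]]; split; [exists ((M + M) * `|sg^-1|)|exists ((L + L) * `|sg^-1|)].
  by move=> x; rewrite normrM ler_wpM2r// (le_trans (ler_normB _ _))// lerD.
move=> x y; rewrite -mulrBl normrM mulrAC ler_wpM2r//.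
rewrite (_ : _ - _ = (h (x + sg *: bvec i) - h (y + sg *: bvec i)) - (h x - h y)); last by ring.
rewrite (le_trans (ler_normB _ _))// mulrDl lerD//.
by rewrite (le_trans (lh _ _))// opprD addrACA subrr addr0.
Qed.

Lemma jop_pderiv sg i h : 0 < sg -> blip h ->
  exists C, pderiv i (jop sg i h) (dop sg i h) C.
Proof.
move=> sg0 [[M bh] [L lh]]; exists (2 * L / sg) => x t.
have := @uniform_average_deriv R (fun s => h (x + s *: bvec i)) M L sg t sg0.
rewrite scale0r addr0 /dop /jop /avg /jvec.
rewrite [X in `|X - _ - _|](_ : _ = \int[uniform_prob (@ltr01 R)]_y
    h (x + t *: bvec i + (sg * y) *: bvec i)); last first.
  by apply: eq_Rintegral => y _; rewrite addrAC -addrA scalerDl addrA.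
move=> H; apply: H => [s s'|s]; last exact: bh.
rewrite (le_trans (lh _ _))// opprD addrACA subrr add0r -scalerBl vnormZ.
by rewrite vnorm_bvec mulr1.
Qed.

(** The remainder of the average is the average of the remainders, so [C] is unchanged. *)
Lemma pderiv_jop sg i j f g C : blip f -> blip g -> pderiv i f g C ->
  pderiv i (jop sg j f) (jop sg j g) C.
Proof.
move=> [[M bf] [L lf]] [[M' bg] [L' lg]] fg x t.
have mf := lip_meas_col lf; have mg := lip_meas_col lg.
pose ft := fun x => f (x + t *: bvec i) - f x.
have mft' : meas_col (fun x => f (x + t *: bvec i)).
  by under eq_fun do rewrite addrC; exact: meas_col_shift.
have bft' : bdd M (fun x => f (x + t *: bvec i)) by move=> y; exact: bf.
have mft : meas_col ft by apply: measurable_funB.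
have bft : bdd (M + M) ft by move=> y; rewrite (le_trans (ler_normB _ _))// lerD.
have mtg : meas_col (fun x => t * g x) by apply: measurable_funM => //; exact: measurable_cst.
have btg : bdd (`|t| * M') (fun x => t * g x) by move=> y; rewrite normrM ler_wpM2l.
have mV := cmeas_jvec sg j.
have := @avg_le _ _ _ (uniform_prob (@ltr01 R)) _ _ mV _ _ ft _ _ mft mtg bft btg (fun x => fg x t) x.
pose U : probability _ R := uniform_prob (@ltr01 R).
have -> : avg U (jvec sg j) ft x = jop sg j f (x + t *: bvec i) - jop sg j f x.
  by rewrite (@avgB _ _ _ U _ _ mV _ _ _ _ x mft' mf bft' bf) avg_shift.
by rewrite (@avgZ _ _ _ U _ _ mV _ t _ x mg bg).
Qed.

Lemma pderiv_dop sg i j f g C : pderiv i f g C ->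
  pderiv i (dop sg j f) (dop sg j g) (2 * C / `|sg|).
Proof.
move=> fg x t; rewrite /dop.
rewrite (_ : _ - _ - _ = ((f (x + sg *: bvec j + t *: bvec i) - f (x + sg *: bvec j) - t * g (x + sg *: bvec j)) - (f (x + t *: bvec i) - f x - t * g x)) / sg); last first.
  by rewrite [x + t *: _ + _]addrAC; ring.
rewrite normrM normfV mulrAC ler_wpM2r ?invr_ge0//.
by rewrite (le_trans (ler_normB _ _))// mulr2n mulrDl mul1r mulrDl lerD.
Qed.

Lemma smooth_blip I n f : smooth I n f -> blip f.
Proof. by case: n => [|n] //= []. Qed.

Lemma smooth_sub (I J : pred 'I_r) n f : (forall i, J i -> I i) ->
  smooth I n f -> smooth J n f.
Proof.
move=> JI; elim: n f => [|n IH] f //= [bf H]; split => // i /JI /H[g [C [fg sg]]].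
by exists g, C; split => //; exact: IH.
Qed.

Lemma smooth_jop I n sg j f : smooth I n f -> smooth I n (jop sg j f).
Proof.
elim: n f => [|n IH] f /=; first exact: blip_jop.
move=> [bf H]; split; first exact: blip_jop.
move=> i Ii; have [g [C [fg sg_]]] := H i Ii.
exists (jop sg j g), C; split; last exact: IH.
by apply: pderiv_jop => //; exact: smooth_blip sg_.
Qed.

Lemma smooth_dop I n sg j f : smooth I n f -> smooth I n (dop sg j f).
Proof.
elim: n f => [|n IH] f /=; first exact: blip_dop.
move=> [bf H]; split; first exact: blip_dop.
move=> i Ii; have [g [C [fg sg_]]] := H i Ii.
exists (dop sg j g), (2 * C / `|sg|); split; last exact: IH.
exact: pderiv_dop.
Qed.

Lemma smoothS I n f : smooth I n.+1 f -> smooth I n f.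
Proof.
elim: n f => [|n IH] f [bf H] //; split=> // i Ii.
by have [g [C [fg sg_]]] := H i Ii; exists g, C; split => //; exact: IH.
Qed.

Lemma smooth_iter_jop I n m sg j f :
  smooth I n f -> smooth I n (iter m (jop sg j) f).
Proof. by elim: m => //= m IH /IH; exact: smooth_jop. Qed.

(** In direction [j], the derivative of the last average is a difference quotient of the previous
    iterate, which already has one order less. In the directions of [I], differentiation commutes
    with the averages. *)
Lemma smooth_extend I n sg j f : 0 < sg -> smooth I n f ->
  smooth (predU1 j I) n (iter n (jop sg j) f).
Proof.
move=> sg0; elim: n f => [|n IH] f // sf.
have sf' := IH f (smoothS sf); have [bf H] := sf.
have bj m : blip (iter m (jop sg j) f).
  by have := smooth_iter_jop m sg j sf => /smooth_blip.
rewrite iterS; split; first exact: blip_jop.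
move=> i /=; have [->|ij] := eqVneq i j.
  move=> _; have [C HC] := jop_pderiv j sg0 (bj n).
  by exists (dop sg j (iter n (jop sg j) f)), C; split => //; exact: smooth_dop.
move=> /orP[/eqP //|Ii].
have [g [C [fg sg_]]] := H i Ii.
exists (iter n.+1 (jop sg j) g), C; split; last first.
  by rewrite iterS; apply: smooth_jop; exact: IH.
rewrite -iterS; elim: n.+1 => // m IHm; rewrite !iterS; apply: pderiv_jop => //.
by have := smooth_iter_jop m sg j sg_ => /smooth_blip.
Qed.

Lemma jop_close sg i L h x : 0 < sg -> blip h -> lip L h -> `|jop sg i h x - h x| <= L * sg.
Proof.
move=> sg0 [[M bh] _] lh.
have L0 : 0 <= L by have := lh x (x + bvec i); rewrite opprD addNKr vnormN vnorm_bvec mulr1; exact: le_trans.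
have mh := lip_meas_col lh; have mV := cmeas_jvec sg i.
rewrite -[X in _ - X](Rint_prob_cst (uniform_prob (@ltr01 R))) -RintegralB//; last 2 first.
  by apply: (avg_integrable _ mV x mh bh).
  exact: finite_measure_integrable_cst.
pose k y := h (x + (sg * y) *: bvec i) - h x.
have mk : measurable_fun setT k.
  by apply: measurable_funB => //; exact: (avg_integrand (T := measurableTypeR R) mV x mh).
have kb : bdd (M + M) k by move=> y; rewrite (le_trans (ler_normB _ _))// lerD.
rewrite [X in `|X|](_ : _ = \int[uniform_prob (@ltr01 R)]_y k y)//.
(* Passing to Lebesgue measure on [[0, 1]] makes [|sg * y| <= sg] available at every point of
   integration; under the uniform law on the whole line it would hold only almost surely. *)
rewrite (Rintegral_uniform01 mk kb).
have mu1 : (@lebesgue_measure R) `[0, 1]%classic = 1%E.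
  by rewrite lebesgue_measure_itv/= lte01 oppr0 adde0.
have j c : (@lebesgue_measure R).-integrable `[0, 1] (EFin \o (fun=> c)).
  apply: measurable_bounded_integrable => //; first by rewrite [X in (X < _)%E]mu1 ltry.
  exists `|c|; split; first exact: num_real.
  by move=> y cy t _ /=; rewrite ltW.
have jk : (@lebesgue_measure R).-integrable `[0, 1] (EFin \o k).
  apply: measurable_bounded_integrable => //; first by rewrite [X in (X < _)%E]mu1 ltry.
    exact: measurable_funTS.
  exists (M + M); split; first exact: num_real.
  by move=> y My t _ /=; rewrite (le_trans (kb _))// ltW.
rewrite (le_trans (le_normr_Rintegral _ jk))//.
rewrite [leRHS](_ : _ = \int[lebesgue_measure]_(y in `[0, 1]) (L * sg)); last first.
  by rewrite Rintegral_cst// [X in fine X]mu1 mulr1.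
apply: le_Rintegral => //; first exact: integrable_norm.
move=> y; rewrite /= in_itv/= => /andP[y0 y1].
rewrite (le_trans (lh _ _))// addrAC subrr add0r vnormZ vnorm_bvec mulr1.
by rewrite ler_wpM2l// ger0_norm ?mulr_ge0// ?(ltW sg0)// ger_pMr.
Qed.

Lemma jop_lip sg i L h : blip h -> lip L h -> lip L (jop sg i h).
Proof. by move=> [[M bh] _] lh; exact: (avg_lip _ (cmeas_jvec sg i) bh lh). Qed.

Definition mollify sg n h := foldr (fun i f => iter n (jop sg i) f) h (enum 'I_r).

Lemma iter_jop_close sg n i L h : 0 < sg -> blip h -> lip L h ->
  [/\ blip (iter n (jop sg i) h), lip L (iter n (jop sg i) h) &
    forall x, `|iter n (jop sg i) h x - h x| <= n%:R * (L * sg)].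
Proof.
move=> sg0 bh lh; elim: n => [|n [IH1 IH2 IH3]].
  by split => // x; rewrite subrr normr0 mul0r.
rewrite iterS; split; [exact: blip_jop|exact: jop_lip|move=> x].
rewrite -(subrKA (iter n (jop sg i) h x)) (le_trans (ler_normD _ _))//.
by rewrite -[n.+1]add1n natrD mulrDl mul1r lerD// jop_close.
Qed.

(** There are [r * n] averages; each displaces the function by at most [L * sg] and none increases
    the Lipschitz constant. *)
Lemma mollify_spec sg n L h : 0 < sg -> blip h -> lip L h ->
  smooth predT n (mollify sg n h) /\
  forall x, `|mollify sg n h x - h x| <= r%:R * (n%:R * (L * sg)).
Proof.
move=> sg0 bh lh; rewrite /mollify.
have : [/\ smooth (mem (enum 'I_r)) n (mollify sg n h), lip L (mollify sg n h) &
    forall x, `|mollify sg n h x - h x| <= (size (enum 'I_r))%:R * (n%:R * (L * sg))].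
  rewrite /mollify; elim: (enum 'I_r) => [|i s [IH1 IH2 IH3]] /=.
    split=> //; last by move=> x; rewrite subrr normr0 mul0r.
    by case: n => [|n] //=; split.
  have [b1 b2 b3] := iter_jop_close n i sg0 (smooth_blip IH1) IH2.
  split => //.
    apply: smooth_sub (smooth_extend i sg0 IH1) => k /=.
    by rewrite inE.
  move=> x; rewrite -(subrKA (foldr (fun i f => iter n (jop sg i) f) h s x)).
  by rewrite (le_trans (ler_normD _ _))// -[(size s).+1]add1n natrD mulrDl mul1r lerD.
rewrite size_enum_ord => -[H1 _ H3]; split => //.
by apply: smooth_sub H1 => k _ /=; rewrite mem_enum.
Qed.

End smoothing.

(** * Second-order Taylor expansion with a uniform constant *)

Section taylor.
Context {R : realType} {r : nat}.
Implicit Types (f g h : 'cV[R]_r -> R) (i j : 'I_r) (x e : 'cV[R]_r).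

Lemma bdd_ge0 M f : bdd M f -> 0 <= M.
Proof. by move=> /(_ 0); exact: le_trans. Qed.

Lemma sumv_bvec (x : 'cV[R]_r) : x = \sum_i x i 0 *: bvec i.
Proof.
apply/colP => k; rewrite summxE (bigD1 k)//= !mxE !eqxx mulr1 big1 ?addr0// => j jk.
by rewrite !mxE eq_sym (negbTE jk) mulr0.
Qed.

Lemma sum_coord_le n (F G : 'I_n -> R) (a b : R) :
  (forall k, `|F k| <= a) -> (forall k, `|G k| <= b) ->
  `|\sum_k F k * G k| <= n%:R * (a * b).
Proof.
move=> Fa Gb; rewrite (le_trans (ler_norm_sum _ _ _))//.
rewrite (@le_trans _ _ (\sum_(k < n) a * b))//.
  by apply: ler_sum => k _; rewrite normrM ler_pM.
by rewrite sumr_const card_ord -[leLHS]mulr_natl.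
Qed.

(** Move along one coordinate at a time. The partial derivative used at an intermediate point
    differs from the one at [x] by at most a multiple of [vnorm e], by the Lipschitz property, and
    this difference is multiplied by a coordinate of [e]. *)
Lemma partials_differential (f : 'cV[R]_r -> R) (D : 'I_r -> 'cV[R]_r -> R) C L :
  (forall i, pderiv i f (D i) C) -> (forall i, lip L (D i)) -> 0 <= C -> 0 <= L ->
  exists2 K, 0 <= K & forall x e,
    `|f (x + e) - f x - \sum_i e i 0 * D i x| <= K * vnorm e ^+ 2.
Proof.
move=> fD DL C0 L0.
suff H (s : seq 'I_r) : exists2 K, 0 <= K & forall x e,
    `|f (x + \sum_(i <- s) e i 0 *: bvec i) - f x - \sum_(i <- s) e i 0 * D i x|
    <= K * vnorm e ^+ 2.
  have [K K0 HK] := H (index_enum 'I_r); exists K => // x e.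
  by rewrite {1}(sumv_bvec e).
elim: s => [|i s [K K0 IH]].
  by exists 0 => // x e; rewrite !big_nil addr0 !subrr normr0 mul0r.
exists (C + L * (size s)%:R + K); first by rewrite !addr_ge0// mulr_ge0.
move=> x e; rewrite !big_cons.
set S := \sum_(_ <- _) _ *: _; set T := \sum_(_ <- _) _ * _.
have -> : x + (e i 0 *: bvec i + S) = x + S + e i 0 *: bvec i.
  by rewrite -addrA [S + _]addrC.
rewrite (_ : _ - _ - _ = (f (x + S + e i 0 *: bvec i) - f (x + S) - e i 0 * D i (x + S))
  + e i 0 * (D i (x + S) - D i x) + (f (x + S) - f x - T)); last by ring.
have Sle : vnorm S <= (size s)%:R * vnorm e.
  rewrite (le_trans (vnorm_sum _ _ _))//.
  rewrite (@le_trans _ _ (\sum_(k <- s) vnorm e))//.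
    by apply: ler_sum => k _; rewrite vnormZ vnorm_bvec mulr1 ler_coord_vnorm.
  by rewrite big_const_seq count_predT iter_addr_0 mulr_natl.
have e0 := ler_coord_vnorm e i; have v0 := vnorm_ge0 e.
rewrite (le_trans (ler_normD _ _))// mulrDl lerD ?IH//.
rewrite (le_trans (ler_normD _ _))// mulrDl lerD//.
  rewrite (le_trans (fD _ _ _))// ler_wpM2l//.
  by rewrite -real_normK ?num_real// ler_sqr ?nnegrE.
rewrite normrM expr2 (_ : _ * (_ * _) = vnorm e * (L * ((size s)%:R * vnorm e))); last by ring.
apply: ler_pM => //; rewrite (le_trans (DL _ _ _))// addrAC subrr add0r.
by rewrite ler_wpM2l.
Qed.

Definition hess (H : 'I_r -> 'I_r -> 'cV[R]_r -> R) (e x : 'cV[R]_r) :=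
  \sum_i e i 0 * \sum_j e j 0 * H i j x.

(** The cubic bound serves small increments and the quadratic one large increments, so the remainder
    is integrable under second moments and still of smaller order than the variance. A single [K]
    controls everything, which makes the class stable under averaging. *)
Definition taylor2 (K : R) f (D : 'I_r -> 'cV[R]_r -> R)
    (H : 'I_r -> 'I_r -> 'cV[R]_r -> R) : Prop :=
  [/\ 0 <= K, (bdd K f /\ lip K f), (forall i, bdd K (D i) /\ lip K (D i)),
      (forall i j, bdd K (H i j) /\ lip K (H i j)) &
   forall x e, `|f (x + e) - f x - \sum_i e i 0 * D i x - 2^-1 * hess H e x|
     <= K * Num.min (vnorm e ^+ 2) (vnorm e ^+ 3)].

Lemma blip_unif (I : finType) (F : I -> 'cV[R]_r -> R) :
  (forall k, blip (F k)) -> exists2 K, 0 <= K & forall k, bdd K (F k) /\ lip K (F k).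
Proof.
move=> bF.
have [M HM] := choice (fun k => (bF k).1).
have [L HL] := choice (fun k => (bF k).2).
exists (\sum_k (`|M k| + `|L k|)); first by apply: sumr_ge0 => k _; rewrite addr_ge0.
move=> k; have Hi : `|M k| + `|L k| <= \sum_k (`|M k| + `|L k|).
  by rewrite (bigD1 k)//= lerDl sumr_ge0// => l _; rewrite addr_ge0.
split => [x|x y].
  by rewrite (le_trans (HM k x))// (le_trans (ler_norm _))// (le_trans _ Hi)// lerDl.
rewrite (le_trans (HL k x y))// ler_wpM2r ?vnorm_ge0//.
by rewrite (le_trans (ler_norm _))// (le_trans _ Hi)// lerDr.
Qed.

Lemma bdd_le K K' f : K <= K' -> bdd K f -> bdd K' f.
Proof. by move=> KK bf x; exact: le_trans (bf x) KK. Qed.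

Lemma lip_le K K' f : K <= K' -> lip K f -> lip K' f.
Proof.
by move=> KK lf x y; rewrite (le_trans (lf x y))// ler_wpM2r ?vnorm_ge0.
Qed.

Lemma pderiv_le i C C' f g : C <= C' -> pderiv i f g C -> pderiv i f g C'.
Proof.
by move=> CC H x t; rewrite (le_trans (H x t))// ler_wpM2r ?sqr_ge0.
Qed.

(* Along the segment [x, x + e] the partial derivatives give genuine first and second derivatives. *)
Lemma taylor_cubic f D H K : 0 <= K ->
  (forall x e, `|f (x + e) - f x - \sum_i e i 0 * D i x| <= K * vnorm e ^+ 2) ->
  (forall i x e, `|D i (x + e) - D i x - \sum_j e j 0 * H i j x| <= K * vnorm e ^+ 2) ->
  (forall i j, lip K (H i j)) ->
  forall x e, `|f (x + e) - f x - \sum_i e i 0 * D i x - 2^-1 * hess H e x|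
    <= r%:R * r%:R * K * vnorm e ^+ 3.
Proof.
move=> K0 fD DH HL x e.
have v0 := vnorm_ge0 e.
pose g0 t := f (x + t *: e).
pose g1 t := \sum_i e i 0 * D i (x + t *: e).
pose g2 t := hess H e (x + t *: e).
have shf t s : x + (t + s) *: e = (x + t *: e) + s *: e by rewrite scalerDl addrA.
have d0 t s : `|g0 (t + s) - g0 t - s * g1 t| <= K * vnorm e ^+ 2 * s ^+ 2.
  rewrite /g0 /g1 shf mulr_sumr.
  rewrite [X in _ - X](_ : _ = \sum_i (s *: e) i 0 * D i (x + t *: e)); last first.
    by apply: eq_bigr => i _; rewrite mxE mulrA.
  rewrite (le_trans (fD _ _))// vnormZ exprMn real_normK ?num_real//.
  by rewrite -mulrA ler_wpM2l// mulrC.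
have d1 t s : `|g1 (t + s) - g1 t - s * g2 t| <= r%:R * (vnorm e * (K * vnorm e ^+ 2)) * s ^+ 2.
  rewrite /g1 /g2 /hess mulr_sumr -!sumrB.
  rewrite [X in `|X|](_ : _ = \sum_i e i 0 * (D i (x + t *: e + s *: e) - D i (x + t *: e)
     - \sum_j (s *: e) j 0 * H i j (x + t *: e))); last first.
    apply: eq_bigr => i _; rewrite shf !mulrBr; congr (_ - _).
    rewrite mulrCA; congr (_ * _); rewrite mulr_sumr.
    by apply: eq_bigr => j _; rewrite mxE mulrA.
  rewrite -mulrA (le_trans (@sum_coord_le _ _ _ (vnorm e) (K * (s ^+ 2 * vnorm e ^+ 2)) _ _))//.
  - by move=> k; exact: ler_coord_vnorm.
  - by move=> k; rewrite (le_trans (DH _ _ _))// vnormZ exprMn real_normK ?num_real.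
  - by rewrite le_eqVlt; apply/orP; left; apply/eqP; ring.
have g2L t s : `|g2 t - g2 s| <= r%:R * r%:R * K * vnorm e ^+ 3 * `|t - s|.
  rewrite /g2 /hess -sumrB.
  rewrite [X in `|X|](_ : _ = \sum_i e i 0 * \sum_j e j 0 *
    (H i j (x + t *: e) - H i j (x + s *: e))); last first.
    apply: eq_bigr => i _; rewrite -mulrBr -sumrB; congr (_ * _).
    by apply: eq_bigr => j _; rewrite mulrBr.
  rewrite (le_trans (@sum_coord_le _ _ _ (vnorm e) (r%:R * (vnorm e * (K * (`|t - s| * vnorm e)))) _ _))//.
  - by move=> k; exact: ler_coord_vnorm.
  - move=> k; apply: sum_coord_le => [l|l]; first exact: ler_coord_vnorm.
    by rewrite (le_trans (HL _ _ _ _))// opprD addrACA subrr add0r -scalerBl vnormZ.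
  - by rewrite le_eqVlt; apply/orP; left; apply/eqP; ring.
have D0 t : is_derive t (1 : R) g0 (g1 t) by apply: quad_is_derive (d0 t).
have D1 t : is_derive t (1 : R) g1 (g2 t) by apply: quad_is_derive (d1 t).
have q1 t : 0 <= t <= 1 -> `|g1 t - g1 0 - t * g2 0| <= r%:R * r%:R * K * vnorm e ^+ 3.
  move=> /andP[t0 t1].
  have := @is_derive_quad R g1 g2 _ 2 0 t (fun s _ => D1 s) g2L.
  rewrite add0r => Hq; apply: le_trans (Hq _ _) _.
  - by apply/andP; split; lra.
  - by apply/andP; split; lra.
  rewrite -[leRHS]mulr1 ler_wpM2l ?mulr_ge0 ?exprn_ge0//.
  by rewrite expr_le1.
(* The derivative of [k] is [g1 t - g1 0 - t * g2 0], bounded on [[0, 1]] by [q1]; one more mean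
   value inequality gives the remainder at [t = 1]. *)
pose k t := g0 t - t * g1 0 - 2^-1 * t ^+ 2 * g2 0.
have kd t : is_derive t (1 : R) k (g1 t - g1 0 - t * g2 0).
  apply: (@quad_is_derive _ _ _ _ (K * vnorm e ^+ 2 + `|2^-1 * g2 0|)) => s.
  rewrite /k (_ : _ - _ - _ = (g0 (t + s) - g0 t - s * g1 t) - 2^-1 * g2 0 * s ^+ 2); last by field.
  rewrite (le_trans (ler_normB _ _))// mulrDl lerD ?d0// normrM.
  by rewrite (ger0_norm (sqr_ge0 s)).
have := @mvt_abs R k (fun t => g1 t - g1 0 - t * g2 0) (r%:R * r%:R * K * vnorm e ^+ 3) 0 1 ler01
  (fun s _ => kd s) q1.
rewrite subr0 mulr1; rewrite [X in `|X| <= _ -> _](_ : _ = f (x + e) - f x - \sum_i e i 0 * D i x - 2^-1 * hess H e x)//.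
rewrite /k /g0 /g1 /g2 !scale1r !scale0r !addr0 expr0n expr1n mulr0 mul0r mulr1 !mul1r mul0r !subr0.
ring.
Qed.

Lemma sum_fin_ge (I : finType) (C : I -> R) (k : I) : C k <= \sum_l `|C l|.
Proof.
by rewrite (le_trans (ler_norm _))// (bigD1 k)//= lerDl sumr_ge0.
Qed.

Lemma smooth_taylor2 f : smooth predT 2 f -> exists K D H, taylor2 K f D H.
Proof.
move=> [bf Hf].
have [D HD] := choice (fun i => Hf i isT).
have [C1 HC1] := choice HD.
have AH i : exists Hi : 'I_r -> 'cV[R]_r -> R,
    forall j, exists C, pderiv j (D i) (Hi j) C /\ blip (Hi j).
  have A j : exists Hj, exists C, pderiv j (D i) Hj C /\ blip Hj.
    by have [_ [_ /(_ j isT)]] := HC1 i.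
  by have [Hi HHi] := choice A; exists Hi.
have [H HH] := choice AH.
have AC i : exists Ci : 'I_r -> R, forall j, pderiv j (D i) (H i j) (Ci j) /\ blip (H i j).
  by have [Ci HCi] := choice (HH i); exists Ci.
have [C2 HC2] := choice AC.
have [K1 K10 HK1] := blip_unif (fun i : 'I_r => (HC1 i).2.1).
have [K2 K20 HK2] := blip_unif (F := fun p : 'I_r * 'I_r => H p.1 p.2) (fun p => (HC2 p.1 p.2).2).
have [K3 K30 HK3] := blip_unif (F := fun _ : unit => f) (fun=> bf).
have [Ka Ka0 HKa] : exists2 Ka, 0 <= Ka & forall x e,
    `|f (x + e) - f x - \sum_i e i 0 * D i x| <= Ka * vnorm e ^+ 2.
  apply: (@partials_differential _ _ (\sum_i `|C1 i|) K1) => //.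
  - by move=> i; apply: pderiv_le (HC1 i).1; exact: sum_fin_ge.
  - by move=> i; exact: (HK1 i).2.
  - by apply: sumr_ge0.
have [Kb Kb0 HKb] : exists2 Kb, 0 <= Kb & forall i x e,
    `|D i (x + e) - D i x - \sum_j e j 0 * H i j x| <= Kb * vnorm e ^+ 2.
  have Hi i : exists Kb, 0 <= Kb /\ forall x e,
      `|D i (x + e) - D i x - \sum_j e j 0 * H i j x| <= Kb * vnorm e ^+ 2.
    have [||||K K0 HK] := @partials_differential (D i) (H i) (\sum_j `|C2 i j|) K2 => //.
    - by move=> j; apply: pderiv_le (HC2 i j).1; exact: (@sum_fin_ge 'I_r (C2 i)).
    - by move=> j; exact: (HK2 (i, j)).2.
    - by apply: sumr_ge0.
    - by exists K.
  have [B HB] := choice Hi; exists (\sum_i `|B i|); first by apply: sumr_ge0.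
  move=> i x e; rewrite (le_trans ((HB i).2 x e))// ler_wpM2r ?exprn_ge0 ?vnorm_ge0//.
  exact: sum_fin_ge.
pose K := K1 + K2 + K3 + Ka + Kb.
have K0 : 0 <= K by rewrite !addr_ge0.
have [le1 le2 le3 le4 le5] : [/\ K1 <= K, K2 <= K, K3 <= K, Ka <= K & Kb <= K].
  by rewrite /K; split; lra.
have Tc : forall x e, `|f (x + e) - f x - \sum_i e i 0 * D i x - 2^-1 * hess H e x|
    <= r%:R * r%:R * K * vnorm e ^+ 3.
  apply: taylor_cubic => //.
  - by move=> x e; rewrite (le_trans (HKa x e))// ler_wpM2r ?exprn_ge0 ?vnorm_ge0.
  - by move=> i x e; rewrite (le_trans (HKb i x e))// ler_wpM2r ?exprn_ge0 ?vnorm_ge0.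
  - by move=> i j; apply: lip_le (HK2 (i, j)).2.
(* For [vnorm e <= 1] the cubic estimate applies. For larger [e] the first-order remainder
   contributes [K] and the Hessian term half of [r ^+ 2 * K], both times [vnorm e ^+ 2]. *)
pose KK := K + r%:R * r%:R * K.
have rK : 0 <= r%:R * r%:R * K by rewrite !mulr_ge0.
have KKK : K <= KK by rewrite lerDl.
have KKK' : K <= KK + K by rewrite lerDr (le_trans K0).
exists (KK + K), D, H; split.
- by rewrite addr_ge0// (le_trans K0).
- have [a b] := HK3 tt; have le6 := le_trans le3 KKK'.
  by split; [exact: bdd_le a|exact: lip_le b].
- move=> i; have [a b] := HK1 i; have le6 := le_trans le1 KKK'.
  by split; [exact: bdd_le a|exact: lip_le b].
- move=> i j; have [a b] := HK2 (i, j); have le6 := le_trans le2 KKK'.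
  by split; [exact: bdd_le a|exact: lip_le b].
move=> x e; have v0 := vnorm_ge0 e.
have [ve|ve] := leP (vnorm e) 1.
  have -> : Num.min (vnorm e ^+ 2) (vnorm e ^+ 3) = vnorm e ^+ 3.
    by apply/min_idPr; rewrite exprS ler_piMl ?exprn_ge0.
  by rewrite (le_trans (Tc x e))// ler_wpM2r ?exprn_ge0// /KK; lra.
have -> : Num.min (vnorm e ^+ 2) (vnorm e ^+ 3) = vnorm e ^+ 2.
  by apply/min_idPl; rewrite [leRHS]exprS ler_peMl ?exprn_ge0// ltW.
rewrite (le_trans (ler_normB _ _))// mulrDl [leRHS]addrC lerD//.
  by rewrite (le_trans (HKa x e))// ler_wpM2r ?exprn_ge0.
rewrite normrM ger0_norm ?invr_ge0//.
have Hh : `|hess H e x| <= r%:R * (vnorm e * (r%:R * (vnorm e * K))).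
  apply: sum_coord_le => [i|i]; first exact: ler_coord_vnorm.
  apply: sum_coord_le => [j|j]; first exact: ler_coord_vnorm.
  exact: bdd_le le2 (HK2 (i, j)).1 x.
rewrite (le_trans (ler_wpM2l _ Hh)) ?invr_ge0//.
rewrite (_ : 2^-1 * _ = 2^-1 * (r%:R * r%:R * K) * vnorm e ^+ 2); last by ring.
rewrite ler_wpM2r ?exprn_ge0//; rewrite /KK; lra.
Qed.

End taylor.

(** * Gaussian operators *)

Section normal.
Context {R : realType}.
Local Notation leb := (@lebesgue_measure R).

(** Change of variables through the Radon-Nikodym derivative, which agrees almost everywhere with
    the explicit density because both have the same integral over every measurable set. *)
Lemma ge0_integral_normal_prob (m s : R) (f : R -> \bar R) :
  measurable_fun setT f -> (forall x, 0 <= f x)%E ->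
  (\int[normal_prob m s]_x f x = \int[leb]_x (f x * (normal_pdf m s x)%:E))%E.
Proof.
move=> mf f0.
have dom := normal_prob_dominates m s.
rewrite -(Radon_Nikodym_SigmaFinite.change_of_variables dom)//.
apply: ae_eq_integral => //.
- apply: emeasurable_funM => //.
  apply: measurable_int (Radon_Nikodym_SigmaFinite.f_integrable dom).
- apply: emeasurable_funM => //.
  by apply/measurable_EFinP; exact: measurable_normal_pdf.
- suff : ae_eq leb setT (Radon_Nikodym_SigmaFinite.f (normal_prob m s) leb)
      (fun x => (normal_pdf m s x)%:E).
    by apply: filterS => x /= /[apply] ->.
  apply: integral_ae_eq => //.
  + exact: Radon_Nikodym_SigmaFinite.f_integrable.
  + by apply/measurable_EFinP; exact: measurable_normal_pdf.
  + by move=> E _ mE; rewrite -Radon_Nikodym_SigmaFinite.f_integral.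
Qed.

Lemma integrable_normal_prob (m s : R) (f : R -> R) :
  measurable_fun setT f ->
  leb.-integrable setT (EFin \o (fun x => f x * normal_pdf m s x)) ->
  (normal_prob m s).-integrable setT (EFin \o f).
Proof.
move=> mf /integrableP[_ fi]; apply/integrableP; split; first exact/measurable_EFinP.
rewrite ge0_integral_normal_prob//; last by do 2 apply: measurableT_comp => //.
apply: le_lt_trans fi; rewrite le_eqVlt; apply/orP; left; apply/eqP.
apply: eq_integral => x _ /=.
by rewrite -EFinM normrM (ger0_norm (normal_pdf_ge0 _ _ _)).
Qed.

Lemma Rintegral_normal_prob (m s : R) (f : R -> R) :
  measurable_fun setT f ->
  leb.-integrable setT (EFin \o (fun x => f x * normal_pdf m s x)) ->
  \int[normal_prob m s]_x f x = \int[leb]_x (f x * normal_pdf m s x).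
Proof.
move=> mf fi.
have gi := integrable_normal_prob mf fi.
have mp := @measurable_normal_pdf R m s.
have ge0 (g : R -> R) : measurable_fun setT g -> (forall x, 0 <= g x) ->
    \int[normal_prob m s]_x g x = \int[leb]_x (g x * normal_pdf m s x).
  move=> mg g0; rewrite /Rintegral ge0_integral_normal_prob//.
  exact/measurable_EFinP.
have mnf : measurable_fun setT (fun x => `|f x|) by exact: measurableT_comp.
have ni : leb.-integrable setT (EFin \o (fun x => `|f x| * normal_pdf m s x)).
  have := integrable_norm fi; apply: eq_integrable => // x _ /=.
  by rewrite normrM (ger0_norm (normal_pdf_ge0 _ _ _)).
(* A signed [f] is the difference of the nonnegative functions [f + |f|] and [|f|]. *)
have := ge0 (fun x => f x + `|f x|).
rewrite RintegralD//; last exact: integrable_norm.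
rewrite (ge0 _ mnf)//.
under [in X in _ -> _ -> _ = X]eq_Rintegral do rewrite mulrDl.
rewrite RintegralD//.
move=> H; apply: (addIr _ (H _ _)); first exact: measurable_funD.
by move=> x; rewrite addrC -lerBlDr sub0r -normrN ler_norm.
Qed.

Lemma bdd_integrable_pdf (m s M : R) (g : R -> R) :
  measurable_fun setT g -> bdd M g ->
  leb.-integrable setT (EFin \o (fun x => g x * normal_pdf m s x)).
Proof.
move=> mg bg; apply: (@le_integrable _ _ _ leb _ measurableT _ (fun x => (M * normal_pdf m s x)%:E)).
- by apply/measurable_EFinP; apply: measurable_funM => //; exact: measurable_normal_pdf.
- move=> x _ /=; rewrite lee_fin !normrM ler_wpM2r//.
  by rewrite (le_trans (bg x))// ler_norm.
- under eq_fun do rewrite EFinM; apply: integrableZl => //.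
  exact: integrable_normal_pdf.
Qed.

(** The rescaled image of Lebesgue measure under the affine map has the right value on half-open
    intervals, hence is Lebesgue measure. *)
Lemma ge0_integral_affine (s c : R) (f : R -> \bar R) : 0 < s ->
  measurable_fun setT f -> (forall x, 0 <= f x)%E ->
  (\int[leb]_x f x = s%:E * \int[leb]_x f (s * x + c)%R)%E.
Proof.
move=> s0 mf f0.
have mphi : measurable_fun setT (fun x : measurableTypeR R => (s * x + c : measurableTypeR R)).
  apply: measurable_funD; last exact: measurable_cst.
  by apply: measurable_funM => //; exact: measurable_cst.
pose nu := [the measure _ _ of mscale (NngNum (ltW s0))
  (measure_function_pushforward__canonical__measure_function_Measure leb mphi)].
have nuE A : measurable A -> leb A = nu A.
  apply: lebesgue_measure_unique => X [[a b] _ <-]/=.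
  rewrite /nu /= /mscale /= /pushforward.
  rewrite [X in _ = (_ * leb X)%E](_ : _ = `](a - c) / s, (b - c) / s]%classic); last first.
    apply/seteqP; split => x /=; rewrite !in_itv/= ltr_pdivrMr// ler_pdivlMr//.
      by move=> /andP[u v]; apply/andP; split; lra.
    by move=> /andP[u v]; apply/andP; split; lra.
  rewrite !lebesgue_measure_itv/= !lte_fin ltr_pM2r ?invr_gt0// ltrD2r.
  case: ifPn => _; last by rewrite mule0.
  by rewrite -!EFinD -EFinM; congr EFin; field; rewrite gt_eqF.
rewrite (@eq_measure_integral _ _ _ _ nu); last by move=> A mA _; exact: nuE.
rewrite /nu /= ge0_integral_mscale//=; congr (_ * _)%E.
by rewrite ge0_integral_pushforward.
Qed.

Lemma normal_pdf_affine (m s y : R) : 0 < s ->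
  s * normal_pdf m s (s * y + m) = normal_pdf 0 1 y.
Proof.
move=> s0; rewrite !normal_pdfE ?gt_eqF ?oner_eq0//.
rewrite /normal_peak /normal_fun addrK subr0 !expr1n.
have two (x : R) : x *+ 2 = 2 * x by rewrite mulr_natl.
rewrite mulrA; congr (_ * expR _); last first.
  by rewrite exprMn (two (s ^+ 2)); field; rewrite gt_eqF.
rewrite mul1r -mulrnAr sqrtrM ?sqr_ge0// sqrtr_sqr (gtr0_norm s0) invfM mulrA divff ?mul1r//.
by rewrite gt_eqF.
Qed.

Lemma ge0_Rintegral_normal_affine (m s : R) (g : R -> R) : 0 < s ->
  measurable_fun setT g -> (forall x, 0 <= g x) ->
  (\int[normal_prob m s]_x (g x)%:E = \int[normal_prob 0 1]_y (g (s * y + m))%:E)%E.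
Proof.
move=> s0 mg g0.
have maff : measurable_fun setT (fun x : R => s * x + m).
  apply: measurable_funD; last exact: measurable_cst.
  by apply: measurable_funM => //; exact: measurable_cst.
have mgs : measurable_fun setT (fun x : R => g (s * x + m)) by exact: (measurableT_comp mg maff).
rewrite (@ge0_integral_normal_prob m s (fun x => (g x)%:E)); first last.
- by move=> x; rewrite lee_fin.
- exact/measurable_EFinP.
rewrite (@ge0_integral_normal_prob 0 1 (fun x => (g (s * x + m))%:E)); first last.
- by move=> x; rewrite lee_fin.
- exact/measurable_EFinP.
rewrite (ge0_integral_affine m s0)/=.
- rewrite -ge0_integralZl//=.
  + apply: eq_integral => x _; rewrite -!EFinM; congr EFin.
    by rewrite mulrCA normal_pdf_affine.
  + apply/measurable_EFinP; apply: measurable_funM => //.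
    exact: (measurableT_comp (measurable_normal_pdf _ _) maff).
  + by move=> x _; rewrite lee_fin mulr_ge0// normal_pdf_ge0.
  + by rewrite lee_fin ltW.
- by apply/measurable_EFinP; apply: measurable_funM => //; exact: measurable_normal_pdf.
- by move=> x; rewrite lee_fin mulr_ge0// normal_pdf_ge0.
Qed.

Lemma Rintegral_normal_affine (m s M : R) (g : R -> R) : 0 < s ->
  measurable_fun setT g -> bdd M g ->
  \int[normal_prob m s]_x g x = \int[normal_prob 0 1]_y g (s * y + m).
Proof.
move=> s0 mg bg.
have maff : measurable_fun setT (fun x : R => s * x + m).
  apply: measurable_funD; last exact: measurable_cst.
  by apply: measurable_funM => //; exact: measurable_cst.
have mgs : measurable_fun setT (fun x : R => g (s * x + m)) by exact: (measurableT_comp mg maff).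
pose N1 : probability _ R := normal_prob m s.
pose N0 : probability _ R := normal_prob 0 1.
have i1 := bdd_integrable N1 mg bg.
have i0 := @bdd_integrable _ _ _ N0 M _ mgs (fun x => bg _).
have E : \int[N1]_x (g x + M) = \int[N0]_y (g (s * y + m) + M).
  rewrite /Rintegral ge0_Rintegral_normal_affine//.
    by apply: measurable_funD => //; exact: measurable_cst.
  by move=> x; rewrite -lerBlDr sub0r; have := bg x; rewrite ler_norml => /andP[].
have c1 := @finite_measure_integrable_cst _ _ _ N1 setT M measurableT.
have c0 := @finite_measure_integrable_cst _ _ _ N0 setT M measurableT.
have E1 := @RintegralD _ _ _ N1 setT g (cst M) measurableT i1 c1.
have E0 := @RintegralD _ _ _ N0 setT (fun y => g (s * y + m)) (cst M) measurableT i0 c0.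
have k1 : \int[N1]_x (cst M x) = M by exact: Rint_prob_cst.
have k0 : \int[N0]_x (cst M x) = M by exact: Rint_prob_cst.
rewrite k1 in E1; rewrite k0 in E0.
rewrite -/N1 -/N0; apply: (@addIr _ M).
exact: (etrans (esym E1) (etrans E E0)).
Qed.

Lemma expR_ge_cube (z : R) : 0 <= z -> z ^+ 3 <= 27 * expR z.
Proof.
move=> z0; have -> : expR z = expR (z / 3) ^+ 3.
  by rewrite -expRM_natl; congr expR; field.
rewrite (_ : z ^+ 3 = 27 * (z / 3) ^+ 3); last by field.
rewrite ler_wpM2l// lerXn2r ?nnegrE ?divr_ge0 ?expR_ge0//.
by rewrite (le_trans _ (expR_ge1Dx _))// lerDr.
Qed.

(* Domination by the integrable [normal_pdf 0 2] is what makes polynomials integrable under N(0, 1). *)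
Lemma normal_pdf_cube_ub : exists C : R, forall y,
  (1 + y ^+ 2) ^+ 3 * normal_pdf 0 1 y <= C * normal_pdf 0 2 y.
Proof.
exists (27 * (8 / 3) ^+ 3 * expR (3/8) * (normal_peak 1 / normal_peak 2)) => y.
rewrite !normal_pdfE ?oner_eq0 ?pnatr_eq0// /normal_fun !subr0.
have p2 : 0 < normal_peak 2 :> R by rewrite normal_peak_gt0.
have p1 : 0 < normal_peak 1 :> R by rewrite normal_peak_gt0 ?oner_eq0.
(* The number 3/8 is 1/2 - 1/8, the gap between the Gaussian exponents for standard deviations 1 and
   2; the other constants come from [expR_ge_cube] at [3/8 * (1 + y ^+ 2)]. *)
have H : (1 + y ^+ 2) ^+ 3 <= 27 * (8 / 3) ^+ 3 * (expR (3/8) * expR (3/8 * y ^+ 2)).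
  have z0 : 0 <= 3/8 * (1 + y ^+ 2) :> R by rewrite mulr_ge0// addr_ge0// sqr_ge0.
  have := expR_ge_cube z0.
  rewrite {2}mulrDr mulr1 expRD exprMn => HH.
  rewrite (_ : (1 + y ^+ 2) ^+ 3 = (8 / 3) ^+ 3 * ((3 / 8) ^+ 3 * (1 + y ^+ 2) ^+ 3)); last by field.
  by rewrite (mulrC 27) -[leRHS]mulrA ler_wpM2l// exprn_ge0.
rewrite [leRHS](_ : _ = normal_peak 1 * (27 * (8 / 3) ^+ 3 * (expR (3 / 8) * expR (- y ^+ 2 / (2 ^+ 2 *+ 2))))); last first.
  by field; rewrite gt_eqF.
rewrite mulrCA ler_pM2l//.
rewrite [X in _ * expR X <= _](_ : _ = - (3/8 * y ^+ 2) + (- y ^+ 2 / (2 ^+ 2 *+ 2))); last first.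
  have two (x : R) : x *+ 2 = 2 * x by rewrite mulr_natl.
  by rewrite expr1n (two (2 ^+ 2)); field.
rewrite expRD mulrA !mulrA ler_pM2r ?expR_gt0// expRN ler_pdivrMr ?expR_gt0//.
by rewrite -!mulrA; rewrite -!mulrA in H.
Qed.

End normal.

(** * Moments of the standard normal law *)

Section moments.
Context {R : realType}.
Local Notation leb := (@lebesgue_measure R).
Local Notation phi := (@normal_pdf R 0 1).

(** Over [[-(n+1), n+1]] the integral is a boundary term of [F], which the decay sends to 0, while
    dominated convergence gives the full integral. This replaces integration by parts for the
    Gaussian moments. *)
Lemma Rintegral_derive_eq0 (F g : R -> R) (C : R) :
  (forall y, is_derive y (1 : R) F (g y)) -> continuous g ->
  leb.-integrable setT (EFin \o g) ->
  (forall y, `|F y| * (1 + y ^+ 2) <= C) ->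
  \int[leb]_y g y = 0.
Proof.
move=> Fg cg ig FC.
have C0 : 0 <= C by have := FC 0; apply: le_trans; rewrite mulr_ge0// addr_ge0// sqr_ge0.
pose gn (n : nat) (y : R) := g y * \1_(`[- n.+1%:R, n.+1%:R]%classic : set R) y.
have mg : measurable_fun setT g by exact: continuous_measurable_fun.
have [] := @dominated_convergence _ _ R leb setT measurableT
  (fun n y => (gn n y)%:E) (EFin \o g) (abse \o (EFin \o g)).
- by move=> n; apply/measurable_EFinP; apply: measurable_funM => //; exact: measurable_indic.
- exact/measurable_EFinP.
- apply/aeW => y _; apply/fine_cvgP; split; first exact: nearW.
  apply: cvg_near_cst; near=> n.
  rewrite /gn /= indicE mem_set ?mulr1//= in_itv/= -ler_norml.
  rewrite (@le_trans _ _ n%:R)// ?ler_nat//.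
  by apply: ltW; near: n; exact: nbhs_infty_gtr.
- exact: integrable_abse.
- apply/aeW => y n _; rewrite lee_fin /gn normrM ler_piMr//.
  by rewrite indicE; case: (_ \in _); rewrite ?normr1// normr0.
move=> _ _ cv.
have E n : (\int[leb]_y (gn n y)%:E = (F n.+1%:R - F (- n.+1%:R))%:E)%E.
  have n0 : - n.+1%:R < n.+1%:R :> R by rewrite gtrN// ltr0n.
  rewrite EFinB -(@continuous_FTC2 R g F)//.
  - rewrite [RHS]integral_mkcond; apply: eq_integral => y _.
    rewrite patchE /gn indicE; case: ifPn => _; by rewrite ?mulr1 ?mulr0.
  - exact: continuous_subspaceT.
  - have cF : {within `[- n.+1%:R, n.+1%:R], continuous F}.
      by apply: derivable_within_continuous => y _; case: (Fg y).
    have [_ F0 F1] := (continuous_within_itvP F n0).1 cF.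
    by split => // y _; case: (Fg y).
  - by move=> y _; rewrite derive1E; case: (Fg y).
have c0 : (fun n : nat => (F n.+1%:R - F (- n.+1%:R))%:E) @ \oo --> (0%R)%:E.
  apply/fine_cvgP; split; first exact: nearW.
  apply/cvgrPdist_le => e e0 /=; near=> n.
  have B (y : R) : `|y| = n.+1%:R -> `|F y| <= C / n.+1%:R.
    move=> yn; rewrite ler_pdivlMr ?ltr0n// (le_trans _ (FC y))// ler_wpM2l//.
    rewrite -real_normK ?num_real// yn.
    have : 0 <= (n.+1%:R - 1) ^+ 2 :> R by exact: sqr_ge0.
    have : 0 <= n.+1%:R :> R by [].
    by move: (n.+1%:R : R) => z; nra.
  rewrite sub0r normrN (le_trans (ler_normB _ _))//.
  rewrite (@le_trans _ _ (C / n.+1%:R + C / n.+1%:R))//.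
    by rewrite lerD// B ?normrN// ger0_norm.
  rewrite -mulrDl ler_pdivrMr ?ltr0n// -ler_pdivrMl// mulrC.
  rewrite (@le_trans _ _ n%:R)// ?ler_nat//.
  by apply: ltW; near: n; exact: nbhs_infty_gtr.
have : (\int[leb]_y (g y)%:E = 0%R%:E)%E.
  apply: (cvg_unique _ cv); first exact: ereal_hausdorff.
  by rewrite (_ : (fun n => _) = (fun n => (F n.+1%:R - F (- n.+1%:R))%:E))//; apply/funext => n; exact: E.
by rewrite /Rintegral => ->.
Unshelve. all: by end_near. Qed.

Lemma is_derive_pdf (y : R) : is_derive y (1 : R) phi (- y * phi y).
Proof.
have q : is_derive y (1 : R) (fun z : R => - z ^+ 2 / (1 ^+ 2 *+ 2)) (- y).
  apply: (@quad_is_derive _ _ _ _ (2^-1)) => t.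
  rewrite [X in `|X|](_ : _ = - (2^-1 * t ^+ 2)); last first.
    by rewrite expr1n -mulr_natr; field.
  by rewrite normrN ger0_norm// mulr_ge0 ?sqr_ge0// invr_ge0.
have e : is_derive (- y ^+ 2 / (1 ^+ 2 *+ 2)) (1 : R) expR (expR (- y ^+ 2 / (1 ^+ 2 *+ 2))).
  exact: is_derive_expR.
have c := @is_derive1_comp _ expR _ y _ _ e q.
have := @is_deriveZ _ _ _ _ (normal_peak 1) y 1 _ c.
rewrite normal_pdfE ?oner_eq0// /normal_fun subr0.
congr is_derive.
  by apply/funext => z; rewrite /= subr0.
by rewrite /GRing.scale/= [RHS]mulrC mulrA.
Qed.

Lemma integrable_pdf_cube (f : R -> R) : measurable_fun setT f ->
  (forall y, `|f y| <= (1 + y ^+ 2) ^+ 3) ->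
  leb.-integrable setT (EFin \o (fun y => f y * phi y)).
Proof.
move=> mf fb; have [C HC] := @normal_pdf_cube_ub R.
apply: (@le_integrable _ _ _ leb _ measurableT _ (fun y => (C * normal_pdf 0 2 y)%:E)).
- by apply/measurable_EFinP; apply: measurable_funM => //; exact: measurable_normal_pdf.
- move=> y _ /=; rewrite lee_fin normrM (ger0_norm (normal_pdf_ge0 _ _ _)).
  rewrite (le_trans _ (ler_norm _))// (le_trans _ (HC y))// ler_wpM2r//.
  exact: normal_pdf_ge0.
- under eq_fun do rewrite EFinM; apply: integrableZl => //.
  exact: integrable_normal_pdf.
Qed.

Lemma pdf_poly_ub : exists C : R, forall y, (1 + y ^+ 2) ^+ 3 * phi y <= C.
Proof.
have [C HC] := @normal_pdf_cube_ub R; exists (`|C| * normal_peak 2) => y.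
rewrite (le_trans (HC y))// (le_trans (ler_norm _))// normrM ler_wpM2l//.
by rewrite (ger0_norm (normal_pdf_ge0 _ _ _)) normal_pdf_ub.
Qed.

Lemma pdf_ge0 (y : R) : 0 <= phi y. Proof. exact: normal_pdf_ge0. Qed.

Lemma continuous_pdf : continuous phi.
Proof. by apply: continuous_normal_pdf; rewrite oner_eq0. Qed.

Let cube1 (y : R) : 1 + y ^+ 2 <= (1 + y ^+ 2) ^+ 3.
Proof. by have := sqr_ge0 y; move: (y ^+ 2) => z; rewrite !exprS expr0; nra. Qed.

Let abs1 (y : R) : `|y| <= 1 + y ^+ 2.
Proof. by rewrite -real_normK ?num_real//; have := normr_ge0 y; move: `|y| => z; nra. Qed.

Let id_cube (y : R) : `|y| <= (1 + y ^+ 2) ^+ 3.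
Proof. exact: le_trans (abs1 y) (cube1 y). Qed.

Let sqr_cube (y : R) : `|y ^+ 2| <= (1 + y ^+ 2) ^+ 3.
Proof.
by rewrite (le_trans _ (cube1 y))// ger0_norm ?sqr_ge0// lerDr.
Qed.

Let abs3_cube (y : R) : `| `|y| ^+ 3 | <= (1 + y ^+ 2) ^+ 3.
Proof.
by rewrite normrX normr_id lerXn2r ?nnegrE ?addr_ge0 ?sqr_ge0// abs1.
Qed.

Lemma measurable_sqr : measurable_fun setT (fun y : R => y ^+ 2).
Proof. exact: exprn_measurable. Qed.

Lemma measurable_abs3 : measurable_fun setT (fun y : R => `|y| ^+ 3).
Proof. by apply: measurable_funX; exact: normr_measurable. Qed.

Lemma normal_integrable_id : (normal_prob 0 1).-integrable setT (EFin \o (@id R)).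
Proof.
by apply: integrable_normal_prob => //; apply: integrable_pdf_cube.
Qed.

Lemma normal_integrable_sqr :
  (normal_prob 0 1).-integrable setT (EFin \o (fun y : R => y ^+ 2)).
Proof.
apply: integrable_normal_prob; first exact: measurable_sqr.
by apply: integrable_pdf_cube => //; exact: measurable_sqr.
Qed.

Lemma normal_integrable_abs3 :
  (normal_prob 0 1).-integrable setT (EFin \o (fun y : R => `|y| ^+ 3)).
Proof.
apply: integrable_normal_prob; first exact: measurable_abs3.
by apply: integrable_pdf_cube => //; exact: measurable_abs3.
Qed.

(** The integrand against Lebesgue measure is the derivative of [- phi]. *)
Lemma normal_mean0 : \int[normal_prob 0 1]_y (y : R) = 0.
Proof.
rewrite (@Rintegral_normal_prob R 0 1 id)//; last exact: integrable_pdf_cube.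
have [C HC] := pdf_poly_ub.
apply: (@Rintegral_derive_eq0 (fun y => - phi y) _ C).
- move=> y; have d := is_derive_pdf y.
  have := is_deriveN d; congr is_derive.
  by rewrite mulNr opprK.
- move=> y; apply: cvgM; [exact: cvg_id|exact: continuous_pdf].
- by apply: integrable_pdf_cube.
- move=> y; rewrite normrN (ger0_norm (pdf_ge0 y)) mulrC (le_trans _ (HC y))//.
  by rewrite ler_wpM2r ?pdf_ge0.
Qed.

(** The function [y ^+ 2 * phi y - phi y] is the derivative of [- (y * phi y)], so the second moment
    equals the total mass. *)
Lemma normal_var1 : \int[normal_prob 0 1]_y ((y : R) ^+ 2) = 1.
Proof.
have m2 := measurable_sqr.
have i2 := integrable_pdf_cube m2 sqr_cube.
rewrite (@Rintegral_normal_prob R 0 1 (fun y => y ^+ 2))//.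
have [C HC] := pdf_poly_ub.
have ip : leb.-integrable setT (EFin \o phi) by exact: integrable_normal_pdf.
have p1 : \int[leb]_y phi y = 1 by rewrite /Rintegral integral_normal_pdf.
suff : \int[leb]_y (y ^+ 2 * phi y - phi y) = 0.
  by rewrite RintegralB// p1 => /eqP; rewrite subr_eq0 => /eqP.
apply: (@Rintegral_derive_eq0 (fun y => - (y * phi y)) _ C).
- move=> y; have d := is_derive_pdf y.
  have dM := @is_deriveM _ _ id phi y 1 _ _ (is_derive_id _ _) d.
  have := is_deriveN dM; congr is_derive.
  by rewrite /GRing.scale/=; ring.
- move=> y; apply: cvgB; last exact: continuous_pdf.
  apply: cvgM; last exact: continuous_pdf.
  exact: exprn_continuous.
- have := @integrableB _ _ _ leb setT measurableT _ _ i2 ip.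
  by apply: eq_integrable => // y _ /=; rewrite EFinB.
- move=> y; rewrite normrN normrM (ger0_norm (pdf_ge0 y)) mulrAC (le_trans _ (HC y))//.
  rewrite ler_wpM2r ?pdf_ge0//; have := abs1 y; have := normr_ge0 y; have := sqr_ge0 y.
  rewrite !exprS expr0; move: (y * (y * 1)) `|y| => z a; rewrite mulr1; nra.
Qed.

End moments.

(** * Stability of the normal law under addition *)

Section stability.
Context {R : realType}.
Local Notation leb := (@lebesgue_measure R).
Local Notation phi := (@normal_pdf R 0 1).

(** For independent standard normal Y and Z, both sides are joint densities of [(Y, a Y + b Z)], and
    this pair is exchangeable when [a ^+ 2 + b ^+ 2 = 1]. *)
Lemma normal_pdf_conv (a b y w : R) : 0 < b -> a ^+ 2 + b ^+ 2 = 1 ->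
  phi y * normal_pdf (a * y) b w = phi w * normal_pdf (a * w) b y.
Proof.
move=> b0 ab; have bn : b != 0 by rewrite gt_eqF.
rewrite !normal_pdfE ?oner_eq0// /normal_fun !subr0.
rewrite mulrACA [RHS]mulrACA; congr (_ * _); rewrite -!expRD; congr expR.
have two (x : R) : x *+ 2 = 2 * x by rewrite mulr_natl.
rewrite expr1n (two (b ^+ 2)).
have -> : b ^+ 2 = 1 - a ^+ 2 by rewrite -ab; ring.
have bn2 : 1 - a ^+ 2 != 0 by rewrite (_ : 1 - a ^+ 2 = b ^+ 2) ?expf_neq0// -ab; ring.
by field.
Qed.

(** After normalisation by [q], the inner variable becomes [w = a y + b z], with law N(a y, b^2)
    given [y]. By [normal_pdf_conv] the joint density can be read with [w] first; Tonelli then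
    integrates [y] out, which leaves the standard density of [w]. *)
Lemma ge0_normal_conv (s t : R) (g : R -> R) : 0 < s -> 0 < t ->
  measurable_fun setT g -> (forall x, 0 <= g x) ->
  (\int[normal_prob 0 1]_y \int[normal_prob 0 1]_z (g (s * y + t * z))%:E =
   \int[normal_prob 0 1]_w (g (Num.sqrt (s ^+ 2 + t ^+ 2) * w))%:E)%E.
Proof.
move=> s0 t0 mg g0; set q := Num.sqrt _.
have q2 : q ^+ 2 = s ^+ 2 + t ^+ 2 by rewrite sqr_sqrtr// addr_ge0// sqr_ge0.
have q0 : 0 < q by rewrite sqrtr_gt0 addr_gt0// exprn_gt0.
pose a := s / q; pose b := t / q.
have b0 : 0 < b by rewrite divr_gt0.
have ab : a ^+ 2 + b ^+ 2 = 1.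
  by rewrite /a /b !expr_div_n -mulrDl -q2 divff// expf_neq0// gt_eqF.
pose G (w : R) := g (q * w).
have mG : measurable_fun setT G.
  by apply: (measurableT_comp mg); apply: measurable_funM => //; exact: measurable_cst.
have G0 x : 0 <= G x by exact: g0.
pose K (p : R * R) := G p.2 * (phi p.2 * normal_pdf 0 b (p.1 - a * p.2)).
have mK : measurable_fun setT K.
  apply: measurable_funM; first by apply: (measurableT_comp mG); exact: measurable_snd.
  apply: measurable_funM; first by apply: (measurableT_comp (measurable_normal_pdf _ _)); exact: measurable_snd.
  apply: (measurableT_comp (measurable_normal_pdf _ _)); apply: measurable_funB; first exact: measurable_fst.
  by apply: measurable_funM; [exact: measurable_cst|exact: measurable_snd].
have K0 p : 0 <= K p by rewrite !mulr_ge0// normal_pdf_ge0.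
have KE y w : K (y, w) = G w * normal_pdf (a * y) b w * phi y.
  rewrite /K /= (_ : normal_pdf 0 b (y - a * w) = normal_pdf (a * w) b y).
    by rewrite -(normal_pdf_conv _ _ b0 ab); ring.
  by rewrite !normal_pdfE ?gt_eqF// /normal_fun subr0.
have inner y : (\int[normal_prob 0 1]_z (g (s * y + t * z))%:E =
    \int[leb]_w (G w * normal_pdf (a * y) b w)%:E)%E.
  have := @ge0_Rintegral_normal_affine R (a * y) b G b0 mG G0.
  rewrite (@ge0_integral_normal_prob _ _ _ (fun x => (G x)%:E)); first last.
  - by move=> x; rewrite lee_fin.
  - exact/measurable_EFinP.
  move=> ->; apply: eq_integral => z _; rewrite /G; congr (g _)%:E.
  by rewrite /a /b; field; rewrite gt_eqF.
under eq_integral do rewrite inner.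
have mI : measurable_fun setT (fun y : R => \int[leb]_w (G w * normal_pdf (a * y) b w)%:E)%E.
  pose K' (p : R * R) := (G p.2 * normal_pdf 0 b (p.2 - a * p.1))%:E.
  rewrite (_ : (fun y => _) = fun y => (\int[leb]_w K' (y, w))%E); last first.
    apply/funext => y; apply: eq_integral => w _; congr ((_ * _)%:E).
    by rewrite /= !normal_pdfE ?gt_eqF// /normal_fun subr0.
  apply: (@measurable_fun_fubini_tonelli_F _ _ _ _ _ leb K').
    apply/measurable_EFinP; apply: measurable_funM; first by apply: (measurableT_comp mG); exact: measurable_snd.
    apply: (measurableT_comp (measurable_normal_pdf _ _)); apply: measurable_funB; first exact: measurable_snd.
    by apply: measurable_funM; [exact: measurable_cst|exact: measurable_fst].
  by move=> p; rewrite lee_fin mulr_ge0// normal_pdf_ge0.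
rewrite (@ge0_integral_normal_prob _ _ _ (fun y : R => \int[leb]_w (G w * normal_pdf (a * y) b w)%:E)%E)//; last first.
  by move=> y; apply: integral_ge0 => w _; rewrite lee_fin mulr_ge0// normal_pdf_ge0.
have E1 y : (\int[leb]_w (G w * normal_pdf (a * y) b w)%:E * (phi y)%:E =
    \int[leb]_w (K (y, w))%:E)%E.
  rewrite -ge0_integralZr//; last 3 first.
  - apply/measurable_EFinP; apply: measurable_funM => //; exact: measurable_normal_pdf.
  - by move=> w _; rewrite lee_fin mulr_ge0// normal_pdf_ge0.
  - by rewrite lee_fin normal_pdf_ge0.
  by apply: eq_integral => w _; rewrite KE.
under eq_integral do rewrite E1.
rewrite (@fubini_tonelli _ _ _ _ _ leb leb (fun p => (K p)%:E)); last 2 first.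
- exact/measurable_EFinP.
- by move=> p; rewrite lee_fin.
rewrite (@ge0_integral_normal_prob _ _ _ (fun w => (G w)%:E)); first last.
- by move=> x; rewrite lee_fin.
- exact/measurable_EFinP.
apply: eq_integral => w _; rewrite -EFinM.
rewrite -[RHS]mule1 -(integral_normal_pdf (a * w) b) -ge0_integralZl//.
- apply: eq_integral => y _; rewrite -EFinM /K /= mulrA; congr ((_ * _)%:E).
  by rewrite !normal_pdfE ?gt_eqF// /normal_fun subr0.
- by apply/measurable_EFinP; exact: measurable_normal_pdf.
- by move=> y _; rewrite lee_fin normal_pdf_ge0.
- by rewrite lee_fin mulr_ge0// normal_pdf_ge0.
Qed.

End stability.

Section gauss_operators.
Context {R : realType} {r : nat}.
Implicit Types (h : 'cV[R]_r -> R) (x v : 'cV[R]_r).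

(* A centered Gaussian law on R^r is encoded by a list [vs] of vectors: it is the
   law of sum_v xi_v v with independent standard normal xi_v, and
   [gall vs h x] is the expectation of h at x + sum_v xi_v v. *)
Definition gvec v (y : measurableTypeR R) := y *: v.

Definition gop v h := avg (normal_prob 0 1) (gvec v) h.

Definition gall (vs : seq 'cV[R]_r) h := foldr gop h vs.

Lemma cmeas_gvec v : cmeas (gvec v).
Proof. by apply: cmeasZ; [exact: cmeas_cst|]. Qed.

Lemma gop_bdd M v h : meas_col h -> bdd M h -> bdd M (gop v h).
Proof. exact: (avg_bdd _ (cmeas_gvec v)). Qed.

Lemma gop_meas M v h : meas_col h -> bdd M h -> meas_col (gop v h).
Proof. exact: (avg_meas _ (cmeas_gvec v)). Qed.

Lemma gall_spec M vs h : meas_col h -> bdd M h ->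
  meas_col (gall vs h) /\ bdd M (gall vs h).
Proof.
move=> mh bh; elim: vs => [//|v vs [IH1 IH2]] /=.
by split; [exact: gop_meas IH2|exact: gop_bdd].
Qed.

Lemma gopC M v w h x : meas_col h -> bdd M h ->
  gop v (gop w h) x = gop w (gop v h) x.
Proof. exact: (avgC _ _ _ (cmeas_gvec v) (cmeas_gvec w)). Qed.

Lemma gop_conv M (s t : R) v h x : 0 < s -> 0 < t -> meas_col h -> bdd M h ->
  gop (s *: v) (gop (t *: v) h) x = gop (Num.sqrt (s ^+ 2 + t ^+ 2) *: v) h x.
Proof.
move=> s0 t0 mh bh.
pose N : probability _ R := normal_prob 0 1.
pose g (w : R) := h (x + w *: v) + M.
have mg : measurable_fun setT g.
  apply: measurable_funD; last exact: measurable_cst.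
  exact: (avg_integrand (T := measurableTypeR R) (cmeas_gvec v) x mh).
have g0 w : 0 <= g w.
  by rewrite -lerBlDr sub0r; have := bh (x + w *: v); rewrite ler_norml => /andP[].
have cM := @finite_measure_integrable_cst _ _ _ N setT M measurableT.
have shift u (W : R -> 'cV[R]_r) : cmeas (W : measurableTypeR R -> _) ->
    \int[N]_y (h (u + W y) + M) = \int[N]_y h (u + W y) + M.
  move=> mW.
  rewrite (@RintegralD _ _ _ N setT _ (cst M) measurableT _ cM).
    by rewrite Rint_prob_cst.
  exact: (avg_integrable N mW u mh bh).
apply: (@addIr _ M); rewrite /gop /avg.
rewrite -(shift x (gvec (Num.sqrt (s ^+ 2 + t ^+ 2) *: v)) (cmeas_gvec _)).
have bt := gop_bdd (t *: v) mh bh; have mt := gop_meas (t *: v) mh bh.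
have -> : \int[N]_y \int[N]_z h (x + gvec (s *: v) y + gvec (t *: v) z) + M =
    \int[N]_y (\int[N]_z g (s * y + t * z)).
  transitivity (\int[N]_y (\int[N]_z h (x + gvec (s *: v) y + gvec (t *: v) z) + M)).
    rewrite (@RintegralD _ _ _ N setT _ (cst M) measurableT _ cM).
      by rewrite Rint_prob_cst.
    exact: (avg_integrable N (cmeas_gvec (s *: v)) x mt bt).
  apply: eq_Rintegral => y _; rewrite -shift; last exact: cmeas_gvec.
  apply: eq_Rintegral => z _; rewrite /g /gvec scalerDl addrA.
  by rewrite !scalerA (mulrC y) (mulrC z).
have fineI y : (\int[N]_z (g (s * y + t * z))%:E = (\int[N]_z g (s * y + t * z))%:E)%E.
  rewrite /Rintegral fineK//; apply: integrable_fin_num => //.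
  apply: (@bdd_integrable _ _ _ N (M + M)) => [|z]; last first.
    by rewrite (le_trans (ler_normD _ _))// lerD// ger0_norm// (le_trans _ (bh x)).
  apply: (measurableT_comp mg); apply: measurable_funD; first exact: measurable_cst.
  by apply: measurable_funM => //; exact: measurable_cst.
have := @ge0_normal_conv R s t g s0 t0 mg g0.
under eq_integral do rewrite fineI.
rewrite /Rintegral => ->; congr fine; apply: eq_integral => w _.
by rewrite /g /gvec scalerA mulrC.
Qed.

Lemma gop_ext v h h' x : h =1 h' -> gop v h x = gop v h' x.
Proof. by move=> hh; rewrite (_ : h = h')//; exact/funext. Qed.

(** With [s] the inverse square root of [n.+1] this returns [gop v] exactly, without an error term.
    The count starts at one factor because [gop_conv] combines positive scales only. *)
Lemma iter_gop M n (s : R) v h x : 0 < s -> meas_col h -> bdd M h ->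
  iter n.+1 (gop (s *: v)) h x = gop ((Num.sqrt n.+1%:R * s) *: v) h x.
Proof.
move=> s0 mh bh; elim: n x => [|n IH] x.
  by rewrite /= sqrtr1 mul1r.
rewrite iterS (gop_ext _ _ IH).
have t0 : 0 < Num.sqrt n.+1%:R * s by rewrite mulr_gt0// sqrtr_gt0 ltr0n.
rewrite (@gop_conv M s _ v h x s0 t0 mh bh).
have -> : Num.sqrt (s ^+ 2 + (Num.sqrt n.+1%:R * s) ^+ 2) = Num.sqrt n.+2%:R * s.
  rewrite exprMn sqr_sqrtr// -{1}(mul1r (s ^+ 2)) -mulrDl.
  by rewrite -[n.+2]add1n natrD sqrtrM ?addr_ge0// sqrtr_sqr gtr0_norm.
by [].
Qed.

End gauss_operators.

(** * Central limit theorem for bounded Lipschitz functions *)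

Section trotter.
Context {R : realType} {r : nat}.
Implicit Types (f g h : 'cV[R]_r -> R) (x v e : 'cV[R]_r) (i j : 'I_r).

Definition bm h := meas_col h /\ exists M, bdd M h.

Lemma bm_gop v h : bm h -> bm (gop v h).
Proof.
by move=> [mh [M bh]]; split; [exact: gop_meas bh|exists M; exact: gop_bdd].
Qed.

Lemma bm_gall vs h : bm h -> bm (gall vs h).
Proof. by move=> bh; elim: vs => //= v vs; exact: bm_gop. Qed.

Lemma bm_iter_gall vs n h : bm h -> bm (iter n (gall vs) h).
Proof. by move=> bh; elim: n => //= n; exact: bm_gall. Qed.

Lemma gop_gallC v vs h : bm h -> gop v (gall vs h) = gall vs (gop v h).
Proof.
move=> bh; elim: vs => //= w vs <-; apply/funext => x.
by have [mg [M bg]] := bm_gall vs bh; exact: gopC mg bg.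
Qed.

(** The operators [gop] commute, so the power of their composition is the composition of their
    powers, and [iter_gop] handles each of these. *)
Lemma iter_gall n (s : R) vs h : 0 < s -> bm h ->
  iter n.+1 (gall [seq s *: v | v <- vs]) h =
  gall [seq (Num.sqrt n.+1%:R * s) *: v | v <- vs] h.
Proof.
move=> s0 bh; elim: vs => [|v vs IH].
  by elim: n => // n IHn; rewrite iterS IHn.
rewrite [RHS]/= -IH; set A := gall [seq s *: v | v <- vs].
have bA k : bm (iter k A h) by exact: bm_iter_gall.
have split_iter k : iter k (gall [seq s *: v | v <- v :: vs]) h =
    iter k (gop (s *: v)) (iter k A h).
  elim: k => // k IHk; rewrite iterS IHk [RHS]iterS /= -/A; congr gop.
  have : bm (iter k A h) by [].
  move: (iter k A h) => g bg; elim: (k) => //= l <-.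
  by apply/esym/gop_gallC; elim: l => //= l; exact: bm_gop.
have [mg [M bg]] := bA n.+1.
by apply/funext => x; rewrite split_iter (iter_gop n v x s0 mg bg).
Qed.

Section avgtaylor.
Context d (T : measurableType d) (mu : probability T R) (V : T -> 'cV[R]_r).
Hypothesis mV : cmeas V.

Lemma avg_sum (I : Type) (s : seq I) (c : I -> R) (F : I -> 'cV[R]_r -> R) x :
  (forall k, bm (F k)) ->
  [/\ bm (fun x => \sum_(k <- s) c k * F k x) &
  avg mu V (fun x => \sum_(k <- s) c k * F k x) x =
  \sum_(k <- s) c k * avg mu V (F k) x].
Proof.
move=> bF; elim: s => [|k s [IH1 IH2]].
  split.
    split; first by under eq_fun do rewrite big_nil; exact: measurable_cst.
    by exists 0 => y; rewrite big_nil normr0.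
  by rewrite big_nil /avg; under eq_Rintegral do rewrite big_nil; rewrite Rint_prob_cst.
have [mF [M bFk]] := bF k; have [mS [M' bS]] := IH1.
have mc : meas_col (fun x => c k * F k x) by apply: measurable_funM => //; exact: measurable_cst.
have bc : bdd (`|c k| * M) (fun x => c k * F k x) by move=> y; rewrite normrM ler_wpM2l.
have E : (fun x => \sum_(l <- k :: s) c l * F l x) =
    (fun x => c k * F k x + \sum_(l <- s) c l * F l x).
  by apply/funext => y; rewrite big_cons.
rewrite E big_cons; split.
  split; first exact: measurable_funD.
  by exists (`|c k| * M + M') => y; rewrite (le_trans (ler_normD _ _))// lerD.
rewrite (@avgD _ _ _ mu _ _ mV _ _ _ _ x mc mS bc bS) IH2.
by rewrite (@avgZ _ _ _ mu _ _ mV _ (c k) _ x mF bFk).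
Qed.

Lemma taylor2_bm K f D H : taylor2 K f D H ->
  [/\ bm f, forall i, bm (D i) & forall i j, bm (H i j)].
Proof.
move=> [_ [bf lf] bD bH _]; split.
- by split; [exact: lip_meas_col lf|exists K].
- by move=> i; have [b l] := bD i; split; [exact: lip_meas_col l|exists K].
- by move=> i j; have [b l] := bH i j; split; [exact: lip_meas_col l|exists K].
Qed.

(** Derivatives of an average are averages of derivatives, and so is the remainder; [K] does not
    deteriorate, however often averages are iterated. *)
Lemma avg_taylor2 K f D H : taylor2 K f D H ->
  taylor2 K (avg mu V f) (fun i => avg mu V (D i)) (fun i j => avg mu V (H i j)).
Proof.
move=> tf; have [bmf bmD bmH] := taylor2_bm tf; case: tf => K0 [bf lf] bD bH tf.
split => //.
- by split; [exact: avg_bdd bmf.1 bf|exact: avg_lip bf lf].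
- by move=> i; have [b l] := bD i; split; [exact: avg_bdd (bmD i).1 b|exact: avg_lip b l].
- by move=> i j; have [b l] := bH i j; split; [exact: avg_bdd (bmH i j).1 b|exact: avg_lip b l].
move=> x e.
have mfe : meas_col (fun y => f (y + e)).
  by under eq_fun do rewrite addrC; exact: meas_col_shift bmf.1.
have bfe : bdd K (fun y => f (y + e)) by move=> y; exact: bf.
have [bS1 S1] := avg_sum (index_enum 'I_r) (fun i => e i 0) x bmD.
have bHi i : bm (fun y => \sum_j e j 0 * H i j y).
  by have [] := avg_sum (index_enum 'I_r) (fun j => e j 0) x (bmH i).
have [bS2 S2] := avg_sum (index_enum 'I_r) (fun i => e i 0) x bHi.
have E2 : avg mu V (hess H e) x = hess (fun i j => avg mu V (H i j)) e x.
  rewrite /hess S2; apply: eq_bigr => i _; congr (_ * _).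
  by have [] := avg_sum (index_enum 'I_r) (fun j => e j 0) x (bmH i).
rewrite -E2 -S1 -avg_shift.
have [mS1 [M1 b1]] := bS1; have [mS2 [M2 b2]] := bS2.
rewrite -(@avgZ _ _ _ mu _ _ mV _ 2^-1 _ x mS2 b2).
rewrite -(@avgB _ _ _ mu _ _ mV _ _ _ _ x mfe bmf.1 bfe bf).
have m1 : meas_col (fun y => f (y + e) - f y) by apply: measurable_funB => //; exact: bmf.1.
have bb1 : bdd (K + K) (fun y => f (y + e) - f y).
  by move=> y; rewrite (le_trans (ler_normB _ _))// lerD.
rewrite -(@avgB _ _ _ mu _ _ mV _ _ _ _ x m1 mS1 bb1 b1).
have m2 : meas_col (fun y => f (y + e) - f y - \sum_i e i 0 * D i y).
  exact: measurable_funB.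
have bb2 : bdd (K + K + M1) (fun y => f (y + e) - f y - \sum_i e i 0 * D i y).
  by move=> y; rewrite (le_trans (ler_normB _ _))// lerD.
have m3 : meas_col (fun y => 2^-1 * hess H e y) by apply: measurable_funM => //; exact: measurable_cst.
have bb3 : bdd (2^-1 * M2) (fun y => 2^-1 * hess H e y).
  move=> y; rewrite normrM ger0_norm ?invr_ge0// ler_wpM2l ?invr_ge0//.
  exact: b2.
rewrite -(@avgB _ _ _ mu _ _ mV _ _ _ _ x m2 m3 bb2 bb3).
apply: Rint_le_bdd; last by move=> t; exact: tf.
by apply: (avg_integrand mV x (h := fun y => f (y + e) - f y - \sum_i e i 0 * D i y - 2^-1 * hess H e y)); exact: measurable_funB.
Qed.

End avgtaylor.
End trotter.

Section integral_tools.
Context {R : realType} d (T : measurableType d) (mu : {measure set T -> \bar R}).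

Lemma integrable_scale (c : R) (F : T -> R) : mu.-integrable setT (EFin \o F) ->
  mu.-integrable setT (EFin \o (fun t => c * F t)).
Proof.
by move=> iF; apply: eq_integrable (integrableZl measurableT c iF) => // x _ /=.
Qed.

Lemma integrable_add (F G : T -> R) : mu.-integrable setT (EFin \o F) ->
  mu.-integrable setT (EFin \o G) -> mu.-integrable setT (EFin \o (fun t => F t + G t)).
Proof.
by move=> iF iG; apply: eq_integrable (integrableD measurableT iF iG) => // x _ /=.
Qed.

Lemma integrable_sub (F G : T -> R) : mu.-integrable setT (EFin \o F) ->
  mu.-integrable setT (EFin \o G) -> mu.-integrable setT (EFin \o (fun t => F t - G t)).
Proof.
by move=> iF iG; apply: eq_integrable (integrableB measurableT iF iG) => // x _ /=.
Qed.

Lemma Rint_lincomb (I : Type) (s : seq I) (c : I -> R) (F : I -> T -> R) :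
  (forall k, mu.-integrable setT (EFin \o F k)) ->
  mu.-integrable setT (EFin \o (fun t => \sum_(k <- s) c k * F k t)) /\
  \int[mu]_t (\sum_(k <- s) c k * F k t) = \sum_(k <- s) c k * \int[mu]_t F k t.
Proof.
move=> iF; elim: s => [|k s [IH1 IH2]].
  have -> : (fun t => \sum_(k <- [::]) c k * F k t) = cst 0.
    by apply/funext => t; rewrite big_nil.
  by rewrite big_nil; split; [exact: integrable0|rewrite /Rintegral integral0].
have E : (fun t => \sum_(l <- k :: s) c l * F l t) =
    (fun t => c k * F k t + \sum_(l <- s) c l * F l t).
  by apply/funext => y; rewrite big_cons.
have ic := integrable_scale (c k) (iF k).
rewrite E big_cons; split; first exact: integrable_add.
by rewrite (RintegralD measurableT ic IH1) IH2 RintegralZl.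
Qed.

Lemma ge_integrable (F G : T -> R) : measurable_fun setT F ->
  (forall t, `|F t| <= G t) -> mu.-integrable setT (EFin \o G) ->
  mu.-integrable setT (EFin \o F).
Proof.
move=> mF FG; apply: le_integrable => //; first exact/measurable_EFinP.
by move=> t _ /=; rewrite lee_fin (le_trans (FG t))// ler_norm.
Qed.

Lemma integrable_measurable (F : T -> R) : mu.-integrable setT (EFin \o F) ->
  measurable_fun setT F.
Proof. by move=> /measurable_int /measurable_EFinP. Qed.

End integral_tools.

(** * One averaging step compared with its second-order expansion *)

Section onestep.
Context {R : realType} {r : nat} d (T : measurableType d) (mu : probability T R).
Variable V : T -> 'cV[R]_r.
Hypothesis mV : cmeas V.
Hypothesis iV : mu.-integrable setT (EFin \o (fun t => vnorm (V t) ^+ 2)).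

Let icst c : mu.-integrable setT (EFin \o (fun=> c)).
Proof. exact: finite_measure_integrable_cst. Qed.

Lemma integrable_coord i : mu.-integrable setT (EFin \o (fun t => V t i 0)).
Proof.
apply: (ge_integrable (mV i) _ (integrable_add (icst 1) iV)) => t.
rewrite (le_trans (ler_coord_vnorm _ _))//; have := vnorm_ge0 (V t).
by move: (vnorm _) => z; nra.
Qed.

Lemma integrable_coord2 i j : mu.-integrable setT (EFin \o (fun t => V t i 0 * V t j 0)).
Proof.
apply: (ge_integrable _ _ iV); first exact: measurable_funM.
by move=> t; rewrite normrM expr2 ler_pM// ler_coord_vnorm.
Qed.

Lemma measurable_vnorm : measurable_fun setT (fun t => vnorm (V t)).
Proof.
have -> : (fun t => vnorm (V t)) = Num.sqrt \o (fun t => vnorm (V t) ^+ 2).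
  by apply/funext => t /=; rewrite sqrtr_sqr ger0_norm// vnorm_ge0.
apply: measurableT_comp; last exact: integrable_measurable iV.
by apply: continuous_measurable_fun; exact: sqrt_continuous.
Qed.

(* Second-order Taylor remainder. Applied to n^-1/2 V, its expectation is o(1/n)
   under second moments only. *)
Definition lind (z : R) := Num.min (z ^+ 2) (z ^+ 3).

Lemma measurable_lind (g : T -> R) : measurable_fun setT g ->
  measurable_fun setT (fun t => lind (g t)).
Proof. by move=> mg; apply: measurable_minr; exact: measurable_funX. Qed.

Lemma lind_ge0 z : 0 <= z -> 0 <= lind z.
Proof. by move=> z0; rewrite /lind le_min !exprn_ge0. Qed.

Variable S : 'I_r -> 'I_r -> R.
Hypothesis V0 : forall i, \int[mu]_t V t i 0 = 0.
Hypothesis VS : forall i j, \int[mu]_t (V t i 0 * V t j 0) = S i j.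

(** For a covariance matrix [W], half of this quantity is the generator of Brownian motion with
    covariance [W], with [H] standing for the Hessian. *)
Definition quadS (W : 'I_r -> 'I_r -> R) (H : 'I_r -> 'I_r -> 'cV[R]_r -> R) x :=
  \sum_i \sum_j W i j * H i j x.

(** Centering kills the first-order term and the second moments turn the Hessian term into
    [quadS S H x]. Up to the remainder the result depends on [V] only through [S], so two laws with
    equal covariance can be compared. *)
Lemma avg_step K f D H x : taylor2 K f D H ->
  `|avg mu V f x - f x - 2^-1 * quadS S H x| <= K * \int[mu]_t lind (vnorm (V t)).
Proof.
move=> tf; have [bmf bmD bmH] := taylor2_bm tf; case: tf => K0 [bf lf] bD bH tf.
have i1 : mu.-integrable setT (EFin \o (fun t => f (x + V t))).
  exact: avg_integrable bmf.1 bf.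
have [i2 E2] := Rint_lincomb (index_enum 'I_r) (fun i => D i x) integrable_coord.
have [i3 E3] := Rint_lincomb (index_enum ('I_r * 'I_r)%type) (fun p => H p.1 p.2 x)
  (fun p => integrable_coord2 p.1 p.2).
have {}E2 : \int[mu]_t (\sum_i D i x * V t i 0) = 0.
  by rewrite E2 big1// => i _; rewrite V0 mulr0.
have HE t : \sum_p H p.1 p.2 x * (V t p.1 0 * V t p.2 0) = hess H (V t) x.
  rewrite /hess [RHS](eq_bigr (fun i => \sum_j H i j x * (V t i 0 * V t j 0))).
    by rewrite pair_bigA.
  by move=> i _; rewrite mulr_sumr; apply: eq_bigr => j _; rewrite mulrA mulrC.
have {}E3 : \int[mu]_t hess H (V t) x = quadS S H x.
  under eq_Rintegral do rewrite -HE.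
  rewrite E3 /quadS pair_bigA; apply: eq_bigr => p _.
  by rewrite VS mulrC.
have {}i3 : mu.-integrable setT (EFin \o (fun t => hess H (V t) x)).
  by apply: eq_integrable i3 => // t _ /=; rewrite HE.
pose err t := f (x + V t) - f x - \sum_i D i x * V t i 0 - 2^-1 * hess H (V t) x.
have i4 := integrable_sub i1 (icst (f x)).
have i5 := integrable_sub i4 i2.
have i6 := integrable_scale 2^-1 i3.
have -> : avg mu V f x - f x - 2^-1 * quadS S H x = \int[mu]_t err t.
  rewrite /err (RintegralB measurableT i5 i6) (RintegralB measurableT i4 i2).
  rewrite (RintegralB measurableT i1 (icst (f x))) E2 subr0 Rint_prob_cst.
  by rewrite (RintegralZl _ measurableT i3) E3.
have ierr : mu.-integrable setT (EFin \o err) := integrable_sub i5 i6.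
rewrite (le_trans (le_normr_Rintegral _ ierr))//.
have il : mu.-integrable setT (EFin \o (fun t => lind (vnorm (V t)))).
  apply: (ge_integrable _ _ iV); first by apply: measurable_lind; exact: measurable_vnorm.
  by move=> t; rewrite ger0_norm ?lind_ge0 ?vnorm_ge0// ge_min lexx.
rewrite -(RintegralZl _ measurableT il); apply: le_Rintegral => //.
- exact: integrable_norm.
- exact: integrable_scale.
- move=> t _; rewrite /err (eq_bigr (fun i => V t i 0 * D i x)); first exact: tf.
  by move=> i _; rewrite mulrC.
Qed.

End onestep.

Section gaussstep.
Context {R : realType} {r : nat}.
Implicit Types (f g h : 'cV[R]_r -> R) (x v e : 'cV[R]_r) (i j : 'I_r).

Let N : probability _ R := normal_prob 0 1.
Let m1 : R := \int[N]_y `|y|.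
Let m3 : R := \int[N]_y `|y| ^+ 3.

Let m3_ge0 : 0 <= m3. Proof. by apply: Rintegral_ge0 => y _; rewrite exprn_ge0. Qed.
Let m1_ge0 : 0 <= m1. Proof. by apply: Rintegral_ge0. Qed.

Lemma quadSZ c (W : 'I_r -> 'I_r -> R) (H : 'I_r -> 'I_r -> 'cV[R]_r -> R) x :
  quadS (fun i j => c * W i j) H x = c * quadS W H x.
Proof.
rewrite /quadS mulr_sumr; apply: eq_bigr => i _; rewrite mulr_sumr.
by apply: eq_bigr => j _; rewrite mulrA.
Qed.

Lemma quadSD (W W' : 'I_r -> 'I_r -> R) (H : 'I_r -> 'I_r -> 'cV[R]_r -> R) x :
  quadS (fun i j => W i j + W' i j) H x = quadS W H x + quadS W' H x.
Proof.
rewrite /quadS -big_split; apply: eq_bigr => i _; rewrite -big_split.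
by apply: eq_bigr => j _; rewrite mulrDl.
Qed.

Lemma quadS_lip K (W : 'I_r -> 'I_r -> R) (H : 'I_r -> 'I_r -> 'cV[R]_r -> R) :
  (forall i j, bdd K (H i j) /\ lip K (H i j)) ->
  bdd (\sum_i \sum_j `|W i j| * K) (quadS W H) /\
  lip (\sum_i \sum_j `|W i j| * K) (quadS W H).
Proof.
move=> HH; split => [x|x y].
  rewrite (le_trans (ler_norm_sum _ _ _))//; apply: ler_sum => i _.
  rewrite (le_trans (ler_norm_sum _ _ _))//; apply: ler_sum => j _.
  by rewrite normrM ler_wpM2l//; exact: (HH i j).1.
rewrite /quadS -sumrB mulr_suml (le_trans (ler_norm_sum _ _ _))//.
apply: ler_sum => i _.
rewrite -sumrB mulr_suml (le_trans (ler_norm_sum _ _ _))//.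
apply: ler_sum => j _.
by rewrite -mulrBr normrM -mulrA ler_wpM2l//; exact: (HH i j).2.
Qed.

Lemma normal_integrable_abs : N.-integrable setT (EFin \o (fun y : R => `|y|)).
Proof. exact: integrable_norm (@normal_integrable_id R). Qed.

(** A normal variable has a third absolute moment, so the cubic branch of [lind] alone suffices. *)
Lemma gop_step K f D H (s : R) v x : taylor2 K f D H -> 0 <= s ->
  `|gop (s *: v) f x - f x - 2^-1 * (s ^+ 2 * quadS (fun i j => v i 0 * v j 0) H x)|
  <= K * (s ^+ 3 * (vnorm v ^+ 3 * m3)).
Proof.
move=> tf s0; have K0 : 0 <= K by case: tf.
have v0 := vnorm_ge0 v.
have vE y : vnorm (gvec (s *: v) y) = `|y| * (s * vnorm v).
  by rewrite /gvec !vnormZ (ger0_norm s0).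
have cE i y : gvec (s *: v) y i 0 = s * v i 0 * y by rewrite /gvec !mxE mulrC.
have iV : N.-integrable setT (EFin \o (fun y => vnorm (gvec (s *: v) y) ^+ 2)).
  have := integrable_scale ((s * vnorm v) ^+ 2) (@normal_integrable_sqr R).
  apply: eq_integrable => // y _ /=; congr EFin.
  by rewrite vE [RHS]exprMn real_normK ?num_real// mulrC.
have V0 i : \int[N]_y gvec (s *: v) y i 0 = 0.
  under eq_Rintegral do rewrite cE.
  by rewrite RintegralZl// ?normal_mean0 ?mulr0//; exact: normal_integrable_id.
have VS i j : \int[N]_y (gvec (s *: v) y i 0 * gvec (s *: v) y j 0) =
    s ^+ 2 * (v i 0 * v j 0).
  transitivity (\int[N]_y (s ^+ 2 * (v i 0 * v j 0) * y ^+ 2)).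
    by apply: eq_Rintegral => y _; rewrite !cE; ring.
  by rewrite RintegralZl// ?normal_var1 ?mulr1//; exact: normal_integrable_sqr.
have := avg_step (cmeas_gvec (s *: v)) iV V0 VS x tf.
rewrite quadSZ; move=> /le_trans; apply; rewrite ler_wpM2l//.
rewrite mulrA -RintegralZl//; last exact: normal_integrable_abs3.
have mn : measurable_fun setT (fun y => vnorm (gvec (s *: v) y)).
  exact: (measurable_vnorm iV).
apply: le_Rintegral => //.
- apply: (ge_integrable _ _ iV); first exact: measurable_lind.
  by move=> y; rewrite ger0_norm ?lind_ge0 ?vnorm_ge0// ge_min lexx.
- by apply: integrable_scale; exact: normal_integrable_abs3.
- move=> y _; rewrite /lind ge_min; apply/orP; right.
  by rewrite vE !exprMn mulrC.
Qed.

(** The covariance of the Gaussian law encoded by [vs]. *)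
Definition outer (vs : seq 'cV[R]_r) i j : R := \sum_(v <- vs) v i 0 * v j 0.

Lemma gop_lip_close L M v q x : bdd M q -> lip L q -> 0 <= L ->
  `|gop v q x - q x| <= L * (vnorm v * m1).
Proof.
move=> bq lq L0; have mq := lip_meas_col lq.
have iq := avg_integrable N (cmeas_gvec v) x mq bq.
have ic : N.-integrable setT (EFin \o (fun=> q x)).
  exact: finite_measure_integrable_cst.
rewrite -[X in _ - X](Rint_prob_cst N) -RintegralB//.
have id := integrable_sub iq ic.
rewrite (le_trans (le_normr_Rintegral _ id))//.
rewrite mulrA -RintegralZl//; last exact: normal_integrable_abs.
apply: le_Rintegral => //.
- exact: integrable_norm.
- by apply: integrable_scale; exact: normal_integrable_abs.
- move=> y _; rewrite (le_trans (lq _ _))// addrAC subrr add0r /gvec vnormZ.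
  by rewrite -mulrA ler_wpM2l// mulrC.
Qed.

Lemma gall_taylor2 K f D H vs : taylor2 K f D H ->
  exists D' H', taylor2 K (gall vs f) D' H'.
Proof.
move=> tf; elim: vs => [|v vs [D' [H' IH]]] /=; first by exists D, H.
by eexists; eexists; exact: (avg_taylor2 N (cmeas_gvec v) IH).
Qed.

(** Adding a vector [v] produces three errors: the one for the shorter list, the one-step error of
    [v], and the change of the second-order term under [gop (s *: v)]. The last is of order
    [s ^+ 2 * s], because second derivatives are Lipschitz. [C] is chosen before [f], uniformly over
    the class. *)
Lemma gall_step K vs : exists2 C, 0 <= C & forall f D H (s : R) x,
  taylor2 K f D H -> 0 <= s -> s <= 1 ->
  `|gall [seq s *: v | v <- vs] f x - f x - 2^-1 * (s ^+ 2 * quadS (outer vs) H x)|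
  <= C * s ^+ 3.
Proof.
elim: vs => [|v vs [C C0 IH]].
  exists 0 => // f D H s x tf _ _; rewrite /= subrr mul0r.
  rewrite /quadS big1 ?mulr0 ?subrr ?normr0// => i _; rewrite big1// => j _.
  by rewrite /outer big_nil mul0r.
pose Lq := \sum_i \sum_j `|outer vs i j| * K.
exists (C + `|K| * (vnorm v ^+ 3 * m3) + 2^-1 * (`|Lq| * (vnorm v * m1))).
  have v0 := vnorm_ge0 v.
  by rewrite !addr_ge0// !mulr_ge0 ?exprn_ge0 ?invr_ge0// mulr_ge0.
move=> f D H s x tf s0 s1 /=.
have K0 : 0 <= K by case: tf.
have [bmf bmD bmH] := taylor2_bm tf.
have tH : forall i j, bdd K (H i j) /\ lip K (H i j) by case: tf.
have [bq lq] := quadS_lip (outer vs) tH; rewrite -/Lq in bq lq.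
have Lq0 : 0 <= Lq by apply: sumr_ge0 => i _; apply: sumr_ge0 => j _; rewrite mulr_ge0.
set A := gall _ _; have [mA [MA bA]] : bm A by exact: bm_gall.
have [mf [Mf bf]] := bmf; have mq := lip_meas_col lq.
have mq2 : meas_col (fun y => 2^-1 * s ^+ 2 * quadS (outer vs) H y).
  by apply: measurable_funM => //; exact: measurable_cst.
have bq2 : bdd (`|2^-1 * s ^+ 2| * Lq) (fun y => 2^-1 * s ^+ 2 * quadS (outer vs) H y).
  by move=> y; rewrite normrM ler_wpM2l.
pose B y := f y + 2^-1 * s ^+ 2 * quadS (outer vs) H y.
have mB : meas_col B by exact: measurable_funD.
have bB : bdd (Mf + `|2^-1 * s ^+ 2| * Lq) B.
  by move=> y; rewrite (le_trans (ler_normD _ _))// lerD.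
have AB y : `|A y - B y| <= C * s ^+ 3.
  by have := IH f D H s y tf s0 s1; rewrite /B opprD addrA mulrA.
have mg := cmeas_gvec (s *: v).
have s1' : `|gop (s *: v) A x - gop (s *: v) B x| <= C * s ^+ 3.
  exact: (avg_le N mg mA mB bA bB AB).
have BE : gop (s *: v) B x = gop (s *: v) f x + 2^-1 * s ^+ 2 * gop (s *: v) (quadS (outer vs) H) x.
  rewrite /gop (@avgD _ _ _ N _ _ mg _ _ _ _ x mf mq2 bf bq2).
  by rewrite (@avgZ _ _ _ N _ _ mg _ _ _ x mq bq).
have s2 := gop_step v x tf s0.
have s3 := gop_lip_close (s *: v) x bq lq Lq0.
have QE : quadS (outer (v :: vs)) H x =
    quadS (fun i j => v i 0 * v j 0) H x + quadS (outer vs) H x.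
  rewrite -quadSD /quadS; apply: eq_bigr => i _; apply: eq_bigr => j _.
  by rewrite /outer big_cons.
rewrite QE.
set q := quadS (outer vs) H in BE s3 *; set qv := quadS (fun i j => _) H x in s2 *.
rewrite [X in `|X|](_ : _ = (gop (s *: v) A x - gop (s *: v) B x) +
  (gop (s *: v) f x - f x - 2^-1 * (s ^+ 2 * qv)) +
  2^-1 * s ^+ 2 * (gop (s *: v) q x - q x)); last by rewrite BE; ring.
rewrite (le_trans (ler_normD _ _))// mulrDl lerD//.
  rewrite (le_trans (ler_normD _ _))// mulrDl lerD//.
  rewrite (le_trans s2)// (ger0_norm K0) -[leRHS]mulrA ler_wpM2l//.
  by rewrite [leRHS]mulrC.
rewrite normrM ger0_norm ?mulr_ge0 ?invr_ge0 ?exprn_ge0//.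
rewrite -!mulrA ler_wpM2l ?invr_ge0//.
rewrite vnormZ (ger0_norm s0) in s3.
rewrite (ger0_norm Lq0) [leRHS](_ : _ = s ^+ 2 * (Lq * (s * vnorm v * m1))); last by ring.
by rewrite mulrA -expr2 ler_wpM2l// exprn_ge0.
Qed.

Section trotter.
Context d (T : measurableType d) (mu : probability T R) (V : T -> 'cV[R]_r).
Hypothesis mV : cmeas V.

Lemma bm_avg h : bm h -> bm (avg mu V h).
Proof.
move=> [mh [M bh]]; split; first exact: avg_meas bh.
by exists M; exact: avg_bdd.
Qed.

Lemma bm_iter_avg n h : bm h -> bm (iter n (avg mu V) h).
Proof. by move=> bh; elim: n => //= n; exact: bm_avg. Qed.

(* Telescoping: all the functions iter k (gall us) f stay in the same Taylor class. *)
Lemma trotter K us (e : R) n f D H : taylor2 K f D H ->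
  (forall g D H, taylor2 K g D H -> forall x, `|avg mu V g x - gall us g x| <= e) ->
  forall x, `|iter n (avg mu V) f x - iter n (gall us) f x| <= n%:R * e.
Proof.
move=> tf He; have [bmf _ _] := taylor2_bm tf.
elim: n => [|n IH] x; first by rewrite subrr normr0 mul0r.
have tn : exists D' H', taylor2 K (iter n (gall us) f) D' H'.
  elim: {IH} n => [|n [D' [H' IH]]] /=; first by exists D, H.
  exact: gall_taylor2 IH.
have [D' [H' {}tn]] := tn.
rewrite !iterS -(subrKA (avg mu V (iter n (gall us) f) x)).
rewrite (le_trans (ler_normD _ _))// -[n.+1]addn1 natrD mulrDl mul1r lerD//; last exact: He tn x.
have [m1' [M1 b1]] := bm_iter_avg n bmf; have [m2' [M2 b2]] := bm_iter_gall us n bmf.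
exact: (avg_le mu mV m1' m2' b1 b2 IH).
Qed.

Lemma iter_avg_le n h h' (e : R) : bm h -> bm h' ->
  (forall x, `|h x - h' x| <= e) ->
  forall x, `|iter n (avg mu V) h x - iter n (avg mu V) h' x| <= e.
Proof.
move=> bh bh' hh'; elim: n => // n IH x; rewrite !iterS.
have [m1' [M1 b1]] := bm_iter_avg n bh; have [m2' [M2 b2]] := bm_iter_avg n bh'.
exact: (avg_le mu mV m1' m2' b1 b2 IH).
Qed.

End trotter.

Lemma gall_le vs h h' (e : R) : bm h -> bm h' ->
  (forall x, `|h x - h' x| <= e) ->
  forall x, `|gall vs h x - gall vs h' x| <= e.
Proof.
move=> bh bh' hh'; elim: vs => // v vs IH x /=.
have [m1' [M1 b1]] := bm_gall vs bh; have [m2' [M2 b2]] := bm_gall vs bh'.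
exact: (avg_le N (cmeas_gvec v) m1' m2' b1 b2 IH).
Qed.

End gaussstep.

Lemma small_invsqrt {R : realType} (C e : R) : 0 <= C -> 0 < e ->
  exists N : nat, forall n, (N <= n)%N -> C / Num.sqrt n.+1%:R <= e.
Proof.
move=> C0 e0; have [N _ HN] := nbhs_infty_gtr ((C / e) ^+ 2).
exists N => n Nn; rewrite ler_pdivrMr ?sqrtr_gt0 ?ltr0n// -ler_pdivrMl// mulrC.
rewrite -[leLHS]ger0_norm ?divr_ge0 ?(ltW e0)// -sqrtr_sqr ler_sqrt ?ltr0n//.
by rewrite (le_trans (ltW (HN n Nn)))// ler_nat.
Qed.

(** * Lindeberg comparison of normalised sums with the Gaussian law *)

Section clt.
Context {R : realType} {r : nat} d (T : measurableType d) (mu : probability T R).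
Variable V : T -> 'cV[R]_r.
Hypothesis mV : cmeas V.
Hypothesis iV : mu.-integrable setT (EFin \o (fun t => vnorm (V t) ^+ 2)).
Variable us : seq 'cV[R]_r.
Hypothesis V0 : forall i, \int[mu]_t V t i 0 = 0.
Hypothesis VS : forall i j, \int[mu]_t (V t i 0 * V t j 0) = outer us i j.

Let s n : R := (Num.sqrt n.+1%:R)^-1.

Let s0 n : 0 < s n. Proof. by rewrite invr_gt0 sqrtr_gt0. Qed.

Let s1 n : s n <= 1.
Proof. by rewrite invf_le1 ?sqrtr_gt0// -[leLHS]sqrtr1 ler_sqrt// ler1n. Qed.

Let s2 n : n.+1%:R * s n ^+ 2 = 1.
Proof. by rewrite exprVn sqr_sqrtr// divff. Qed.

Definition svec n t := s n *: V t.

Let mS n : cmeas (svec n).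
Proof. by apply: cmeasZ => //; exact: measurable_cst. Qed.

Let vS n t : vnorm (svec n t) = s n * vnorm (V t).
Proof. by rewrite vnormZ ger0_norm// ltW. Qed.

Let iS n : mu.-integrable setT (EFin \o (fun t => vnorm (svec n t) ^+ 2)).
Proof.
have := integrable_scale (s n ^+ 2) iV; apply: eq_integrable => // t _ /=.
by rewrite vS exprMn.
Qed.

(** This is [n.+1] times the expected remainder [lind] of the normalised variable, as [lind_c]
    verifies: the total error of [n.+1] replacements. *)
Let c n := \int[mu]_t Num.min (vnorm (V t) ^+ 2) (s n * vnorm (V t) ^+ 3).

Let mc n : measurable_fun setT (fun t => Num.min (vnorm (V t) ^+ 2) (s n * vnorm (V t) ^+ 3)).
Proof.
have mn := measurable_vnorm iV.
apply: measurable_minr; first exact: measurable_funX.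
by apply: measurable_funM; [exact: measurable_cst|exact: measurable_funX].
Qed.

Let c_bound n t : 0 <= Num.min (vnorm (V t) ^+ 2) (s n * vnorm (V t) ^+ 3) <= vnorm (V t) ^+ 2.
Proof.
by rewrite ge_min lexx andbT le_min exprn_ge0 ?vnorm_ge0//= mulr_ge0 ?exprn_ge0 ?vnorm_ge0// ltW.
Qed.

(** Pointwise the second branch of the minimum tends to 0, and [vnorm (V t) ^+ 2] dominates.
    Lindeberg's condition thus follows from square integrability. *)
Let c_cvg0 : c n @[n --> \oo] --> (0 : R).
Proof.
have [] := @dominated_convergence _ _ R mu setT measurableT
  (fun n t => (Num.min (vnorm (V t) ^+ 2) (s n * vnorm (V t) ^+ 3))%:E)
  (cst (0%R)%:E) (fun t => (vnorm (V t) ^+ 2)%:E).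
- by move=> n; apply/measurable_EFinP; exact: mc.
- exact: measurable_cst.
- apply/aeW => t _; apply/fine_cvgP; split; first exact: nearW.
  apply/cvgrPdist_le => e e0 /=; near=> n.
  rewrite sub0r normrN ger0_norm; last by have /andP[] := c_bound n t.
  rewrite ge_min; apply/orP; right; rewrite /s mulrC.
  near: n; have [N HN] := @small_invsqrt R (vnorm (V t) ^+ 3) e (exprn_ge0 _ (vnorm_ge0 _)) e0.
  by exists N.
- exact: iV.
- apply/aeW => t n _; rewrite lee_fin; have /andP[u v] := c_bound n t.
  by rewrite ger0_norm.
move=> _ _; rewrite integral0 => /fine_cvg; exact.
Unshelve. all: by end_near. Qed.

Let lind_c n : n.+1%:R * \int[mu]_t lind (vnorm (svec n t)) = c n.
Proof.
rewrite -RintegralZl//; last first.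
  apply: (ge_integrable _ _ (iS n)).
    by apply: measurable_lind; exact: measurable_vnorm (iS n).
  by move=> t; rewrite ger0_norm ?lind_ge0 ?vnorm_ge0// ge_min lexx.
apply: eq_Rintegral => t _; rewrite /lind minr_pMr// vS !exprMn; congr (Num.min _ _).
  by rewrite mulrA s2 mul1r.
rewrite (_ : n.+1%:R * (s n ^+ 3 * _) = (n.+1%:R * s n ^+ 2) * (s n * vnorm (V t) ^+ 3)); last by ring.
by rewrite s2 mul1r.
Qed.

Lemma clt_blip (h : 'cV[R]_r -> R) : blip h -> forall e : R, 0 < e ->
  exists N, forall n, (N <= n)%N ->
    `|iter n.+1 (avg mu (svec n)) h 0 - gall us h 0| <= e.
Proof.
move=> bh e e0; have [[M bM] [L lL]] := bh.
have bmh : bm h by split; [exact: lip_meas_col lL|exists M].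
have e4 : 0 < e / 4 by rewrite divr_gt0.
(* Two averages in each of [r] directions move [h] by at most [r * 2 * |L| * sg], hence by at most
   [e / 4]. This error is paid twice, on the side of the sums and on the Gaussian side; the
   telescoping costs another [e / 4]. *)
pose sg := (e / 4) / (r%:R * (2 * `|L|) + 1).
have den : 0 < r%:R * (2 * `|L|) + 1 :> R by rewrite ltr_wpDl// !mulr_ge0.
have sg0 : 0 < sg by rewrite divr_gt0.
have lL' : lip `|L| h by apply: lip_le lL; exact: ler_norm.
have [sf fh0] := mollify_spec 2 sg0 bh lL'.
set f := mollify sg 2 h in sf fh0.
have fh x : `|f x - h x| <= e / 4.
  rewrite (le_trans (fh0 x))// (_ : _ * _ = (e / 4) * ((r%:R * (2 * `|L|)) / (r%:R * (2 * `|L|) + 1))); last first.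
    by rewrite /sg; ring.
  by rewrite ler_piMr ?(ltW e4)// ler_pdivrMr// mul1r lerDl.
have [K [D [H tf]]] := smooth_taylor2 sf.
have [bmf _ _] := taylor2_bm tf.
have K0 : 0 <= K by case: tf.
have [C C0 HC] := gall_step K us.
(* Error of a single replacement: both operators have the same second-order expansion, since the
   covariances agree, so only the two remainders are left. *)
pose dl n := K * \int[mu]_t lind (vnorm (svec n t)) + C * s n ^+ 3.
have step n g D' H' : taylor2 K g D' H' -> forall x,
    `|avg mu (svec n) g x - gall [seq s n *: v | v <- us] g x| <= dl n.
  move=> tg x.
  have W0 i : \int[mu]_t svec n t i 0 = 0.
    under eq_Rintegral do rewrite mxE.
    by rewrite RintegralZl// ?V0 ?mulr0//; exact: (integrable_coord mV iV).
  have WS i j : \int[mu]_t (svec n t i 0 * svec n t j 0) = s n ^+ 2 * outer us i j.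
    rewrite -VS -RintegralZl//; last exact: (integrable_coord2 mV iV).
    by apply: eq_Rintegral => t _; rewrite !mxE; ring.
  have a := avg_step (mS n) (iS n) W0 WS x tg.
  have b := HC _ _ _ (s n) x tg (ltW (s0 n)) (s1 n).
  rewrite quadSZ in a.
  rewrite [X in `|X|](_ : _ =
    (avg mu (svec n) g x - g x - 2^-1 * (s n ^+ 2 * quadS (outer us) H' x)) -
    (gall [seq s n *: v | v <- us] g x - g x - 2^-1 * (s n ^+ 2 * quadS (outer us) H' x))); last by ring.
  by rewrite (le_trans (ler_normB _ _))// lerD.
have e8 : 0 < e / 8 by rewrite divr_gt0.
have [N1 HN1] := @small_invsqrt R C (e / 8) C0 e8.
have [N2 _ HN2] : \forall n \near \oo, K * c n <= e / 8.
  have /cvgrPdist_le/(_ _ e8) : K * c n @[n --> \oo] --> K * 0.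
    by apply: cvgM; [exact: cvg_cst|exact: c_cvg0].
  apply: filterS => n; rewrite mulr0 sub0r normrN; apply: le_trans.
  exact: ler_norm.
exists (maxn N1 N2) => n; rewrite geq_max => /andP[/HN1 b1 /HN2 b2].
have t1 := @trotter _ _ _ _ mu _ (mS n) K [seq s n *: v | v <- us] (dl n) n.+1 f D H tf (step n) 0.
rewrite (iter_gall n us (s0 n) bmf) in t1.
have us1 : [seq (Num.sqrt n.+1%:R * s n) *: v | v <- us] = us.
  rewrite -[RHS]map_id; apply: eq_map => v.
  by rewrite divff ?scale1r// gt_eqF// sqrtr_gt0.
rewrite us1 in t1.
have t2 : n.+1%:R * dl n <= e / 4.
  rewrite /dl mulrDr (mulrCA _ K) lind_c (_ : e / 4 = e / 8 + e / 8); last by field.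
  rewrite lerD//; rewrite (le_trans _ b1)// le_eqVlt; apply/orP; left; apply/eqP.
  rewrite (_ : n.+1%:R * (C * s n ^+ 3) = (n.+1%:R * s n ^+ 2) * (C * s n)); last by ring.
  by rewrite s2 mul1r.
have t3 := @iter_avg_le _ _ _ _ mu _ (mS n) n.+1 _ _ _ bmf bmh fh 0.
have t4 := gall_le us bmf bmh fh 0.
rewrite [X in `|X|](_ : _ = - (iter n.+1 (avg mu (svec n)) f 0 - iter n.+1 (avg mu (svec n)) h 0)
  + (iter n.+1 (avg mu (svec n)) f 0 - gall us f 0) + (gall us f 0 - gall us h 0)); last by ring.
have t5 := ler_normD (- (iter n.+1 (avg mu (svec n)) f 0 - iter n.+1 (avg mu (svec n)) h 0)
  + (iter n.+1 (avg mu (svec n)) f 0 - gall us f 0)) (gall us f 0 - gall us h 0).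
have t6 := ler_normD (- (iter n.+1 (avg mu (svec n)) f 0 - iter n.+1 (avg mu (svec n)) h 0))
  (iter n.+1 (avg mu (svec n)) f 0 - gall us f 0).
rewrite normrN in t6.
lra.
Qed.

End clt.

(** * Sums of i.i.d. variables *)

Section push.
Context {R : realType} d d' (T : measurableType d) (T' : measurableType d').

Definition pushm (mu : {measure set T -> \bar R}) (f : T -> T')
    (mf : measurable_fun setT f) : {measure set T' -> \bar R} :=
  measure_function_pushforward__canonical__measure_function_Measure mu mf.

End push.

Section independence.
Context {R : realType} {d dz : measure_display}
  {Omega : measurableType d} {Zt : measurableType dz}
  (P : probability Omega R) (Q : probability Zt R) (Zs : nat -> Omega -> Zt).
Hypothesis HZ : iid P Q Zs.

Let mZ j : measurable_fun setT (Zs j). Proof. by case: HZ. Qed.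

Definition pre k (w : Omega) : k.-tuple Zt := [tuple Zs i w | i < k].

Lemma measurable_pre k : measurable_fun setT (pre k).
Proof.
apply/measurable_fun_tnthP => i.
have -> : (@tnth k Zt ^~ i \o pre k) = Zs i.
  by apply/funext => w /=; rewrite tnth_mktuple.
exact: mZ.
Qed.

Definition cylinders k : set (set (k.-tuple Zt)) :=
  [set C | exists A : 'I_k -> set Zt, (forall i, measurable (A i)) /\
     C = [set t | forall i, A i (tnth t i)]].

Lemma cylinder_measurable k : cylinders (k := k) `<=` measurable.
Proof.
move=> _ [A [mA ->]].
have -> : [set t : k.-tuple Zt | forall i, A i (tnth t i)] =
    \bigcap_(i in [set: 'I_k]) ((@tnth k Zt)^~ i @^-1` A i).
  by apply/seteqP; split=> t /= H i; [move=> _; exact: H|exact: (H i I)].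
apply: fin_bigcap_measurable => // i _; rewrite -[X in measurable X]setTI.
exact: measurable_tnth.
Qed.

Lemma cylinder_setI k : setI_closed (cylinders (k := k)).
Proof.
move=> _ _ [A [mA ->]] [B [mB ->]].
exists (fun i => A i `&` B i); split; first by move=> i; exact: measurableI.
by apply/seteqP; split => t /=; [move=> [a b] i; split|move=> H; split => i; case: (H i)].
Qed.

Lemma cylinder_sigma k (E : set (k.-tuple Zt)) : measurable E -> <<s cylinders (k := k) >> E.
Proof.
apply: sub_sigma_algebra2 => C.
rewrite -bigcup_seq => -[/= i _ [B mB <-]].
exists (fun j => if j == i then B else setT); split.
  by move=> j; case: ifP.
apply/seteqP; split => t /=.
  by move=> [_ Bt] j; case: eqP => [->|].
by move=> /(_ i); rewrite eqxx.
Qed.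

(** Independence in [iid] takes a family of sets indexed by all naturals; [A] is continued by [B],
    and in [prob_cylinder] this continuation is evaluated only at the index [k]. *)
Definition ext k (A : 'I_k -> set Zt) (B : set Zt) (j : nat) : set Zt :=
  if insub j is Some i then A i else B.

Lemma prob_cylinder k (A : 'I_k -> set Zt) (B : set Zt) :
  (forall i, measurable (A i)) -> measurable B ->
  P ((pre k @^-1` [set t | forall i, A i (tnth t i)]) `&` (Zs k @^-1` B)) =
  (P (pre k @^-1` [set t | forall i, A i (tnth t i)]) * Q B)%E.
Proof.
move=> mA mB; have [_ [HQ HI]] := HZ.
have mE j : measurable (ext A B j) by rewrite /ext; case: insubP.
have E1 : pre k @^-1` [set t | forall i, A i (tnth t i)] =
    \big[setI/setT]_(j <- iota 0 k) (Zs j @^-1` ext A B j).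
  rewrite -bigcap_seq; apply/seteqP; split => w /=.
    move=> H j; rewrite /= mem_iota add0n => jk.
    rewrite /ext insubT /=; have := H (Ordinal jk); by rewrite tnth_mktuple.
  move=> H i; have := H i; rewrite /= mem_iota add0n ltn_ord => /(_ isT).
  by rewrite tnth_mktuple /ext valK.
have E2 : (pre k @^-1` [set t | forall i, A i (tnth t i)]) `&` (Zs k @^-1` B) =
    \big[setI/setT]_(j <- iota 0 k.+1) (Zs j @^-1` ext A B j).
  rewrite -addn1 iotaD big_cat /= big_seq1 -E1 add0n; congr (_ `&` _ @^-1` _).
  by rewrite /ext insubF// ltnn.
rewrite E2 HI ?iota_uniq// E1 HI ?iota_uniq//.
rewrite -addn1 iotaD big_cat /= big_seq1 add0n; congr (_ * _)%E.
by rewrite HQ// /ext insubF// ltnn.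
Qed.

(** For fixed [B], both sides are finite measures in [A]. They agree on cylinders, which are stable
    under intersection and generate the sigma-algebra of tuples. *)
Lemma pre_indep k (A : set (k.-tuple Zt)) (B : set Zt) : measurable A -> measurable B ->
  P ((pre k @^-1` A) `&` (Zs k @^-1` B)) = (P (pre k @^-1` A) * Q B)%E.
Proof.
move=> mA mB.
have mZB : measurable (Zs k @^-1` B) by rewrite -[X in measurable X]setTI; exact: mZ.
have QB : (0 <= fine (Q B))%R by rewrite fine_ge0.
pose m1 := pushm [the measure _ _ of mrestr P mZB] (measurable_pre (k := k)).
pose m2 := [the measure _ _ of mscale (NngNum QB) (pushm P (measurable_pre (k := k)))].
have QE : ((fine (Q B))%:E = Q B)%E by rewrite fineK// fin_num_measure.
have m1E C : m1 C = P ((pre k @^-1` C) `&` (Zs k @^-1` B)) by [].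
have m2E C : m2 C = (P (pre k @^-1` C) * Q B)%E by rewrite -QE muleC.
have : m1 A = m2 A.
  apply: (g_sigma_algebra_measure_unique (cylinders (k := k)) _ (fun=> setT)).
  - exact: cylinder_measurable.
  - move=> _; exists (fun=> setT); split => //.
    by apply/seteqP; split.
  - by apply/seteqP; split => // t _; exists 0%N.
  - exact: cylinder_setI.
  - move=> C [A' [mA' ->]].
    by rewrite m1E m2E prob_cylinder.
  - move=> _; rewrite m1E (@le_lt_trans _ _ 1%E) ?ltry//; apply: probability_le1.
    by rewrite preimage_setT setTI.
  - exact: cylinder_sigma.
by rewrite m1E m2E.
Qed.

Lemma mpair k : measurable_fun setT (fun w => (pre k w, Zs k w)).
Proof. by apply: measurable_fun_pair; [exact: measurable_pre|exact: mZ]. Qed.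

(** By [pre_indep] the joint law of the first [k] observations and the next one is a product
    measure, so Fubini applies. *)
Lemma Rintegral_indep k (F : k.-tuple Zt * Zt -> R) :
  measurable_fun setT F ->
  P.-integrable setT (EFin \o (fun w => F (pre k w, Zs k w))) ->
  (forall t, Q.-integrable setT (EFin \o (fun z => F (t, z)))) ->
  \int[P]_w F (pre k w, Zs k w) = \int[P]_w (\int[Q]_z F (pre k w, z)).
Proof.
move=> mF iP iQ.
pose X : {mfun Omega >-> k.-tuple Zt} :=
  HB.pack (pre k) (isMeasurableFun.Build _ _ _ _ _ (measurable_pre (k := k))).
pose J : {mfun Omega >-> (k.-tuple Zt * Zt)%type} :=
  HB.pack (fun w => (pre k w, Zs k w)) (isMeasurableFun.Build _ _ _ _ _ (mpair (k := k))).
pose L : probability _ R := distribution P X.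
pose LJ : probability _ R := distribution P J.
have LE A : measurable A -> (L \x Q)%E A = LJ A.
  move=> mA; apply: product_measure_unique => // B C mB mC.
  exact: (pre_indep mB mC).
have iLJ : LJ.-integrable setT (EFin \o F).
  apply: (integrable_pushforward (mpair (k := k)) (mu := P)) => //.
  exact/measurable_EFinP.
have iLQ : (L \x Q)%E.-integrable setT (EFin \o F).
  have := iLJ => /integrableP[mEF fi]; apply/integrableP; split => //.
  by rewrite (@eq_measure_integral _ _ _ _ LJ) => // A mA _; exact: LE.
have E1 : (\int[P]_w (F (pre k w, Zs k w))%:E = \int[LJ]_p (F p)%:E)%E.
  apply/esym; apply: (integral_pushforward (mpair (k := k)) (mu := P)) => //.
  exact/measurable_EFinP.
have E2 : (\int[LJ]_p (F p)%:E = \int[L \x Q]_p (F p)%:E)%E.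
  by apply/esym/eq_measure_integral => A mA _; exact: LE.
pose G t := \int[Q]_z F (t, z).
have GE t : fubini_F Q (EFin \o F) t = (G t)%:E.
  rewrite /fubini_F /G /Rintegral fineK//; apply: integrable_fin_num => //.
  exact: iQ.
have iL : L.-integrable setT (EFin \o G).
  have := integrable_fubini_F iLQ; apply: eq_integrable => // t _.
have iPG : P.-integrable setT (EFin \o (fun w => G (pre k w))).
  have mG : measurable_fun setT G by exact: integrable_measurable iL.
  apply/integrableP; split.
    by apply/measurable_EFinP; apply: (measurableT_comp mG); exact: measurable_pre.
  have /integrableP[mEG] := iL; apply: le_lt_trans.
  rewrite [leRHS](ge0_integral_pushforward (measurable_pre (k := k)))//.
  by do 2 apply: measurableT_comp => //.
have E4 : (\int[L]_t (G t)%:E = \int[P]_w (G (pre k w))%:E)%E.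
  apply: (integral_pushforward (measurable_pre (k := k)) (mu := P)) => //.
  exact: measurable_int iL.
rewrite /Rintegral E1 E2; congr fine.
rewrite -(integral12_prod_meas1 iLQ) -E4.
by apply: eq_integral => t _; rewrite GE.
Qed.

Lemma Rintegral_indep_bdd k (F : k.-tuple Zt * Zt -> R) M :
  measurable_fun setT F -> bdd M F ->
  \int[P]_w F (pre k w, Zs k w) = \int[P]_w (\int[Q]_z F (pre k w, z)).
Proof.
move=> mF bF; apply: Rintegral_indep => //.
  apply: (bdd_integrable P (M := M) (g := fun w => F (pre k w, Zs k w))).
    exact: (measurableT_comp mF (mpair (k := k))).
  by move=> w; exact: bF.
move=> t; apply: (bdd_integrable Q (g := fun z => F (t, z))); last by move=> z; exact: bF.
by apply: (measurableT_comp mF); exact: measurable_pair1.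
Qed.

Lemma Rintegral_law j (f : Zt -> R) : measurable_fun setT f ->
  Q.-integrable setT (EFin \o f) ->
  P.-integrable setT (EFin \o (fun w => f (Zs j w))) /\
  \int[P]_w f (Zs j w) = \int[Q]_z f z.
Proof.
move=> mf fi; have [_ [HQ _]] := HZ.
have push (g : Zt -> \bar R) : measurable_fun setT g -> (forall x, 0 <= g x)%E ->
    (\int[P]_w g (Zs j w) = \int[Q]_z g z)%E.
  move=> mg g0.
  have <- := ge0_integral_pushforward (mZ j) P measurableT mg (fun y _ => g0 y).
  by apply: eq_measure_integral => A mA _; exact: HQ.
have iP : P.-integrable setT (EFin \o (fun w => f (Zs j w))).
  apply/integrableP; split; first by apply/measurable_EFinP; exact: (measurableT_comp mf (mZ j)).
  rewrite (push (fun z => `|(f z)%:E|%E))//; first by case/integrableP : fi.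
  by do 2 apply: measurableT_comp => //.
split => //; rewrite /Rintegral; congr fine.
have mEf : measurable_fun setT (EFin \o f) by exact/measurable_EFinP.
have <- := integral_pushforward (mZ j) mEf iP measurableT.
by apply: eq_measure_integral => A mA _; exact: HQ.
Qed.

(** Integrating out the last observation replaces [h] by [avg Q V h] and leaves a sum with one term
    less. *)
Lemma Rintegral_sum_avg r (V : Zt -> 'cV[R]_r) : cmeas V ->
  forall k h x, bm h ->
  \int[P]_w h (x + \sum_(j < k) V (Zs j w)) = iter k (avg Q V) h x.
Proof.
move=> mV; elim=> [|k IH] h x bh.
  by under eq_Rintegral do rewrite big_ord0 addr0; rewrite Rint_prob_cst.
have [mh [M bM]] := bh.
pose F (p : k.-tuple Zt * Zt) := h (x + \sum_(j < k) V (tnth p.1 j) + V p.2).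
have mF : measurable_fun setT F.
  apply: meas_col_comp mh _; apply: cmeasD.
    apply: cmeasD; first exact: cmeas_cst.
    apply: cmeas_sum => j; apply: (cmeas_comp mV).
    by apply: (measurableT_comp (measurable_tnth j)); exact: measurable_fst.
  by apply: (cmeas_comp mV); exact: measurable_snd.
have pE w j : tnth (pre k w) j = Zs j w by rewrite tnth_mktuple.
transitivity (\int[P]_w F (pre k w, Zs k w)).
  apply: eq_Rintegral => w _; rewrite /F /= big_ord_recr/= addrA.
  by under [in RHS]eq_bigr do rewrite pE.
rewrite (@Rintegral_indep_bdd k F M mF); last by move=> p; exact: bM.
rewrite iterSr -IH; last exact: bm_avg.
apply: eq_Rintegral => w _; rewrite /F /avg /=.
by under [in LHS]eq_bigr do rewrite pE.
Qed.

End independence.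

(** * The Gaussian density *)

Section schur.
Context {R : realType} {r : nat}.
Variables (a : R) (b : 'cV[R]_r) (D : 'M[R]_r).

Definition posdef k (S : 'M[R]_k) := forall x : 'cV[R]_k, x != 0 -> 0 < (x^T *m S *m x) 0 0.

Let S : 'M[R]_(1 + r) := block_mx a%:M b^T b D.

Definition schur := D - a^-1 *: (b *m b^T).

Definition elim_mx : 'M[R]_(1 + r) := block_mx 1%:M 0 (- (a^-1 *: b)) 1%:M.
Definition elim_inv : 'M[R]_(1 + r) := block_mx 1%:M 0 (a^-1 *: b) 1%:M.

Lemma elim_mxK : elim_inv *m elim_mx = 1%:M.
Proof.
rewrite /elim_inv /elim_mx mulmx_block !(mulmx0, mul0mx, mulmx1, mul1mx, addr0, add0r).
by rewrite subrr -scalar_mx_block.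
Qed.

(** One step of symmetric block elimination. The determinant and the inverse quadratic form are both
    read off from it. *)
Lemma schur_factor : a != 0 ->
  S = elim_inv *m block_mx a%:M 0 0 schur *m elim_inv^T.
Proof.
move=> a0; rewrite /elim_inv tr_block_mx !mulmx_block.
rewrite !(mulmx0, mul0mx, mulmx1, mul1mx, addr0, add0r, trmx0, trmx1).
rewrite /S /schur; congr block_mx.
- by rewrite mul_scalar_mx linearZ/= scalerA divff ?scale1r.
- by rewrite mul_mx_scalar scalerA divff ?scale1r.
- rewrite mul_mx_scalar scalerA divff// scale1r linearZ/= -scalemxAr.
  by rewrite addrC subrK.
Qed.

Lemma det_schur : a != 0 -> \det S = a * \det schur.
Proof.
move=> a0; rewrite schur_factor// !det_mulmx det_tr /elim_inv !det_lblock.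
by rewrite !det1 !mul1r !mulr1 det_scalar1.
Qed.

(** The first term is the exponent of the marginal law of the first coordinate, the second that of
    the conditional law of the others: mean [(x0 / a) *: b], covariance the Schur complement. *)
Lemma schur_quad (x0 : R) (y : 'cV[R]_r) : a != 0 -> schur \in unitmx ->
  ((col_mx x0%:M y)^T *m invmx S *m col_mx x0%:M y) 0 0 =
  x0 ^+ 2 / a + ((y - (x0 / a) *: b)^T *m invmx schur *m (y - (x0 / a) *: b)) 0 0.
Proof.
move=> a0 uS'.
pose M := elim_mx^T *m block_mx (a^-1)%:M 0 0 (invmx schur) *m elim_mx.
have SM : S *m M = 1%:M.
  rewrite /M schur_factor// -!mulmxA (mulmxA elim_inv^T) -trmx_mul.
  have -> : elim_mx *m elim_inv = 1%:M by apply: mulmx1C; exact: elim_mxK.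
  have DD : @mulmx _ (1 + r) (1 + r) (1 + r) (block_mx a%:M 0 0 schur)
      (block_mx (a^-1)%:M 0 0 (invmx schur)) = 1%:M.

    rewrite mulmx_block !(mulmx0, mul0mx, addr0, add0r) mulmxV// -scalar_mxM divff//.
    by rewrite -scalar_mx_block.
  by rewrite trmx1 mul1mx (mulmxA (block_mx a%:M 0 0 schur)) DD mul1mx elim_mxK.
have uS : S \in unitmx by case: (mulmx1_unit SM).
have -> : invmx S = M by rewrite -[M]mul1mx -(mulVmx uS) -mulmxA SM mulmx1.
rewrite /M -!mulmxA mulmxA -trmx_mul.
have -> : elim_mx *m col_mx x0%:M y = col_mx x0%:M (y - (x0 / a) *: b).
  rewrite /elim_mx mul_block_col !(mul1mx, mul0mx, addr0).
  congr col_mx; rewrite mulNmx -scalemxAl mul_mx_scalar scalerA addrC.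
  by rewrite (mulrC x0).
set z := y - _.
rewrite mul_block_col !mul0mx addr0 add0r tr_col_mx mul_row_col.
rewrite -scalar_mxM tr_scalar_mx -scalar_mxM [LHS]mxE.
by rewrite mxE eqxx mulr1n; field.
Qed.

Lemma quad_col (x0 : R) (y : 'cV[R]_r) :
  ((col_mx x0%:M y)^T *m S *m col_mx x0%:M y) 0 0 =
  a * x0 ^+ 2 + 2 * x0 * dotv b y + (y^T *m D *m y) 0 0.
Proof.
rewrite /S -mulmxA mul_block_col tr_col_mx mul_row_col tr_scalar_mx.
rewrite !mulmxDr [LHS]mxE [X in X + _]mxE [X in _ + X]mxE.
rewrite -!scalar_mxM [X in X + _ + _]mxE eqxx mulr1n.
have -> : (x0%:M *m (b^T *m y)) 0 0 = x0 * dotv b y.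
  by rewrite mul_scalar_mx mxE dotvE.
have -> : (y^T *m (b *m x0%:M)) 0 0 = x0 * dotv b y.
  by rewrite mul_mx_scalar -scalemxAr mxE dotvE dotvC.
rewrite mulmxA.
ring.
Qed.

Lemma schur_posdef : posdef S -> 0 < a /\ posdef schur.
Proof.
move=> pS.
have a0 : 0 < a.
  have := pS (col_mx 1%:M 0); rewrite quad_col expr1n mulr1 dotv0r mulr0 addr0.
  rewrite mulmx0 mxE addr0; apply.
  apply/eqP => /(congr1 usubmx); rewrite col_mxKu linear0 => /matrixP/(_ 0 0)/eqP.
  by rewrite !mxE oner_eq0.
(* For given [y], this first coordinate minimises the quadratic form of [S], and the minimum is the
   form of the Schur complement. *)
split => // y y0; have := pS (col_mx (- (dotv b y / a))%:M y).
rewrite quad_col /schur => H.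
have -> : (y^T *m (D - a^-1 *: (b *m b^T)) *m y) 0 0 =
   a * (- (dotv b y / a)) ^+ 2 + 2 * (- (dotv b y / a)) * dotv b y + (y^T *m D *m y) 0 0.
  have qb : (y^T *m (b *m b^T) *m y) 0 0 = dotv b y ^+ 2.
    have -> : y^T *m (b *m b^T) *m y = (y^T *m b) *m (b^T *m y) by rewrite !mulmxA.
    by rewrite mxE big_ord1 !dotvE (dotvC y b) expr2.
  rewrite mulmxBr mulmxBl [LHS]mxE [X in _ + X]mxE addrC; congr (_ + _).
  rewrite -scalemxAr -scalemxAl mxE qb.
  by field; rewrite gt_eqF.
apply: H; apply: contra_neq y0 => /(congr1 dsubmx).
by rewrite col_mxKd linear0.
Qed.

End schur.

Section gaussian.
Context {R : realType}.
Local Notation leb := (@lebesgue_measure R).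

Lemma schur_sym r (a : R) (b : 'cV[R]_r) (D : 'M[R]_r) : D^T = D -> (schur a b D)^T = schur a b D.
Proof.
by move=> sD; rewrite /schur linearB/= sD linearZ/= trmx_mul trmxK.
Qed.

Lemma gauss_dens_schur r (a x0 : R) (b y : 'cV[R]_r) (D : 'M[R]_r) :
  0 < a -> 0 < \det (schur a b D) ->
  gauss_dens (block_mx a%:M b^T b D : 'M[R]_(1 + r)) (col_mx x0%:M y) =
  normal_pdf 0 (Num.sqrt a) x0 * gauss_dens (schur a b D) (y - (x0 / a) *: b).
Proof.
move=> a0 dS; have an0 : a != 0 by rewrite gt_eqF.
have uS : schur a b D \in unitmx by rewrite unitmxE unitfE gt_eqF.
rewrite /gauss_dens schur_quad// det_schur//.
have sa : Num.sqrt a ^+ 2 = a by rewrite sqr_sqrtr// ltW.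
have sa0 : Num.sqrt a != 0 by rewrite gt_eqF// sqrtr_gt0.
have two (x : R) : x *+ 2 = 2 * x by rewrite mulr_natl.
have two' (x : R) : a * x *+ 2 = 2 * (a * x) by rewrite mulr_natl.
rewrite normal_pdfE// /normal_peak /normal_fun subr0 sa two' (two a).
set q := (_ *m _) 0 0; set dd := \det _.
rewrite mulrACA; congr (_ * _).
  rewrite -invfM -sqrtrM; last by rewrite !mulr_ge0 ?pi_ge0// ltW.
  by congr (Num.sqrt _)^-1; rewrite exprS; ring.
by rewrite -expRD; congr expR; field.
Qed.

Lemma posdef_det r (S : 'M[R]_r) : S^T = S -> posdef S -> 0 < \det S.
Proof.
elim: r S => [|r IH] S sS pS; first by rewrite det_mx00.
pose a := S 0 0; pose b : 'cV[R]_r := @dlsubmx R 1 r 1 r S; pose D : 'M[R]_r := @drsubmx R 1 r 1 r S.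
have SE : S = block_mx a%:M b^T b D :> 'M[R]_(1 + r).
  rewrite -[LHS](@submxK R 1 r 1 r) -/b -/D; congr block_mx.
    apply/matrixP => i j; rewrite !ord1 !mxE eqxx mulr1n /a; congr (S _ _); exact/val_inj.
  by rewrite /b -[in RHS]sS trmx_dlsub trmxK.
rewrite SE in pS sS *; have [a0 pS'] := schur_posdef pS.
have sD : D^T = D.
  by have /(@eq_block_mx R 1 r 1 r)[] := etrans (esym (@tr_block_mx R 1 r 1 r a%:M b^T b D)) sS.
rewrite det_schur ?gt_eqF// mulr_gt0// IH//.
exact: schur_sym.
Qed.

Lemma gall_scale r (us : seq 'cV[R]_r) c h x : bm h ->
  gall us (fun y => c * h y) x = c * gall us h x.
Proof.
move=> bh; elim: us x => //= u us IH x.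
rewrite (gop_ext _ _ IH); have [mg [M bg]] := bm_gall us bh.
exact: (avgZ _ (cmeas_gvec u) _ _ mg bg).
Qed.

Lemma gall_embed r (us : seq 'cV[R]_r) (h : 'cV[R]_(1 + r) -> R) (x0 : R) y :
  gall us (fun y => h (col_mx x0%:M y)) y =
  gall [seq col_mx 0 u | u <- us] h (col_mx x0%:M y).
Proof.
elim: us y => //= u us IH y; rewrite (gop_ext _ _ IH) /gop /avg.
apply: eq_Rintegral => t _; congr (gall _ _ _).
by rewrite /gvec scale_col_mx scaler0 add_col_mx addr0.
Qed.

Lemma col_vcons r (x0 : R) (y : 'I_r -> R) :
  \col_(i < r.+1) vcons x0 y i = col_mx x0%:M (\col_i y i) :> 'cV[R]_(1 + r).
Proof.
apply/colP => i; rewrite -[i](@splitK 1 r i) mxE /vcons; case: (@fintype.split 1 r i) => j /=.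
  rewrite col_mxEu mxE !ord1 eqxx mulr1n.
  by rewrite (_ : lshift r 0 = ord0) ?unlift_none//; exact/val_inj.
rewrite col_mxEd mxE (_ : rshift 1 j = lift ord0 j) ?liftK//.
by apply/val_inj; rewrite /= /bump/=.
Qed.

Lemma cmeas_col_mx r d (T : measurableType d) (f : T -> R) (V : T -> 'cV[R]_r) :
  measurable_fun setT f -> cmeas V ->
  cmeas (fun t => col_mx (f t)%:M (V t) : 'cV[R]_(1 + r)).
Proof.
move=> mf mV i; rewrite -[i](@splitK 1 r i); case: (@fintype.split 1 r i) => i' /=.
  by under eq_fun do rewrite col_mxEu mxE ord1 eqxx mulr1n.
by under eq_fun do rewrite col_mxEd; exact: mV.
Qed.

Lemma eq_iter_int r (F G : ('I_r -> R) -> R) : F =1 G -> iter_int F = iter_int G.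
Proof. by move=> FG; congr iter_int; exact/funext. Qed.

(** The vectors are the columns of a Cholesky factor, built by elimination of the first coordinate.
    The centre [c] has to be general: conditioning on the first coordinate shifts the remaining
    ones. *)
Lemma iter_int_gauss r (S : 'M[R]_r) : S^T = S -> posdef S ->
  exists2 us, (forall i j, outer us i j = S i j) &
    forall h c, bm h ->
      iter_int (fun x => h (\col_i x i) * gauss_dens S (\col_i x i - c)) = gall us h c.
Proof.
elim: r S => [|r IH] S sS pS.
  exists [::]; first by case.
  move=> h c bh /=; rewrite /gauss_dens /iter_int /=.
  have z0 (z : 'cV[R]_0) : z = c by apply/colP; case.
  rewrite (z0 (\col_i 0)) subrr det_mx00 expr0 mulr1 sqrtr1 invr1 mul1r.
  by rewrite mulmx0 mxE oppr0 mul0r expR0 mulr1.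
pose a := S 0 0; pose b : 'cV[R]_r := @dlsubmx R 1 r 1 r S; pose D : 'M[R]_r := @drsubmx R 1 r 1 r S.
have SE : S = block_mx a%:M b^T b D :> 'M[R]_(1 + r).
  rewrite -[LHS](@submxK R 1 r 1 r) -/b -/D; congr block_mx.
    apply/matrixP => i j; rewrite !ord1 !mxE eqxx mulr1n /a; congr (S _ _); exact/val_inj.
  by rewrite /b -[in RHS]sS trmx_dlsub trmxK.
clearbody a b D; subst S.
have [a0 pS'] := schur_posdef pS.
have sD : D^T = D.
  by have /(@eq_block_mx R 1 r 1 r)[] := etrans (esym (@tr_block_mx R 1 r 1 r a%:M b^T b D)) sS.
have sS' := schur_sym a b sD.
have dS' := posdef_det sS' pS'.
have [us outE usE] := IH _ sS' pS'.
have sa0 : 0 < Num.sqrt a by rewrite sqrtr_gt0.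
have sa : Num.sqrt a ^+ 2 = a by rewrite sqr_sqrtr// ltW.
(* First Cholesky column: its outer product reproduces the first row and column of [S], and what
   remains in the lower block is the Schur complement. *)
pose v0 : 'cV[R]_(1 + r) := col_mx (Num.sqrt a)%:M ((Num.sqrt a)^-1 *: b).
exists (v0 :: [seq col_mx 0 u | u <- us]).
  move=> i j; rewrite /outer big_cons big_map -/(outer us).
  rewrite -[i](@splitK 1 r i) -[j](@splitK 1 r j) /v0.
  have out0 : forall k l, \sum_(u <- us) u k 0 * u l 0 = schur a b D k l by exact: outE.
  case: (@fintype.split 1 r i) => i'; case: (@fintype.split 1 r j) => j' /=.
  - rewrite (@block_mxEul R 1 r 1 r) !(@col_mxEu R 1 r 1) !mxE !ord1 eqxx !mulr1n -expr2 sa big1 ?addr0// => u _.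
    by rewrite !(@col_mxEu R 1 r 1) !mxE mulr0.
  - rewrite (@block_mxEur R 1 r 1 r) (@col_mxEu R 1 r 1) (@col_mxEd R 1 r 1) !mxE !ord1 eqxx mulr1n mulrA divff ?gt_eqF// mul1r.
    by rewrite big1 ?addr0// => u _; rewrite !(@col_mxEu R 1 r 1) !mxE mul0r.
  - rewrite (@block_mxEdl R 1 r 1 r) (@col_mxEu R 1 r 1) (@col_mxEd R 1 r 1) !mxE !ord1 eqxx mulr1n mulrC mulrA divff ?gt_eqF// mul1r.
    by rewrite big1 ?addr0// => u _; rewrite !(@col_mxEu R 1 r 1) !mxE mulr0.
  - rewrite (@block_mxEdr R 1 r 1 r) !(@col_mxEd R 1 r 1).
    under eq_bigr do rewrite !(@col_mxEd R 1 r 1).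
    rewrite out0 /schur !mxE big_ord1 !mxE.
    rewrite (_ : _ * (_ * _) = a^-1 * (b i' 0 * b j' 0)); first by ring.
    by rewrite -{3}sa; field; rewrite gt_eqF.
move=> h c bh.
have [mh [M bM]] := bh.
pose c0 : R := c ord0 0; pose c1 : 'cV[R]_r := @dsubmx R 1 r 1 c.
have cE : c = col_mx c0%:M c1 :> 'cV[R]_(1 + r).
  rewrite -[LHS](@vsubmxK R 1 r 1) -/c1; congr col_mx.
  by apply/matrixP => i j; rewrite !ord1 !mxE eqxx mulr1n; congr (c _ _); exact/val_inj.
pose G : 'cV[R]_(1 + r) -> R := @gall R (1 + r) [seq col_mx 0 u | u <- us] h.
have [mG [MG bG]] : bm G by exact: bm_gall.
(* The first coordinate [x] followed by the conditional mean of the rest. Substituting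
   [x = Num.sqrt a * y + c0] turns it into [c + y *: v0], the argument of the one-dimensional
   operator. *)
pose W (x : R) : 'cV[R]_(1 + r) := col_mx x%:M (c1 + ((x - c0) / a) *: b).
have mW : cmeas (W : measurableTypeR R -> _).
  apply: cmeas_col_mx; first exact: measurable_id.
  apply: cmeasD; first exact: cmeas_cst.
  apply: cmeasZ; first exact: cmeas_cst.
  apply: measurable_funM; last exact: measurable_cst.
  by apply: measurable_funB; [exact: measurable_id|exact: measurable_cst].
have bslice x0 : bm (fun y => h (col_mx x0%:M y)).
  split; last by exists M => y; exact: bM.
  apply: (meas_col_comp (r := r.+1) mh).
  by apply: cmeas_col_mx; [exact: measurable_cst|exact: cmeas_col].
transitivity (\int[leb]_x (G (W x) * normal_pdf c0 (Num.sqrt a) x)).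
  rewrite [LHS]/=; apply: eq_Rintegral => x _.
  transitivity (iter_int (fun y : 'I_r -> R =>
      (normal_pdf c0 (Num.sqrt a) x * h (col_mx x%:M (\col_i y i))) *
      gauss_dens (schur a b D) (\col_i y i - (c1 + ((x - c0) / a) *: b)))).
    apply: eq_iter_int => y.
    have Ed : \col_(i < r.+1) vcons x y i - c = col_mx (x - c0)%:M (\col_i y i - c1) :> 'cV[R]_(1 + r).
      rewrite (col_vcons x y) [in LHS]cE (@opp_col_mx R 1 r 1) (@add_col_mx R 1 r 1).
      by rewrite -raddfN -raddfD.
    rewrite Ed (col_vcons x y) [in RHS]mulrC.
    have -> := gauss_dens_schur (x - c0) (\col_i y i - c1) a0 dS'.
    rewrite -addrA -opprD [in RHS]mulrA mulrC; congr (_ * _).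
    by rewrite mulrC; congr (_ * _); rewrite !normal_pdfE ?gt_eqF// /normal_fun subr0.
  rewrite (usE (fun y => normal_pdf c0 (Num.sqrt a) x * h (col_mx x%:M y))); last first.
    have [ms [Ms bs]] := bslice x; split.
      by apply: measurable_funM => //; exact: measurable_cst.
    by exists (`|normal_pdf c0 (Num.sqrt a) x| * Ms) => y; rewrite normrM ler_wpM2l.
  by rewrite gall_scale// gall_embed mulrC.
have mGW : measurable_fun setT (fun x => G (W x)) by exact: (meas_col_comp (T := measurableTypeR R) mG mW).
have bGW : bdd MG (fun x => G (W x)) by move=> x; exact: bG.
have E1 := @Rintegral_normal_prob R c0 (Num.sqrt a) (fun x => G (W x)) mGW (bdd_integrable_pdf c0 (Num.sqrt a) mGW bGW).
have E2 := Rintegral_normal_affine c0 sa0 mGW bGW.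
apply: (etrans (esym E1)); apply: (etrans E2).
rewrite [RHS]/= -/G /gop /avg.
apply: eq_Rintegral => y _; congr (G _).
have -> : c + gvec v0 y = col_mx c0%:M c1 + col_mx (y *: (Num.sqrt a)%:M) (y *: ((Num.sqrt a)^-1 *: b)) :> 'cV[R]_(1 + r).
  by rewrite {1}cE /gvec /v0 (@scale_col_mx R 1 r 1).
rewrite /W (@add_col_mx R 1 r 1); congr (@col_mx R 1 r 1).
  by rewrite scale_scalar_mx -raddfD/= addrC mulrC.
rewrite addrK scalerA; congr (_ + _ *: _).
by rewrite -[X in _ / X]sa; field; rewrite gt_eqF.
Qed.

End gaussian.

(** * Bounded continuous functions and Slutsky's lemma *)

Section inf_convolution.
Context {R : realType} {r : nat} (h : 'cV[R]_r -> R) (M : R).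
Hypotheses (bh : bdd M h) (ch : econt h).

(** The largest [k]-Lipschitz minorant of [h]; it increases to [h] when [h] is bounded and
    continuous. *)
Definition infconv (k : nat) x : R := inf [set h y + k%:R * vnorm (x - y) | y in [set: 'cV[R]_r]].

Let lb k x : lbound [set h y + k%:R * vnorm (x - y) | y in [set: 'cV[R]_r]] (- M).
Proof.
move=> _ [y _ <-]; rewrite (@le_trans _ _ (h y))//.
  by have := bh y; rewrite ler_norml => /andP[].
by rewrite lerDl mulr_ge0// vnorm_ge0.
Qed.

Let hinf k x : has_inf [set h y + k%:R * vnorm (x - y) | y in [set: 'cV[R]_r]].
Proof. by split; [exists (h x + k%:R * vnorm (x - x)); exists x|exists (- M); exact: lb]. Qed.

Lemma infconv_le k x y : infconv k x <= h y + k%:R * vnorm (x - y).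
Proof. by apply: ge_inf; [exists (- M); exact: lb|exists y]. Qed.

Lemma infconv_le_self k x : infconv k x <= h x.
Proof. by have := infconv_le k x x; rewrite subrr vnorm0 mulr0 addr0. Qed.

Lemma infconv_ge k x c : (forall y, c <= h y + k%:R * vnorm (x - y)) -> c <= infconv k x.
Proof. by move=> H; apply: lb_le_inf; [case: (hinf k x)|move=> _ [y _ <-]]. Qed.

Lemma infconv_bdd k : bdd M (infconv k).
Proof.
move=> x; rewrite ler_norml; apply/andP; split.
  by apply: infconv_ge => y; apply: (lb (k := k) (x := x)); exists y.
by rewrite (le_trans (infconv_le_self k x))//; have := bh x; rewrite ler_norml => /andP[].
Qed.

Lemma infconv_lip k : lip k%:R (infconv k).
Proof.
have H x y : infconv k x - infconv k y <= k%:R * vnorm (x - y).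
  rewrite lerBlDr -lerBlDl; apply: infconv_ge => z.
  rewrite lerBlDr (le_trans (infconv_le k x z))// -addrA lerD2l -mulrDr ler_wpM2l//.
  have -> : x - z = (y - z) + (x - y) by rewrite [RHS]addrC subrKA.
  exact: vnormD.
move=> x y; rewrite ler_norml H andbT lerNl opprB.
by rewrite vnormB H.
Qed.

(** Points within [dl] of [x] are handled by continuity. Farther away, once [k] exceeds
    [(M + M) / dl], the penalty outweighs the oscillation of [h]. *)
Lemma infconv_cvg x : infconv k x @[k --> \oo] --> h x.
Proof.
apply/cvgrPdist_le => e e0 /=.
have [dl [dl0 Hdl]] := ch x e0.
near=> k; rewrite ger0_norm ?subr_ge0 ?infconv_le_self// lerBlDr addrC -lerBlDr.
apply: infconv_ge => y; have [xy|xy] := ltP (vnorm (y - x)) dl.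
  have := Hdl y xy; rewrite ltr_norml => /andP[h1 _].
  by rewrite ler_wpDr ?mulr_ge0 ?vnorm_ge0// lerBlDr -lerBlDl ltW// ltrBlDl -ltrBlDr; lra.
have k1 : (M + M) / dl <= k%:R.
  by apply: ltW; near: k; exact: nbhs_infty_gtr.
have k2 : M + M <= k%:R * vnorm (x - y).
  rewrite vnormB (@le_trans _ _ (k%:R * dl))//; first by rewrite -ler_pdivrMr.
  by rewrite ler_wpM2l.
have := bh x; have := bh y; rewrite !ler_norml => /andP[y1 _] /andP[_ x2].
lra.
Unshelve. all: by end_near. Qed.

Lemma infconv_blip k : blip (infconv k).
Proof. by split; [exists M; exact: infconv_bdd|exists k%:R; exact: infconv_lip]. Qed.

End inf_convolution.

(** * From bounded Lipschitz to bounded continuous test functions *)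

Section portmanteau.
Context {R : realType} {r : nat} {d} {Omega : measurableType d} (P : probability Omega R).
Variables (X : nat -> Omega -> 'cV[R]_r) (us : seq 'cV[R]_r).
Hypothesis mX : forall n, cmeas (X n).

Definition weak_lim (h : 'cV[R]_r -> R) := forall e : R, 0 < e ->
  exists N, forall n, (N <= n)%N -> `|\int[P]_w h (X n w) - gall us h 0| <= e.

Lemma gall_cvg (hk : nat -> 'cV[R]_r -> R) h M x :
  (forall k, meas_col (hk k)) -> (forall k, bdd M (hk k)) ->
  (forall y, hk k y @[k --> \oo] --> h y) ->
  gall us (hk k) x @[k --> \oo] --> gall us h x.
Proof.
move=> mh bh hh; elim: us x => [|u vs IH] x /=; first exact: hh.
apply: (@avg_cvg R _ _ (normal_prob 0 1) _ (gvec u) (cmeas_gvec u) M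
  (fun k => gall vs (hk k)) (gall vs h) x) => [k|k|y].
- by have [] := gall_spec vs (mh k) (bh k).
- by have [] := gall_spec vs (mh k) (bh k).
- exact: IH.
Qed.

Let iX n h M : meas_col h -> bdd M h -> P.-integrable setT (EFin \o (fun w => h (X n w))).
Proof.
move=> mh bh; apply: (bdd_integrable P (M := M)); last by move=> w; exact: bh.
exact: meas_col_comp mh (mX n).
Qed.

(** Inf-convolutions approach [h] from below, so they give only a lower bound for the expectations;
    the upper bound comes from applying this to [-h]. *)
Lemma weak_lower h M : (forall g, blip g -> weak_lim g) -> bdd M h -> econt h ->
  forall e : R, 0 < e -> exists N, forall n, (N <= n)%N ->
    gall us h 0 - e <= \int[P]_w h (X n w).
Proof.
move=> HL bh ch e e0.
have mk k : meas_col (infconv h k) by apply: lip_meas_col; exact: infconv_lip bh _.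
have e2 : 0 < e / 2 by rewrite divr_gt0.
have [K _ HK] : \forall k \near \oo, `|gall us h 0 - gall us (infconv h k) 0| <= e / 2.
  have /cvgrPdist_le := @gall_cvg (infconv h) h M 0 mk (infconv_bdd bh) (infconv_cvg bh ch).
  exact.
have {}HK := HK K (leqnn K).
have [N HN] := HL _ (infconv_blip bh K) _ e2.
exists N => n /HN {}HN.
have le1 : \int[P]_w infconv h K (X n w) <= \int[P]_w h (X n w).
  apply: le_Rintegral => //.
  - exact: (iX n (mk K) (@infconv_bdd _ _ _ _ bh K)).
  - exact: (iX n (econt_meas_col ch) bh).
  - by move=> w _; exact: infconv_le_self.
move: HN HK; rewrite !ler_norml => /andP[a1 a2] /andP[b1 b2]; lra.
Qed.

Lemma weak_bounded_cont h : (forall g, blip g -> weak_lim g) -> bounded_cont h -> weak_lim h.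
Proof.
move=> HL [[M bh] ch] e e0.
have mh := econt_meas_col ch.
have [N1 H1] := weak_lower HL bh ch e0.
have bh' : bdd M (fun x => - 1 * h x) by move=> x; rewrite mulN1r normrN.
have ch' : econt (fun x => - 1 * h x).
  move=> x eps eps0; have [dl [dl0 H]] := ch x _ eps0; exists dl; split => // y /H.
  by rewrite !mulN1r -opprD normrN.
have [N2 H2] := weak_lower HL bh' ch' e0.
exists (maxn N1 N2) => n; rewrite geq_max => /andP[/H1 {}H1 /H2].
have bmh : bm h by split => //; exists M.
rewrite gall_scale// RintegralZl//; last exact: (iX n mh bh).
by rewrite ler_norml => H3; apply/andP; split; lra.
Qed.

End portmanteau.

Section slutsky.
Context {R : realType} {r : nat} {d} {Omega : measurableType d} (P : probability Omega R).
Variables (X Y : nat -> Omega -> 'cV[R]_r) (us : seq 'cV[R]_r).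
Hypotheses (mX : forall n, cmeas (X n)) (mY : forall n, cmeas (Y n)).
Hypothesis XY : forall e : R, 0 < e -> forall dl : R, 0 < dl -> exists N, forall n, (N <= n)%N ->
  exists A, measurable A /\ [set w | e < vnorm (X n w - Y n w)] `<=` A /\ (P A < dl%:E)%E.

Lemma slutsky h : blip h -> weak_lim P Y us h -> weak_lim P X us h.
Proof.
move=> [[M bh] [L lh]] HY e e0.
have mh := lip_meas_col lh.
have M0 := bdd_ge0 bh.
have e4 : 0 < e / 4 by rewrite divr_gt0.
(* Outside [A] the vectors differ by at most [e1], which costs at most [e / 4] through the Lipschitz
   constant; on [A], of probability below [e2], the crude bound [M + M] costs another [e / 4]. *)
pose e1 := e / 4 / (`|L| + 1); pose e2 := e / 4 / (M + M + 1).
have L1 : 0 < `|L| + 1 by rewrite ltr_wpDl.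
have M1 : 0 < M + M + 1 by rewrite ltr_wpDl// addr_ge0.
have e10 : 0 < e1 by rewrite divr_gt0.
have e20 : 0 < e2 by rewrite divr_gt0.
have [N1 H1] := XY e10 e20.
have [N2 H2] := HY _ e4.
exists (maxn N1 N2) => n; rewrite geq_max => /andP[/H1[A [mA [sA PA]]] /H2 {}H2].
have iX : P.-integrable setT (EFin \o (fun w => h (X n w))).
  apply: (bdd_integrable P (M := M)); last by move=> w; exact: bh.
  exact: meas_col_comp mh (mX n).
have iY : P.-integrable setT (EFin \o (fun w => h (Y n w))).
  apply: (bdd_integrable P (M := M)); last by move=> w; exact: bh.
  exact: meas_col_comp mh (mY n).
have iA : P.-integrable setT (EFin \o (\1_A : Omega -> R)) by exact: integrable_indic.
have ic : P.-integrable setT (EFin \o (fun=> e / 4)).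
  exact: finite_measure_integrable_cst.
have iAM := integrable_scale (M + M) iA.
have iB := integrable_add ic iAM.
have id := integrable_sub iX iY.
have H3 : `|\int[P]_w h (X n w) - \int[P]_w h (Y n w)| <= e / 4 + (M + M) * fine (P A).
  rewrite -RintegralB// (le_trans (le_normr_Rintegral _ id))//.
  have -> : e / 4 + (M + M) * fine (P A) = \int[P]_w (e / 4 + (M + M) * \1_A w).
    rewrite (RintegralD measurableT ic iAM) Rint_prob_cst (RintegralZl _ measurableT iA).
    by rewrite /Rintegral integral_indic// setIT.
  apply: le_Rintegral => //; first exact: integrable_norm.
  move=> w _; rewrite indicE.
  have [wA|wA] := boolP (w \in A).
    rewrite mulr1 (le_trans (ler_normB _ _))// ler_wpDl ?(ltW e4)// lerD//; exact: bh.
  rewrite mulr0 addr0 (le_trans (lh _ _))//.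
  have : ~ (e1 < vnorm (X n w - Y n w)).
    by move=> H; move/negP: wA; apply; rewrite inE; exact: sA.
  move=> /negP; rewrite -leNgt => v1.
  rewrite (@le_trans _ _ ((`|L| + 1) * e1))//.
    rewrite (@le_trans _ _ ((`|L| + 1) * vnorm (X n w - Y n w)))//.
      by rewrite ler_wpM2r ?vnorm_ge0// (le_trans (ler_norm _))// lerDl.
    by rewrite ler_wpM2l// ltW.
  by rewrite /e1 mulrC divfK// gt_eqF.
have H4 : (M + M) * fine (P A) <= e / 4.
  have PAe : fine (P A) <= e2.
    by rewrite -lee_fin fineK ?fin_num_measure// ltW.
  rewrite (@le_trans _ _ ((M + M + 1) * e2))//.
    by rewrite ler_pM ?addr_ge0 ?fine_ge0// lerDl.
  by rewrite /e2 mulrC divfK// gt_eqF.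
rewrite -(subrKA (\int[P]_w h (Y n w))) (le_trans (ler_normD _ _))//.
lra.
Qed.

End slutsky.

(** * The tilting equation *)

Section linear_algebra.
Context {R : realType} {k : nat}.
Implicit Types (A : 'M[R]_k) (x y : 'cV[R]_k).

Lemma coercive_unitmx A (c : R) : 0 < c ->
  (forall x, c * vnorm x ^+ 2 <= dotv x (A *m x)) -> A \in unitmx.
Proof.
move=> c0 H; rewrite -unitmx_tr -row_free_unit -kermx_eq0; apply/rowV0P => v /sub_kermxP vA.
have Av : A *m v^T = 0 by rewrite -[A]trmxK -trmx_mul vA trmx0.
have := H v^T; rewrite Av dotv0r => H0.
have : vnorm v^T = 0.
  apply/eqP; rewrite -sqrf_eq0; apply/eqP/le_anti; rewrite sqr_ge0 andbT.
  by rewrite -(pmulr_rle0 _ c0).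
by move/vnorm_eq0 => v0; rewrite -[v]trmxK v0 trmx0.
Qed.

Lemma coercive_inv_bound A (c : R) y : 0 < c ->
  (forall x, c * vnorm x ^+ 2 <= dotv x (A *m x)) ->
  vnorm (invmx A *m y) <= vnorm y / c.
Proof.
move=> c0 H; have uA := coercive_unitmx c0 H.
set x := invmx A *m y.
have xy : A *m x = y by rewrite /x mulmxA mulmxV// mul1mx.
have := H x; rewrite xy => /le_trans/(_ (dotv_le x y)).
have [->|x0] := eqVneq (vnorm x) 0.
  by move=> _; rewrite divr_ge0 ?vnorm_ge0// ltW.
have xp : 0 < vnorm x by rewrite lt_def x0 vnorm_ge0.
rewrite ler_pdivlMr// expr2 mulrA [leRHS]mulrC ler_pM2r//.
by rewrite mulrC.
Qed.

End linear_algebra.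

Lemma pow2_small {R : realType} (C e : R) : 0 <= C -> 0 < e ->
  exists n, C / 2 ^+ n <= e.
Proof.
move=> C0 e0; have Ce : 0 <= C / e by apply: divr_ge0 => //; exact: ltW.
exists (Num.bound (C / e)); rewrite ler_pdivrMr ?exprn_gt0// mulrC -ler_pdivrMr//.
rewrite (le_trans (ltW (archi_boundP Ce)))// -natrX ler_nat ltnW//.
exact: ltn_expl.
Qed.

(** The intervals of radius [2 * K / 2 ^+ n] around [a n] are nested; the supremum of their left
    ends lies in all of them. *)
Lemma geometric_limit {R : realType} (a : nat -> R) (K : R) :
  (forall n, `|a n.+1 - a n| <= K / 2 ^+ n) ->
  exists l, forall n, `|a n - l| <= 2 * K / 2 ^+ n.
Proof.
move=> H.
have K0 : 0 <= K by have := H 0%N; rewrite expr0 divr1; exact: le_trans.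
pose lo n := a n - 2 * K / 2 ^+ n; pose hi n := a n + 2 * K / 2 ^+ n.
have half n : 2 * K / 2 ^+ n.+1 = K / 2 ^+ n.
  by rewrite exprS; field; rewrite expf_neq0.
have lo_nd : nondecreasing_seq lo.
  apply/nondecreasing_seqP => n; rewrite /lo half.
  have := H n; rewrite ler_norml => /andP[]; rewrite -mulrA; lra.
have hi_ni n p : hi (n + p)%N <= hi n.
  elim: p => [|p IH]; first by rewrite addn0.
  rewrite (le_trans _ IH)// addnS /hi half.
  have := H (n + p)%N; rewrite ler_norml => /andP[]; rewrite -mulrA; lra.
have lohi n p : lo n <= hi p.
  rewrite (le_trans (lo_nd _ _ (leq_addr p n)))//.
  rewrite (le_trans _ (hi_ni p n))// addnC /lo /hi.
  by rewrite lerBlDr -addrA lerDl addr_ge0// divr_ge0 ?mulr_ge0// exprn_ge0.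
exists (sup (range lo)) => n; rewrite ler_distlC; apply/andP; split.
  apply: ub_le_sup; last by exists n.
  by exists (hi 0%N) => _ [p _ <-]; exact: lohi.
apply: ge_sup; first by exists (lo 0%N), 0%N.
by move=> _ [p _ <-]; exact: lohi.
Qed.

(** Iteration from 0, with limits taken coordinatewise by [geometric_limit]. The factor [k] in [K]
    serves the passage to the limit only and does not enter the conclusion. *)
Lemma contraction_fixpoint {R : realType} {k : nat} (T : 'cV[R]_k -> 'cV[R]_k) (rho : R) :
  0 <= rho ->
  (forall x, vnorm x <= rho -> vnorm (T x) <= rho) ->
  (forall x y, vnorm x <= rho -> vnorm y <= rho ->
     vnorm (T x - T y) <= 2^-1 * vnorm (x - y)) ->
  exists2 x, vnorm x <= rho & T x = x.
Proof.
move=> r0 TT TL.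
pose z n := iter n T 0.
have zr n : vnorm (z n) <= rho by elim: n => [|n]; [rewrite vnorm0|exact: TT].
have zd n : vnorm (z n.+1 - z n) <= rho / 2 ^+ n.
  elim: n => [|n IH]; first by rewrite expr0 divr1 subr0.
  apply: le_trans (TL _ _ (zr n.+1) (zr n)) _; rewrite (le_trans (ler_wpM2l _ IH))//.
  by rewrite exprS le_eqVlt; apply/orP; left; apply/eqP; field; rewrite expf_neq0.
have /choice [l lP] i : exists l, forall n, `|z n i 0 - l| <= 2 * rho / 2 ^+ n.
  apply: geometric_limit => n.
  by have := ler_coord_vnorm (z n.+1 - z n) i; rewrite !mxE => /le_trans; exact.
pose x := \col_i l i.
pose K := k%:R * (2 * rho).
have K0 : 0 <= K by rewrite !mulr_ge0.
have zx n : vnorm (z n - x) <= K / 2 ^+ n.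
  rewrite (le_trans (vnorm_le_sum _))//.
  rewrite (@le_trans _ _ (\sum_(i < k) (2 * rho / 2 ^+ n)))//.
    by apply: ler_sum => i _; rewrite !mxE.
  by rewrite sumr_const card_ord -[X in X <= _]mulr_natl /K mulrA.
have xr : vnorm x <= rho.
  apply/ler_addgt0Pr => e e0; have [n nP] := pow2_small K0 e0.
  rewrite -[x](subrK (z n)) (le_trans (vnormD _ _))// addrC lerD//.
  by rewrite vnormB (le_trans (zx n)).
exists x => //; apply/eqP; rewrite -subr_eq0; apply/eqP/vnorm_eq0.
apply/le_anti; rewrite vnorm_ge0 andbT; apply/ler_addgt0Pr => e e0; rewrite add0r.
have [n nP] := pow2_small K0 (divr_gt0 e0 (ltr0n R 2)).
rewrite (_ : T x - x = (T x - T (z n)) + (z n.+1 - x)); last by rewrite addrA subrK.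
rewrite (le_trans (vnormD _ _))// [e]splitr lerD//.
  rewrite (le_trans (TL _ _ xr (zr n)))// vnormB.
  have := zx n; have := vnorm_ge0 (z n - x); lra.
rewrite (le_trans (zx _))// (le_trans _ nP)// ler_wpM2l//.
by rewrite lef_pV2 ?posrE ?exprn_gt0// exprS ler_peMl ?exprn_ge0// ler1n.
Qed.

(* 1/(1+x) = 1 - x + [gfun x] *)
Definition gfun {R : realType} (x : R) : R := x ^+ 2 / (1 + x).

(** The increment factors as [x - y] times [(x + y + x * y) / ((1 + x) * (1 + y))]. The numerator is
    at most [5/2 * q] and the denominator at least 1/4, whence the 10. *)
Lemma gfun_lip {R : realType} (q x y : R) : q <= 2^-1 -> `|x| <= q -> `|y| <= q ->
  `|gfun x - gfun y| <= 10 * q * `|x - y|.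
Proof.
move=> q2 xq yq; have q0 : 0 <= q by exact: le_trans (normr_ge0 _) xq.
have [x1 x2] : - q <= x /\ x <= q by move: xq; rewrite ler_norml => /andP.
have [y1 y2] : - q <= y /\ y <= q by move: yq; rewrite ler_norml => /andP.
have ax : 2^-1 <= 1 + x by lra.
have ay : 2^-1 <= 1 + y by lra.
have p : 4^-1 <= (1 + x) * (1 + y).
  by rewrite (_ : 4^-1 = 2^-1 * 2^-1) ?ler_pM//; field.
have -> : gfun x - gfun y = (x - y) * ((x + y + x * y) / ((1 + x) * (1 + y))).
  by rewrite /gfun; field; apply/andP; split; rewrite gt_eqF//; lra.
rewrite normrM mulrC ler_wpM2r// normrM normfV.
rewrite [X in _ / X]ger0_norm ?(le_trans _ p)//.
rewrite ler_pdivrMr; last by rewrite (lt_le_trans _ p).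
rewrite (@le_trans _ _ (10 * q * 4^-1))//; last by rewrite ler_wpM2l ?mulr_ge0.
have xy : `|x * y| <= 2^-1 * q.
  by rewrite normrM ler_pM// (le_trans xq).
rewrite (le_trans (ler_normD _ _))//.
have := ler_normD x y; lra.
Qed.

Lemma opnorm_ge0 {R : realType} p q (A : 'M[R]_(p, q)) : 0 <= opnorm A.
Proof.
rewrite /opnorm; set S := [set _ | _ in _].
(* In dimension 0 there is no unit vector, and the supremum of the empty set has the default value
   0. *)
have [->|/set0P[y Sy]] := eqVneq S set0; first by rewrite sup0.
have [x x1 yx] := Sy; rewrite (@le_trans _ _ y)//.
  by rewrite -yx vnorm_ge0.
apply: ub_le_sup => //; exists (frob A) => _ /= [z z1 <-].
by rewrite -[leRHS]mulr1 -z1 vnorm_mulmx_frob.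
Qed.

(** * The tilting equation for one fixed sample *)

Section empirical_likelihood.
Context {R : realType} {n k : nat}.
Variable (u : 'I_n -> 'cV[R]_k).
Hypothesis n0 : (0 < n)%N.
Implicit Types (x y z : 'cV[R]_k).

Let nR : 0 < n%:R :> R. Proof. by rewrite ltr0n. Qed.

Definition wbar : 'M[R]_k := n%:R^-1 *: \sum_j (u j *m (u j)^T).
Definition ubar : 'cV[R]_k := n%:R^-1 *: \sum_j u j.

Lemma wbar_mul y : wbar *m y = n%:R^-1 *: \sum_j (dotv (u j) y *: u j).
Proof.
rewrite /wbar -scalemxAl mulmx_suml; congr (_ *: _); apply: eq_bigr => j _.
rewrite -mulmxA [X in _ *m X](_ : _ = (dotv (u j) y)%:M) ?mul_mx_scalar//.
by rewrite [LHS]mx11_scalar dotvE.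
Qed.

Lemma dotv_wbar x y : dotv x (wbar *m y) = n%:R^-1 * \sum_j (dotv (u j) x * dotv (u j) y).
Proof.
rewrite wbar_mul dotvZr; congr (_ * _).
rewrite dotvC dotv_suml; apply: eq_bigr => j _.
by rewrite dotvZl mulrC.
Qed.

Variables (c0 C0 : R).
Hypotheses (c00 : 0 < c0) (C00 : 0 <= C0).
Hypothesis wlow : forall x, c0 * vnorm x ^+ 2 <= dotv x (wbar *m x).
Hypothesis whigh : forall x, dotv x (wbar *m x) <= C0 * vnorm x ^+ 2.

(** Cauchy-Schwarz over the sample; the mean of the squares of [dotv (u j) d] is the quadratic form
    of [wbar], hence at most [C0 * vnorm d ^+ 2]. *)
Lemma weighted_sum (F : 'I_n -> R) (d : 'cV[R]_k) m (p : 'I_n -> 'cV[R]_m) (kap : R) :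
  0 <= kap -> (forall j, `|F j| <= kap * `|dotv (u j) d|) ->
  vnorm (n%:R^-1 *: \sum_j (F j *: p j)) <=
  kap * (Num.sqrt (n%:R^-1 * \sum_j vnorm (p j) ^+ 2) * (Num.sqrt C0 * vnorm d)).
Proof.
move=> k0 HF.
have i0 : 0 <= n%:R^-1 :> R by rewrite invr_ge0.
rewrite vnormZ (ger0_norm i0) (le_trans (ler_wpM2l i0 (vnorm_sum _ _ _)))//.
pose a : 'cV[R]_n := \col_j vnorm (p j).
pose b : 'cV[R]_n := \col_j `|dotv (u j) d|.
have H1 : \sum_j vnorm (F j *: p j) <= kap * dotv a b.
  rewrite /dotv mulr_sumr; apply: ler_sum => j _.
  rewrite vnormZ !mxE [X in kap * X]mulrC mulrA ler_wpM2r ?vnorm_ge0//.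
have aE : vnorm a = Num.sqrt (\sum_j vnorm (p j) ^+ 2).
  by congr Num.sqrt; apply: eq_bigr => j _; rewrite mxE.
have bE : n%:R^-1 * vnorm b ^+ 2 <= C0 * vnorm d ^+ 2.
  rewrite (le_trans _ (whigh d))// dotv_wbar ler_wpM2l// sqr_vnorm.
  by apply: ler_sum => j _; rewrite !mxE -normrM ger0_norm// -expr2 sqr_ge0.
have bE' : Num.sqrt n%:R^-1 * vnorm b <= Num.sqrt C0 * vnorm d.
  rewrite -ler_sqr ?nnegrE ?mulr_ge0 ?vnorm_ge0//.
  by rewrite !exprMn (sqr_sqrtr i0) (sqr_sqrtr C00); exact: bE.
rewrite (le_trans (ler_wpM2l i0 H1))// mulrCA ler_wpM2l//.
rewrite (le_trans (ler_wpM2l i0 (dotv_le a b)))// aE sqrtrM//.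
set v := Num.sqrt (\sum_j _); rewrite -[X in X * _](sqr_sqrtr i0).
rewrite [leLHS](_ : _ = Num.sqrt n%:R^-1 * v * (Num.sqrt n%:R^-1 * vnorm b)); last by ring.
by rewrite ler_wpM2l// mulr_ge0 ?sqrtr_ge0.
Qed.

(** Pairing the sum with itself and dividing by its norm brings in the quadratic form of [wbar]
    twice. Using [weighted_sum] with [p = u] would instead involve the mean of [vnorm (u j) ^+ 2],
    the trace of [wbar], which can be as large as [k * C0]. *)
Lemma weighted_sum_u (F : 'I_n -> R) (d : 'cV[R]_k) (kap : R) :
  0 <= kap -> (forall j, `|F j| <= kap * `|dotv (u j) d|) ->
  vnorm (n%:R^-1 *: \sum_j (F j *: u j)) <= kap * (C0 * vnorm d).
Proof.
move=> k0 HF; set v := _ *: _.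
have i0 : 0 <= n%:R^-1 :> R by rewrite invr_ge0.
have C1 x : Num.sqrt (dotv x (wbar *m x)) <= Num.sqrt C0 * vnorm x.
  rewrite -[X in _ * X]ger0_norm ?vnorm_ge0// -sqrtr_sqr -sqrtrM//.
  by rewrite ler_wsqrtr.
have H : vnorm v ^+ 2 <= kap * (C0 * vnorm d) * vnorm v.
  rewrite sqr_vnorm {1}/v dotvZl dotv_suml.
  rewrite (@le_trans _ _ (n%:R^-1 * (kap * \sum_j (`|dotv (u j) d| * `|dotv (u j) v|))))//.
    rewrite ler_wpM2l// mulr_sumr; apply: ler_sum => j _.
    rewrite dotvZl (le_trans (ler_norm _))// normrM mulrA ler_wpM2r//.
  rewrite mulrCA -!mulrA ler_wpM2l//.
  pose a : 'cV[R]_n := \col_j `|dotv (u j) d|.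
  pose b : 'cV[R]_n := \col_j `|dotv (u j) v|.
  have -> : \sum_j (`|dotv (u j) d| * `|dotv (u j) v|) = dotv a b.
    by apply: eq_bigr => j _; rewrite !mxE.
  rewrite (le_trans (ler_wpM2l i0 (dotv_le a b)))//.
  have nE x : Num.sqrt n%:R^-1 * vnorm (\col_(j < n) `|dotv (u j) x|) = Num.sqrt (dotv x (wbar *m x)).
    rewrite dotv_wbar sqrtrM//; congr (_ * Num.sqrt _).
    by apply: eq_bigr => j _; rewrite mxE real_normK ?num_real// expr2.
  rewrite -[X in X * _](sqr_sqrtr i0).
  rewrite [leLHS](_ : _ = (Num.sqrt n%:R^-1 * vnorm a) * (Num.sqrt n%:R^-1 * vnorm b)); last by ring.
  rewrite !nE -[C0](sqr_sqrtr C00).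
  rewrite [leRHS](_ : _ = (Num.sqrt C0 * vnorm d) * (Num.sqrt C0 * vnorm v)); last by ring.
  by rewrite ler_pM.
have [->|v0] := eqVneq (vnorm v) 0.
  by rewrite !mulr_ge0 ?vnorm_ge0.
by move: H; rewrite expr2 ler_pM2r// lt_def v0 vnorm_ge0.
Qed.

Lemma gfun_le (q x : R) : q <= 2^-1 -> `|x| <= q -> `|gfun x| <= 10 * q * `|x|.
Proof.
move=> q2 xq; have := @gfun_lip _ q x 0 q2 xq.
have -> : gfun 0 = 0 :> R by rewrite /gfun expr0n/= mul0r.
by rewrite !subr0 normr0; apply; exact: le_trans xq.
Qed.

Lemma inv1DE (x : R) : 0 < 1 + x -> (1 + x)^-1 = 1 - x + gfun x.
Proof. by move=> x0; rewrite /gfun; field; rewrite gt_eqF. Qed.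

Definition el_rem z : 'cV[R]_k := n%:R^-1 *: \sum_j (gfun (dotv (u j) z) *: u j).

Lemma tilt_sum m (p : 'I_n -> 'cV[R]_m) z : (forall j, 0 < 1 + dotv (u j) z) ->
  n%:R^-1 *: \sum_j ((1 + dotv (u j) z)^-1 *: p j) =
  n%:R^-1 *: \sum_j p j - (n%:R^-1 *: \sum_j (p j *m (u j)^T)) *m z
  + n%:R^-1 *: \sum_j (gfun (dotv (u j) z) *: p j).
Proof.
move=> pz; rewrite -scalemxAl -scalerBr -scalerDr; congr (_ *: _).
rewrite mulmx_suml -sumrB -big_split; apply: eq_bigr => j _ /=.
rewrite inv1DE// !scalerDl scale1r scaleNr; congr (_ - _ + _).
rewrite -mulmxA [X in _ = _ *m X](_ : _ = (dotv (u j) z)%:M) ?mul_mx_scalar//.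
by rewrite [LHS]mx11_scalar dotvE.
Qed.

(* Pairing the difference of the two equations with d = z1 - z2 gives
   sum_j (u_j . d)^2 / ((1 + u_j . z1) (1 + u_j . z2)) = 0. *)
Lemma el_unique z1 z2 :
  (forall j, 0 < 1 + dotv (u j) z1) -> (forall j, 0 < 1 + dotv (u j) z2) ->
  n%:R^-1 *: \sum_j ((1 + dotv (u j) z1)^-1 *: u j) = 0 ->
  n%:R^-1 *: \sum_j ((1 + dotv (u j) z2)^-1 *: u j) = 0 ->
  z1 = z2.
Proof.
move=> p1 p2 e1 e2; pose dl := z1 - z2.
have n1 : n%:R^-1 != 0 :> R by rewrite invr_eq0 gt_eqF.
have s0 z : n%:R^-1 *: \sum_j ((1 + dotv (u j) z)^-1 *: u j) = 0 ->
    \sum_j ((1 + dotv (u j) z)^-1 * dotv (u j) dl) = 0.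
  move=> /eqP; rewrite scaler_eq0 (negbTE n1)/= => /eqP h.
  rewrite -[RHS](dotv0l dl) -h dotv_suml.
  by apply: eq_bigr => j _; rewrite dotvZl.
have udl j : dotv (u j) dl = 0.
  have : \sum_j (dotv (u j) dl ^+ 2 * ((1 + dotv (u j) z1)^-1 * (1 + dotv (u j) z2)^-1)) = 0.
    rewrite (_ : \sum_j _ = \sum_j ((1 + dotv (u j) z2)^-1 * dotv (u j) dl) -
      \sum_j ((1 + dotv (u j) z1)^-1 * dotv (u j) dl)); first by rewrite !s0// subrr.
    rewrite -sumrB; apply: eq_bigr => i _; rewrite {1 2}/dl dotvDr dotvNr.
    have := p1 i; have := p2 i; move=> /gt_eqF a /gt_eqF b.
    by field; rewrite a b.
  move/eqP; rewrite psumr_eq0; last first.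
    by move=> i _; rewrite mulr_ge0 ?sqr_ge0// mulr_ge0// invr_ge0 ltW.
  move=> /allP/(_ j); rewrite mem_index_enum/= => /(_ isT).
  by rewrite mulf_eq0 [X in _ || X]gt_eqF ?mulr_gt0 ?invr_gt0// orbF sqrf_eq0 => /eqP.
have : c0 * vnorm dl ^+ 2 <= 0.
  rewrite (le_trans (wlow dl))// dotv_wbar big1 ?mulr0// => j _.
  by rewrite udl mul0r.
rewrite pmulr_rle0// => h; have : vnorm dl = 0.
  by apply/eqP; rewrite -sqrf_eq0 eq_le h sqr_ge0.
by move/vnorm_eq0/eqP; rewrite subr_eq0 => /eqP.
Qed.

Variables (t B : R).
Hypothesis ut : vnorm ubar <= t.
Hypothesis uB : forall j, vnorm (u j) <= B.
(** The fixed-point map sends 0 to a vector of norm at most [t / c0]. With contraction factor 1/2,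
    twice this radius gives a ball that is mapped into itself; [q] bounds all [dotv (u j) z] on that
    ball. *)
Let rho := 2 * t / c0.
Let q := B * rho.
Hypothesis q2 : q <= 2^-1.
Hypothesis qc : 10 * q * C0 <= 2^-1 * c0.

Let t0 : 0 <= t. Proof. exact: le_trans (vnorm_ge0 _) ut. Qed.
Let rho0 : 0 <= rho. Proof. by rewrite divr_ge0 ?mulr_ge0// ltW. Qed.
Let B0 : 0 <= B.
Proof. exact: le_trans (vnorm_ge0 _) (uB (Ordinal n0)). Qed.
Let q0 : 0 <= q. Proof. exact: mulr_ge0. Qed.
Let uq j z : vnorm z <= rho -> `|dotv (u j) z| <= q.
Proof.
move=> zr; rewrite (le_trans (cauchy_schwarz _ _))//.
by rewrite ler_pM ?vnorm_ge0.
Qed.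

Let u1 j z : vnorm z <= rho -> 0 < 1 + dotv (u j) z.
Proof. by move=> /(uq j); rewrite ler_norml => /andP[]; move: q2; lra. Qed.

Lemma el_exists : exists2 z, vnorm z <= rho &
  n%:R^-1 *: \sum_j ((1 + dotv (u j) z)^-1 *: u j) = 0.
Proof.
have uW := coercive_unitmx c00 wlow.
pose T z := invmx wbar *m (ubar + el_rem z).
have TL x y : vnorm x <= rho -> vnorm y <= rho ->
    vnorm (T x - T y) <= 2^-1 * vnorm (x - y).
  move=> xr yr; rewrite /T -mulmxBr opprD addrACA subrr add0r.
  rewrite (le_trans (coercive_inv_bound _ c00 wlow))// ler_pdivrMr//.
  rewrite /el_rem -scalerBr -sumrB.
  under eq_bigr do rewrite -scalerBl.
  rewrite (@le_trans _ _ (10 * q * (C0 * vnorm (x - y))))//.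
    apply: weighted_sum_u; first by rewrite mulr_ge0.
    move=> j; rewrite (le_trans (gfun_lip q2 (uq j xr) (uq j yr)))//.
    by rewrite dotvDr dotvNr.
  by rewrite mulrA [leRHS]mulrAC ler_wpM2r ?vnorm_ge0.
have r00 : vnorm (0 : 'cV[R]_k) <= rho by rewrite vnorm0.
have T0 : vnorm (T 0) <= t / c0.
  rewrite /T /el_rem big1; last first.
    by move=> j _; rewrite dotv0r /gfun expr0n/= mul0r scale0r.
  rewrite scaler0 addr0 (le_trans (coercive_inv_bound _ c00 wlow))//.
  by rewrite ler_wpM2r// invr_ge0 ltW.
have TT x : vnorm x <= rho -> vnorm (T x) <= rho.
  move=> xr; rewrite -[T x](subrK (T 0)) (le_trans (vnormD _ _))//.
  have := TL x 0 xr r00; rewrite subr0.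
  have -> : rho = 2 * (t / c0) by rewrite mulrA.
  have := T0; have := xr; rewrite /rho -mulrA; lra.
have [z zr Tz] := contraction_fixpoint rho0 TT TL.
exists z => //; rewrite tilt_sum; last by move=> j; exact: u1.
rewrite -/ubar -/wbar -/(el_rem z) addrAC; apply/eqP; rewrite subr_eq0 -{2}Tz.
by rewrite /T mulmxA mulmxV// mul1mx.
Qed.

(** The three summands bound the sampling error of the cross moments acting on [z], the replacement
    of [z] by [invmx W *m ubar], and the quadratic part [gfun] of the weights. *)
Lemma el_linearization (r : nat) (psi : 'I_n -> 'cV[R]_r) (A : 'M[R]_(r, k)) (W : 'M[R]_k) z (w K Psi x : R) :
  (forall y, c0 * vnorm y ^+ 2 <= dotv y (W *m y)) ->
  opnorm (wbar - W) <= w -> frob A <= K ->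
  n%:R^-1 * \sum_j vnorm (psi j) ^+ 2 <= Psi ->
  frob (n%:R^-1 *: \sum_j (psi j *m (u j)^T - A)) <= x ->
  vnorm z <= rho -> n%:R^-1 *: \sum_j ((1 + dotv (u j) z)^-1 *: u j) = 0 ->
  vnorm (n%:R^-1 *: \sum_j ((1 + dotv (u j) z)^-1 *: psi j)
    - (n%:R^-1 *: \sum_j psi j - A *m (invmx W *m ubar))) <=
  x * rho + K * ((w + 10 * q * C0) * rho / c0)
  + 10 * q * (Num.sqrt Psi * (Num.sqrt C0 * rho)).
Proof.
move=> Wlow Ww AK PP cx zr ez.
have uW := coercive_unitmx c00 Wlow.
have pz j : 0 < 1 + dotv (u j) z by exact: u1.
have gz j : `|gfun (dotv (u j) z)| <= 10 * q * `|dotv (u j) z|.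
  by apply: gfun_le => //; exact: uq.
have qq : 0 <= 10 * q by rewrite mulr_ge0.
have ubarE : ubar = wbar *m z - el_rem z.
  move: ez; rewrite tilt_sum// -/ubar -/wbar -/(el_rem z) => /eqP.
  by rewrite addrAC subr_eq0 => /eqP <-; rewrite addrK.
(* Solving the equation with [W] in place of [wbar] leaves exactly these two error terms. *)
have zE : z - invmx W *m ubar = invmx W *m (el_rem z - (wbar - W) *m z).
  rewrite ubarE mulmxBl !mulmxBr [invmx W *m (W *m z)]mulmxA mulVmx// mul1mx.
  by rewrite !opprB addrC -!addrA; congr (_ + _); rewrite addrC.
set c := n%:R^-1 *: \sum_j (psi j *m (u j)^T - A) in cx *.
have cE : n%:R^-1 *: \sum_j (psi j *m (u j)^T) = c + A.
  rewrite /c sumrB scalerBr sumr_const card_ord -(scaler_nat (R:=R) n A) scalerA mulVf ?gt_eqF//.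
  by rewrite scale1r subrK.
rewrite tilt_sum// cE mulmxDl.
set g := _ *: \sum_j (gfun _ *: _); set pb := _ *: \sum_j _.
have -> : pb - (c *m z + A *m z) + g - (pb - A *m (invmx W *m ubar)) =
    - (c *m z) - A *m (z - invmx W *m ubar) + g.
  rewrite mulmxBr; move: (c *m z) (A *m z) (A *m _) => a1 a2 a3.
  by apply/colP => i; rewrite !mxE; ring.
rewrite (le_trans (vnormD _ _))// lerD//; last first.
  rewrite (le_trans (weighted_sum _ qq gz))// ler_wpM2l//.
  by rewrite ler_pM ?mulr_ge0 ?sqrtr_ge0 ?vnorm_ge0// ?ler_wsqrtr// ler_wpM2l ?sqrtr_ge0.
rewrite (le_trans (vnormD _ _))// !vnormN lerD//.
  by rewrite (le_trans (vnorm_mulmx_frob _ _))// ler_pM ?frob_ge0 ?vnorm_ge0.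
rewrite (le_trans (vnorm_mulmx_frob _ _))// ler_pM ?frob_ge0 ?vnorm_ge0// zE.
rewrite (le_trans (coercive_inv_bound _ c00 Wlow))// ler_pM2r ?invr_gt0//.
rewrite (le_trans (vnormD _ _))// vnormN mulrDl addrC lerD//.
  rewrite (le_trans (vnorm_mulmx_opnorm _ _))// ler_pM ?vnorm_ge0//.
  exact: opnorm_ge0.
rewrite (le_trans (weighted_sum_u qq gz))// -[leRHS]mulrA ler_wpM2l// ler_wpM2l//.
Qed.

End empirical_likelihood.

(** * Square-integrable functions and empirical means *)

Section square_integrable.
Context {R : realType} d (T : measurableType d) (mu : probability T R).
Implicit Types f g : T -> R.

Definition ip f g : R := \int[mu]_z (f z * g z).

Lemma L2_mul f g : L2 mu f -> L2 mu g -> mu.-integrable setT (EFin \o (fun z => f z * g z)).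
Proof.
move=> [mf f2] [mg g2]; apply: (ge_integrable _ _ (integrable_add f2 g2)).
  exact: measurable_funM.
move=> z /=; rewrite normrM -(real_normK (num_real (f z))) -(real_normK (num_real (g z))).
have := normr_ge0 (f z); have := normr_ge0 (g z); move: `|f z| `|g z| => a b; nra.
Qed.

Lemma L2_cst c : L2 mu (fun=> c).
Proof. by split=> //; exact: finite_measure_integrable_cst. Qed.

Lemma L2_integrable f : L2 mu f -> mu.-integrable setT (EFin \o f).
Proof.
move=> lf; apply: eq_integrable (L2_mul lf (L2_cst 1)) => // x _ /=.
by rewrite mulr1.
Qed.

Lemma L2D f g : L2 mu f -> L2 mu g -> L2 mu (fun z => f z + g z).
Proof.
move=> lf lg; have [mf f2] := lf; have [mg g2] := lg.
split; first exact: measurable_funD.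
have := integrable_add (integrable_add f2 g2) (integrable_scale 2 (L2_mul lf lg)).
by apply: eq_integrable => // z _ /=; congr EFin; ring.
Qed.

Lemma L2Z c f : L2 mu f -> L2 mu (fun z => c * f z).
Proof.
move=> [mf f2]; split; first exact: measurable_funM.
apply: eq_integrable (integrable_scale (c ^+ 2) f2) => // z _ /=.
by rewrite exprMn.
Qed.

Lemma L2B f g : L2 mu f -> L2 mu g -> L2 mu (fun z => f z - g z).
Proof.
move=> lf lg; have := L2D lf (L2Z (-1) lg).
by under eq_fun do rewrite mulN1r.
Qed.

Lemma L2_sum (I : Type) (s : seq I) (F : I -> T -> R) : (forall i, L2 mu (F i)) ->
  L2 mu (fun z => \sum_(i <- s) F i z).
Proof.
move=> lF; elim: s => [|i s IH].
  by under eq_fun do rewrite big_nil; exact: L2_cst.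
by under eq_fun do rewrite big_cons; exact: L2D.
Qed.

Lemma ipC f g : ip f g = ip g f.
Proof. by apply: eq_Rintegral => z _; rewrite mulrC. Qed.

Lemma ipDl f g h : L2 mu f -> L2 mu g -> L2 mu h ->
  ip (fun z => f z + g z) h = ip f h + ip g h.
Proof.
move=> lf lg lh; rewrite /ip -RintegralD//; [|exact: L2_mul|exact: L2_mul].
by apply: eq_Rintegral => z _; rewrite mulrDl.
Qed.

Lemma ipZl c f h : L2 mu f -> L2 mu h -> ip (fun z => c * f z) h = c * ip f h.
Proof.
move=> lf lh; rewrite /ip -RintegralZl//; last exact: L2_mul.
by apply: eq_Rintegral => z _; rewrite mulrA.
Qed.

Lemma ipZr c f h : L2 mu f -> L2 mu h -> ip f (fun z => c * h z) = c * ip f h.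
Proof. by move=> lf lh; rewrite ipC ipZl// ipC. Qed.

Lemma ipBl f g h : L2 mu f -> L2 mu g -> L2 mu h ->
  ip (fun z => f z - g z) h = ip f h - ip g h.
Proof.
move=> lf lg lh; rewrite -[- ip g h]mulN1r -ipZl// -ipDl//; last exact: L2Z.
by apply: eq_Rintegral => z _; rewrite mulN1r.
Qed.

Lemma ipBr f g h : L2 mu f -> L2 mu g -> L2 mu h ->
  ip h (fun z => f z - g z) = ip h f - ip h g.
Proof. by move=> lf lg lh; rewrite ipC ipBl// !(ipC h). Qed.

Lemma ip_suml (I : Type) (s : seq I) (c : I -> R) (F : I -> T -> R) h :
  (forall i, L2 mu (F i)) -> L2 mu h ->
  ip (fun z => \sum_(i <- s) c i * F i z) h = \sum_(i <- s) c i * ip (F i) h.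
Proof.
move=> lF lh.
have [_ <-] := Rint_lincomb s c (fun i => L2_mul (lF i) lh).
by apply: eq_Rintegral => z _; rewrite mulr_suml; apply: eq_bigr => i _; rewrite mulrA.
Qed.

Lemma ip_ge0 f : 0 <= ip f f.
Proof. by apply: Rintegral_ge0 => z _; rewrite -expr2 sqr_ge0. Qed.

Lemma ip_sqrB f g : L2 mu f -> L2 mu g ->
  ip (fun z => f z - g z) (fun z => f z - g z) = ip f f - 2 * ip f g + ip g g.
Proof.
move=> lf lg; have lB := L2B lf lg.
by rewrite ipBl// !ipBr// (ipC g f); ring.
Qed.

End square_integrable.

(** * Markov's inequality and events of probability tending to one *)

Section markov.
Context {R : realType} {d} {Omega : measurableType d} (P : probability Omega R).

Lemma markov_real (Y : Omega -> R) (a : R) : 0 < a ->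
  (forall w, 0 <= Y w) -> P.-integrable setT (EFin \o Y) ->
  measurable [set w | a < Y w] /\ (P [set w | (a < Y w)%R] <= (\int[P]_w Y w / a)%R%:E)%E.
Proof.
move=> a0 Y0 iY; have mY := integrable_measurable iY.
have mA : measurable [set w | a < Y w].
  rewrite (_ : [set _ | _] = Y @^-1` `]a, +oo[).
    by rewrite -[X in measurable X]setTI; exact: mY.
  by apply/seteqP; split => w /=; rewrite in_itv/= andbT.
split=> //; rewrite -[P _]fineK ?fin_num_measure// lee_fin ler_pdivlMr//.
have iA : P.-integrable setT (EFin \o (fun w => a * \1_[set w | a < Y w] w)).
  by apply: integrable_scale; exact: integrable_indic.
have : \int[P]_w (a * \1_[set w | a < Y w] w) <= \int[P]_w Y w.
  apply: (le_Rintegral measurableT iA iY) => w _; rewrite indicE.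
  case: (boolP (w \in _)) => [|_]; last by rewrite mulr0.
  by rewrite inE/= mulr1 => /ltW.
rewrite RintegralZl//; last exact: integrable_indic.
by rewrite mulrC /Rintegral integral_indic// setIT.
Qed.

Lemma prob_setC_lt (A : set Omega) (e : R) : measurable A ->
  ((1 - e)%:E < P (~` A))%E = (P A < e%:E)%E.
Proof.
move=> mA; rewrite (probability_setC P mA).
have -> : (P A = (fine (P A))%:E)%E by rewrite fineK// fin_num_measure.
by rewrite -EFinB !lte_fin; lra.
Qed.

(* [wpto P E] is [forall dl > 0, wpd dl E]; fixing [dl] allows the intersection
   with O_p bounds, whose constants depend on [dl]. *)
Definition wpd (dl : R) (E : nat -> set Omega) : Prop :=
  exists N, forall n, (N <= n)%N ->
    exists B : set Omega, measurable B /\ B `<=` E n /\ ((1 - dl)%:E < P B)%E.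

Lemma wpd_sub dl (E F : nat -> set Omega) : (exists N, forall n, (N <= n)%N -> E n `<=` F n) ->
  wpd dl E -> wpd dl F.
Proof.
move=> [N1 EF] [N2 H]; exists (maxn N1 N2) => n; rewrite geq_max => /andP[n1 n2].
have [B [mB [BE PB]]] := H n n2; exists B; split=> //; split=> //.
exact: subset_trans BE (EF n n1).
Qed.

Lemma wpdI d1 d2 (E F : nat -> set Omega) : wpd d1 E -> wpd d2 F ->
  wpd (d1 + d2) (fun n => E n `&` F n).
Proof.
move=> [N1 H1] [N2 H2]; exists (maxn N1 N2) => n; rewrite geq_max => /andP[n1 n2].
have [A [mA [AE PA]]] := H1 n n1; have [B [mB [BF PB]]] := H2 n n2.
exists (A `&` B); split; first exact: measurableI.
split; first exact: setISS.
have nA := measurableC mA; have nB := measurableC mB.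
rewrite -[A `&` B]setCK prob_setC_lt ?setCI; last exact: measurableU.
rewrite -[A]setCK prob_setC_lt// in PA; rewrite -[B]setCK prob_setC_lt// in PB.
by rewrite EFinD (le_lt_trans (measureU2 P nA nB))// lteD.
Qed.

Lemma o_pP (X : nat -> Omega -> R) a : o_p P X a <->
  forall eps, 0 < eps -> wpto P (fun n => [set w | `|X n w| <= eps * a n]).
Proof.
split=> H eps e0 dl dl0; have [N HN] := H eps e0 dl dl0; exists N => n Nn.
  have [A [mA [sA PA]]] := HN n Nn; exists (~` A); split; first exact: measurableC.
  split.
    by move=> w Aw /=; rewrite leNgt; apply/negP => h; apply: Aw; exact: sA.
  by rewrite prob_setC_lt.
have [B [mB [sB PB]]] := HN n Nn; exists (~` B); split; first exact: measurableC.
split.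
  by move=> w /= h Bw; have /= := sB w Bw; rewrite leNgt h.
by rewrite -prob_setC_lt ?setCK//; exact: measurableC.
Qed.

Lemma wpd_markov (Y : nat -> Omega -> R) (a : nat -> R) (dl : R) : 0 < dl ->
  (exists N, forall n, (N <= n)%N -> [/\ 0 < a n, (forall w, 0 <= Y n w),
     P.-integrable setT (EFin \o Y n) & \int[P]_w Y n w < dl * a n]) ->
  wpd dl (fun n => [set w | Y n w <= a n]).
Proof.
move=> dl0 [N H]; exists N => n Nn; have [a0 Y0 iY HY] := H n Nn.
have [mA PA] := markov_real a0 Y0 iY.
exists (~` [set w | a n < Y n w]); split; first exact: measurableC.
split; first by move=> w /=; rewrite leNgt => /negP.
by rewrite prob_setC_lt// (le_lt_trans PA)// lte_fin ltr_pdivrMr.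
Qed.

End markov.

Section sample_mean.
Context {R : realType} {d dz : measure_display}
  {Omega : measurableType d} {Zt : measurableType dz}
  (P : probability Omega R) (Q : probability Zt R) (Zs : nat -> Omega -> Zt).
Hypothesis HZ : iid P Q Zs.

Definition amean (f : Zt -> R) n w : R := n%:R^-1 * \sum_(j < n) f (Zs j w).

Let mZ j : measurable_fun setT (Zs j). Proof. by case: HZ. Qed.

Lemma L2_law f j : L2 Q f -> L2 P (fun w => f (Zs j w)).
Proof.
move=> [mf f2]; split; first exact: measurableT_comp mf (mZ j).
have mf2 : measurable_fun setT (fun z => f z ^+ 2) by exact: integrable_measurable f2.
by have [] := Rintegral_law HZ j mf2 f2.
Qed.

(** Induction on the number of terms: the cross term with the last observation vanishes because that
    observation can be integrated out first. *)
Lemma second_moment_sum f n : L2 Q f -> \int[Q]_z f z = 0 ->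
  ip P (fun w => \sum_(j < n) f (Zs j w)) (fun w => \sum_(j < n) f (Zs j w)) =
  n%:R * ip Q f f.
Proof.
move=> lf f0; have [mf f2] := lf.
have lS k : L2 P (fun w => \sum_(j < k) f (Zs j w)).
  by apply: L2_sum => j; exact: L2_law.
elim: n => [|n IH].
  rewrite mul0r /ip; under eq_Rintegral do rewrite big_ord0 mul0r.
  by rewrite Rint_prob_cst.
pose S w := \sum_(j < n) f (Zs j w).
have -> : (fun w => \sum_(j < n.+1) f (Zs j w)) = (fun w => S w + f (Zs n w)).
  by apply/funext => w; rewrite big_ord_recr.
have lZ := L2_law n lf.
have cross : ip P S (fun w => f (Zs n w)) = 0.
  pose F (p : n.-tuple Zt * Zt) := (\sum_(j < n) f (tnth p.1 j)) * f p.2.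
  have E w : F (pre Zs n w, Zs n w) = S w * f (Zs n w).
    by rewrite /F /S /=; congr (_ * _); apply: eq_bigr => j _; rewrite tnth_mktuple.
  have mF : measurable_fun setT F.
    apply: measurable_funM; last exact: measurableT_comp mf measurable_snd.
    apply: measurable_sum => j; apply: measurableT_comp mf _.
    exact: measurableT_comp (measurable_tnth j) measurable_fst.
  rewrite /ip; under eq_Rintegral do rewrite -E.
  rewrite (Rintegral_indep HZ mF).
  - rewrite -[RHS](Rint_prob_cst P); apply: eq_Rintegral => w _.
    by rewrite /F /= RintegralZl ?f0 ?mulr0//; exact: L2_integrable.
  - by apply: eq_integrable (L2_mul (lS n) lZ) => // w _ /=; rewrite E.
  - by move=> t; exact: (integrable_scale (\sum_(j < n) f (tnth t j)) (L2_integrable lf)).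
have sq : ip P (fun w => f (Zs n w)) (fun w => f (Zs n w)) = ip Q f f.
  have [_] := Rintegral_law HZ n (integrable_measurable (L2_mul lf lf)) (L2_mul lf lf).
  exact.
rewrite ipDl//; [|exact: lS|exact: L2D (lS n) lZ].
have D h : L2 P h -> ip P h (fun w => S w + f (Zs n w)) =
    ip P S h + ip P (fun w => f (Zs n w)) h.
  by move=> lh; rewrite ipC ipDl//; exact: lS.
rewrite D//; last exact: lS.
by rewrite D// (IH : ip P S S = _) cross sq ipC cross -natr1; ring.
Qed.

Lemma second_moment_amean f n : L2 Q f -> \int[Q]_z f z = 0 ->
  P.-integrable setT (EFin \o (fun w => amean f n w ^+ 2)) /\
  \int[P]_w amean f n w ^+ 2 = n%:R^-1 * ip Q f f.
Proof.
move=> lf f0.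
have lS : L2 P (fun w => \sum_(j < n) f (Zs j w)).
  by apply: L2_sum => j; exact: L2_law.
have lA : L2 P (amean f n) by exact: L2Z.
split; first by case: lA.
have -> : \int[P]_w amean f n w ^+ 2 = ip P (amean f n) (amean f n).
  by apply: eq_Rintegral => w _; rewrite expr2.
rewrite /amean ipZl// ipC ipZl// second_moment_sum//.
have [->|n0] := eqVneq (n%:R : R) 0; first by rewrite invr0 !mul0r.
by rewrite mulKf.
Qed.

Lemma integrable_amean f n : measurable_fun setT f -> Q.-integrable setT (EFin \o f) ->
  P.-integrable setT (EFin \o (amean f n)) /\
  ((0 < n)%N -> \int[P]_w amean f n w = \int[Q]_z f z).
Proof.
move=> mf fi.
have iZ j : P.-integrable setT (EFin \o (fun w => f (Zs j w))).
  by case: (Rintegral_law HZ j mf fi).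
have [iS ES] := Rint_lincomb (index_enum 'I_n) (fun=> 1) (fun j : 'I_n => iZ j).
have E : (fun w => \sum_(j < n) 1 * f (Zs j w)) = (fun w => \sum_(j < n) f (Zs j w)).
  by apply/funext => w; apply: eq_bigr => j _; rewrite mul1r.
rewrite E in iS ES; split; first exact: integrable_scale.
move=> n0; rewrite /amean RintegralZl// ES.
rewrite (eq_bigr (fun=> \int[Q]_z f z)); last first.
  by move=> j _; rewrite mul1r; case: (Rintegral_law HZ j mf fi).
by rewrite sumr_const card_ord -[X in _ * X]mulr_natl mulKf// pnatr_eq0 -lt0n.
Qed.

End sample_mean.

Section ip_cs.
Context {R : realType} d (T : measurableType d) (mu : probability T R).

Lemma ip_cauchy_schwarz (f g : T -> R) : L2 mu f -> L2 mu g ->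
  ip mu f g ^+ 2 <= ip mu f f * ip mu g g.
Proof.
move=> lf lg.
have H t : 0 <= ip mu f f - 2 * (t * ip mu f g) + t ^+ 2 * ip mu g g.
  have := ip_ge0 mu (fun z => f z - t * g z).
  rewrite ip_sqrB//; last exact: L2Z.
  by rewrite ipZr// ipZl ?ipZr ?expr2 ?mulrA//; exact: L2Z.
have := ip_ge0 mu g; have := ip_ge0 mu f; move: (ip mu f f) (ip mu f g) (ip mu g g) H => a b c H a0.
rewrite le_eqVlt => /orP[/eqP c0|c0].
  rewrite -c0 mulr0; have [->|b0] := eqVneq b 0; first by rewrite expr0n.
  (* If [c = 0] and [b] were nonzero, the polynomial in [t] would be affine, and at this [t] it
     equals -1. *)
  have := H ((a + 1) / (2 * b)); rewrite -c0 mulr0 addr0.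
  have -> : 2 * ((a + 1) / (2 * b) * b) = a + 1 by field.
  lra.
have := H (b / c).
have -> : a - 2 * (b / c * b) + (b / c) ^+ 2 * c = (a * c - b ^+ 2) / c.
  by field; rewrite gt_eqF.
by rewrite pmulr_lge0 ?invr_gt0// subr_ge0.
Qed.

Lemma integral_sqr_ip (f : T -> R) : L2 mu f ->
  (\int[mu]_z (f z ^+ 2)%:E = (ip mu f f)%:E)%E.
Proof.
move=> [mf f2]; rewrite -(@fineK _ (\int[mu]_z (f z ^+ 2)%:E)%E).
  by congr EFin; rewrite /ip /Rintegral; congr fine; apply: eq_integral => z _; rewrite expr2.
exact: integrable_fin_num f2.
Qed.

End ip_cs.

(** * Projections on the span of the constraints *)

Section projection.
Context {R : realType} {dz} {Zt : measurableType dz} (Q : probability Zt R).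
Variable u : nat -> Zt -> R.
Hypothesis lu : forall i, L2 Q (u i).

Definition comb k (b : 'cV[R]_k) z : R := dotv b (uvec u k z).

Lemma combE k (b : 'cV[R]_k) : comb b = fun z => \sum_(i < k) b i 0 * u i z.
Proof. by apply/funext => z; apply: eq_bigr => i _; rewrite !mxE. Qed.

Lemma L2_comb k (b : 'cV[R]_k) : L2 Q (comb b).
Proof. by rewrite combE; apply: L2_sum => i; exact: L2Z. Qed.

Lemma ip_comb k (b : 'cV[R]_k) h : L2 Q h ->
  ip Q (comb b) h = \sum_(i < k) b i 0 * ip Q (u i) h.
Proof. by move=> lh; rewrite combE (@ip_suml _ _ _ _ _ _ _ (fun i : 'I_k => u i)). Qed.

Lemma ip_comb_u k (b : 'cV[R]_k) (i : 'I_k) : ip Q (comb b) (u i) = (Wmat Q u k *m b) i 0.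
Proof.
rewrite ip_comb// mxE; apply: eq_bigr => j _; rewrite mxE mulrC; congr (_ * _).
by rewrite ipC.
Qed.

Lemma ip_comb_comb k (b c : 'cV[R]_k) : ip Q (comb b) (comb c) = dotv b (Wmat Q u k *m c).
Proof.
rewrite ip_comb; last exact: L2_comb.
by apply: eq_bigr => i _; rewrite ipC ip_comb_u.
Qed.

Lemma Wmat_sym k : (Wmat Q u k)^T = Wmat Q u k.
Proof. by apply/matrixP => i j; rewrite !mxE; apply: ipC. Qed.

(* Bessel-type inequality: expand E (f - C^-1 sum_i a_i u_i)^2 >= 0 with a_i = E f u_i. *)
Lemma cross_coord_bound k C f : 0 < C ->
  (forall x : 'cV[R]_k, dotv x (Wmat Q u k *m x) <= C * vnorm x ^+ 2) ->
  L2 Q f -> \sum_(i < k) ip Q f (u i) ^+ 2 <= C * ip Q f f.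
Proof.
move=> C0 H lf; pose a : 'cV[R]_k := \col_i ip Q f (u i).
have aE : vnorm a ^+ 2 = \sum_(i < k) ip Q f (u i) ^+ 2.
  by rewrite sqr_vnorm; apply: eq_bigr => i _; rewrite mxE expr2.
have fa : ip Q f (comb a) = vnorm a ^+ 2.
  rewrite ipC ip_comb// sqr_vnorm; apply: eq_bigr => i _.
  by rewrite !mxE ipC.
have lc : L2 Q (fun z => C^-1 * comb a z) by apply: L2Z; exact: L2_comb.
have := ip_ge0 Q (fun z => f z - C^-1 * comb a z).
rewrite ip_sqrB//.
have la := L2_comb a.
rewrite ipZr// ipZl// ipZr// fa ip_comb_comb -aE.
have := H a; move: (dotv _ _) (vnorm a ^+ 2) (ip Q f f) => w v p wv h.
have : C^-1 * (C^-1 * w) <= C^-1 * v.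
  by rewrite ler_pM2l ?invr_gt0// mulrC ler_pdivrMr// mulrC.
by move=> L; rewrite -(@ler_pM2l _ C^-1) ?invr_gt0// mulKf ?gt_eqF//; lra.
Qed.

(** Solution of the normal equations: the coefficients of the projection of [f] on the first [k]
    functions. *)
Definition pcoef k (f : Zt -> R) : 'cV[R]_k := invmx (Wmat Q u k) *m \col_i ip Q f (u i).

Lemma pcoef_orth k f (i : 'I_k) : Wmat Q u k \in unitmx -> L2 Q f ->
  ip Q (fun z => f z - comb (pcoef k f) z) (u i) = 0.
Proof.
move=> uW lf; rewrite ipBl//; last exact: L2_comb.
by rewrite ip_comb_u /pcoef mulmxA mulmxV// mul1mx mxE subrr.
Qed.

(** Since [f - g] is orthogonal to every [u i], the projection of [f] on the first [k] functions is
    also that of [g], and Pythagoras compares it with any competitor in that span. *)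
Lemma best_approx k l f g (c : 'I_l -> R) : Wmat Q u k \in unitmx ->
  (l <= k)%N -> L2 Q f -> L2 Q g ->
  (forall i, ip Q (fun z => f z - g z) (u i) = 0) ->
  ip Q (fun z => comb (pcoef k f) z - g z) (fun z => comb (pcoef k f) z - g z) <=
  ip Q (fun z => g z - \sum_(i < l) c i * u i z) (fun z => g z - \sum_(i < l) c i * u i z).
Proof.
move=> uW lk lf lg fg; set p := comb _.
have lp : L2 Q p by exact: L2_comb.
pose s z := \sum_(i < l) c i * u i z.
have ls : L2 Q s by apply: L2_sum => i; exact: L2Z.
have lgp := L2B lg lp; have lps := L2B lp ls.
have o i : (i < k)%N -> ip Q (u i) (fun z => g z - p z) = 0.
  move=> ik; have := pcoef_orth (Ordinal ik) uW lf; have := fg i.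
  rewrite /= -/p !ipBl// => e1 e2; rewrite ipBr//.
  by rewrite (ipC _ _ g) (ipC _ _ p); lra.
have op : ip Q p (fun z => g z - p z) = 0.
  by rewrite /p ip_comb// big1// => i _; rewrite o ?mulr0.
have os : ip Q s (fun z => g z - p z) = 0.
  rewrite /s (@ip_suml _ _ _ _ _ _ _ (fun i : 'I_l => u i))// big1// => i _.
  by rewrite o ?mulr0// (leq_trans _ lk).
have -> : (fun z => g z - \sum_(i < l) c i * u i z) =
    (fun z => (g z - p z) - (s z - p z)).
  by apply/funext => z; rewrite /s opprB addrA subrK.
have cr : ip Q (fun z => g z - p z) (fun z => s z - p z) = 0.
  rewrite (ipBr ls lp lgp) (ipC Q (fun z => g z - p z) s) os.
  by rewrite (ipC Q (fun z => g z - p z) p) op subrr.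
rewrite (ip_sqrB lgp (L2B ls lp)) cr.
have -> : ip Q (fun z => p z - g z) (fun z => p z - g z) =
    ip Q (fun z => g z - p z) (fun z => g z - p z).
  by apply: eq_Rintegral => z _; rewrite -mulrNN !opprB.
by rewrite mulr0 subr0 lerDl ip_ge0.
Qed.

Hypothesis u0 : forall i, \int[Q]_z u i z = 0.

Definition in_span (g : Zt -> R) := forall eps : R, 0 < eps ->
  exists k (c : 'I_k -> R),
  ip Q (fun z => g z - \sum_(i < k) c i * u i z) (fun z => g z - \sum_(i < k) c i * u i z) < eps.

Lemma span_orth f g : L2 Q f -> L2 Q g -> in_span g -> (forall i, ip Q f (u i) = 0) ->
  ip Q f g = 0.
Proof.
move=> lf lg sg fu; apply/eqP; rewrite -sqrf_eq0 eq_le sqr_ge0 andbT.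
apply/ler_addgt0Pr => e e0; rewrite add0r.
have d0 : 0 < e / (ip Q f f + 1) by rewrite divr_gt0// ltr_wpDl ?ip_ge0.
have [k [c]] := sg _ d0; set s := fun z => g z - _ => h.
have lc : L2 Q (fun z => \sum_(i < k) c i * u i z) by apply: L2_sum => i; exact: L2Z.
have ls : L2 Q s by exact: L2B.
have -> : ip Q f g = ip Q f s.
  rewrite ipBr// [X in _ - X]ipC (ip_suml (index_enum 'I_k) c (fun i : 'I_k => lu i) lf).
  by rewrite big1 ?subr0// => i _; rewrite ipC fu mulr0.
rewrite (le_trans (ip_cauchy_schwarz lf ls))//.
move: h; rewrite ltr_pdivlMr ?ltr_wpDl ?ip_ge0// mulrDr mulr1.
have := ip_ge0 Q s; rewrite mulrC; lra.
Qed.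

(** The [u i] have mean zero, that is, they are orthogonal to the constant 1; [span_orth] extends
    this to the closed span. *)
Lemma span_mean0 g : L2 Q g -> in_span g -> \int[Q]_z g z = 0.
Proof.
move=> lg sg; have : ip Q (fun=> 1) g = 0.
  apply: span_orth => //; first exact: L2_cst.
  by move=> i; rewrite /ip -[RHS](u0 i); apply: eq_Rintegral => z _; rewrite mul1r.
by move=> <-; apply: eq_Rintegral => z _; rewrite mul1r.
Qed.

Lemma mean_comb k (b : 'cV[R]_k) : \int[Q]_z comb b z = 0.
Proof.
have : ip Q (comb b) (fun=> 1) = 0.
  rewrite ip_comb; last exact: L2_cst.
  rewrite big1// => i _.
  rewrite (_ : ip Q _ _ = 0) ?mulr0// -[RHS](u0 i).
  by apply: eq_Rintegral => z _; rewrite mulr1.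
by move=> <-; apply: eq_Rintegral => z _; rewrite mulr1.
Qed.

Lemma is_proj_span f g : is_proj Q u f g -> [/\ L2 Q g, in_span g &
  forall i, ip Q (fun z => f z - g z) (u i) = 0].
Proof.
move=> [lg [sg og]]; split=> // e e0; have [k [c H]] := sg e e0; exists k, c.
rewrite -lte_fin -integral_sqr_ip//; apply: L2B => //.
by apply: L2_sum => i; exact: L2Z.
Qed.

End projection.

(** * Asymptotic expansion and limit law *)

Section expansion.
Context {R : realType} {n k r : nat}.
Variables (u : 'I_n -> 'cV[R]_k) (psi : 'I_n -> 'cV[R]_r).
Variables (W : 'M[R]_k) (A : 'M[R]_(r, k)).
Variables (c C K Ka Kp e : R).
Hypotheses (n0 : (0 < n)%N) (k0 : (0 < k)%N).
Hypotheses (c0 : 0 < c) (C0 : 0 <= C) (K0 : 0 <= K) (Ka0 : 0 <= Ka) (e0 : 0 <= e).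
Hypothesis Wlow : forall x, c * vnorm x ^+ 2 <= dotv x (W *m x).
Hypothesis Whigh : forall x, dotv x (W *m x) <= C * vnorm x ^+ 2.

Let s : R := Num.sqrt k%:R.
Let N : R := Num.sqrt n%:R.
(** Half of the coercivity constant of [W] is sacrificed so that [wbar u], which is within [c'] of
    [W] in operator norm, remains coercive. *)
Let c' := c / 2.
Let C' := C + c'.

Hypothesis u_le : forall j, vnorm (u j) <= e * (N / (k%:R * s)).
Hypothesis W_le : opnorm (wbar u - W) <= e * k%:R^-1.
Hypothesis cross_le : frob (n%:R^-1 *: \sum_j (psi j *m (u j)^T - A)) <= e * s^-1.
Hypothesis ubar_le : vnorm (ubar u) <= K * s / N.
Hypothesis psi_le : n%:R^-1 * \sum_j vnorm (psi j) ^+ 2 <= Kp.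
Hypothesis A_le : frob A <= Ka.
Hypothesis e1 : e <= c'.
Hypothesis e2 : 2 * e * K / c' <= 2^-1.
Hypothesis e3 : 10 * (2 * e * K / c') * C' <= 2^-1 * c'.

Let c'0 : 0 < c'. Proof. exact: divr_gt0. Qed.
Let C'0 : 0 <= C'. Proof. by rewrite addr_ge0// ltW. Qed.
Let s1 : 1 <= s. Proof. by rewrite -[leLHS]sqrtr1 ler_wsqrtr// ler1n. Qed.
Let s0 : 0 < s. Proof. exact: lt_le_trans s1. Qed.
Let N0 : 0 < N. Proof. by rewrite sqrtr_gt0 ltr0n. Qed.
Let kE : k%:R = s ^+ 2. Proof. by rewrite sqr_sqrtr. Qed.

Let opb : opnorm (wbar u - W) <= c'.
Proof.
rewrite (le_trans W_le)// (le_trans _ e1)// ler_piMr// invf_le1 ?ltr0n//.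
by rewrite ler1n.
Qed.

Let dev x : `|dotv x (wbar u *m x) - dotv x (W *m x)| <= c' * vnorm x ^+ 2.
Proof.
rewrite -dotvNr -dotvDr -mulNmx -mulmxDl (le_trans (cauchy_schwarz _ _))//.
rewrite expr2 mulrCA ler_wpM2l ?vnorm_ge0// (le_trans (vnorm_mulmx_opnorm _ _))//.
by rewrite ler_wpM2r ?vnorm_ge0.
Qed.

Let wlow x : c' * vnorm x ^+ 2 <= dotv x (wbar u *m x).
Proof.
have := dev x; rewrite ler_norml => /andP[h _].
have := Wlow x; have : c = 2 * c' by rewrite /c'; field.
by move: (vnorm x ^+ 2) h => v h ->; rewrite -mulrA; lra.
Qed.

Let whigh x : dotv x (wbar u *m x) <= C' * vnorm x ^+ 2.
Proof.
have := dev x; rewrite ler_norml => /andP[_ h].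
by have := Whigh x; rewrite mulrDl; lra.
Qed.

Let Wlow' x : c' * vnorm x ^+ 2 <= dotv x (W *m x).
Proof.
apply: le_trans (Wlow x); rewrite ler_wpM2r ?sqr_ge0//.
by rewrite /c' ler_pdivrMr// ler_peMr ?ltW// ltr1n.
Qed.

(** With this radius the factors [N] and [s] cancel against the bound on [u j], leaving [q] of order
    [e / k]: this is where the exponent -3/2 of the dimension in (i) acts. *)
Let rho := 2 * (K * s / N) / c'.
Let q := e * (N / (k%:R * s)) * rho.

Let qE : q = (2 * e * K / c') / k%:R.
Proof. by rewrite /q /rho kE; field; rewrite !gt_eqF. Qed.

Let q_le : q <= 2 * e * K / c'.
Proof.
rewrite qE ler_pdivrMr ?ltr0n// ler_peMr ?ler1n//.
by rewrite divr_ge0 ?mulr_ge0// ltW.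
Qed.

Let q2 : q <= 2^-1. Proof. exact: le_trans e2. Qed.
Let qc : 10 * q * C' <= 2^-1 * c'.
Proof. by apply: le_trans e3; rewrite ler_wpM2r// ler_wpM2l. Qed.

Lemma el_exists_unique : exists2 z,
  vnorm z <= rho /\ (forall j, 0 < 1 + dotv (u j) z) /\
  n%:R^-1 *: \sum_j ((1 + dotv (u j) z)^-1 *: u j) = 0 &
  forall z', (forall j, 0 < 1 + dotv (u j) z') ->
    n%:R^-1 *: \sum_j ((1 + dotv (u j) z')^-1 *: u j) = 0 -> z' = z.
Proof.
have [z zr ez] := el_exists n0 c'0 C'0 wlow whigh ubar_le u_le q2 qc.
have pz j : 0 < 1 + dotv (u j) z.
  have : `|dotv (u j) z| <= q.
    by rewrite (le_trans (cauchy_schwarz _ _))// ler_pM ?vnorm_ge0.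
  by rewrite ler_norml => /andP[]; move: q2; lra.
exists z => // z' pz' ez'; exact: (el_unique n0 c'0 wlow).
Qed.

(** The three summands of [el_linearization], in the same order, with the common factor [e / N]
    taken out. *)
Definition el_const : R := 2 * K / c' + Ka * ((1 + 20 * K * C' / c') * (2 * K / c') / c')
  + 10 * (2 * K / c') * (Num.sqrt Kp * (Num.sqrt C' * (2 * K / c'))).

Lemma el_expansion z : (forall j, 0 < 1 + dotv (u j) z) ->
  n%:R^-1 *: \sum_j ((1 + dotv (u j) z)^-1 *: u j) = 0 ->
  vnorm (n%:R^-1 *: \sum_j ((1 + dotv (u j) z)^-1 *: psi j)
    - (n%:R^-1 *: \sum_j psi j - A *m (invmx W *m ubar u))) <= el_const * e / N.
Proof.
move=> pz ez; have [z1 [zr _] uz] := el_exists_unique.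
move: (uz _ pz ez) zr => <- zr.
apply: le_trans (el_linearization n0 c'0 C'0 whigh ubar_le u_le q2
  Wlow' W_le A_le psi_le cross_le zr ez) _.
rewrite -/rho -/q; have [N' s' c''] := And3 (ltW N0) (ltW s0) (ltW c'0).
have k1 : (k%:R : R)^-1 <= s^-1.
  by rewrite lef_pV2 ?posrE ?ltr0n// kE expr2 ler_peMr// ltW.
(* Both the operator-norm error and [q] carry a factor [1/k], which absorbs the [s] contained in
   [rho]; for the cross moments the factor [s^-1] cancels it exactly. *)
have ks : (k%:R : R)^-1 * rho <= 2 * K / c' / N.
  have -> : 2 * K / c' / N = s^-1 * rho by rewrite /rho; field; rewrite !gt_eqF.
  by rewrite ler_wpM2r// /rho !mulr_ge0 ?invr_ge0.
have t1 : e * s^-1 * rho = 2 * K / c' * e / N.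
  by rewrite /rho; field; rewrite !gt_eqF.
have h1 : 0 <= 1 + 20 * K * C' / c' by rewrite addr_ge0// !mulr_ge0 ?invr_ge0.
have t2 : Ka * ((e * k%:R^-1 + 10 * q * C') * rho / c') <=
    Ka * ((1 + 20 * K * C' / c') * (2 * K / c') / c') * e / N.
  rewrite [leLHS](_ : _ = Ka * (1 + 20 * K * C' / c') * e / c' * (k%:R^-1 * rho)); last first.
    by rewrite qE; field; rewrite !gt_eqF// ltr0n.
  rewrite [leRHS](_ : _ = Ka * (1 + 20 * K * C' / c') * e / c' * (2 * K / c' / N)); last first.
    by field; rewrite !gt_eqF.
  by rewrite ler_wpM2l// !mulr_ge0 ?invr_ge0.
have t3 : 10 * q * (Num.sqrt Kp * (Num.sqrt C' * rho)) <=
    10 * (2 * K / c') * (Num.sqrt Kp * (Num.sqrt C' * (2 * K / c'))) * e / N.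
  rewrite [leLHS](_ : _ = 10 * (2 * K / c') * e * Num.sqrt Kp * Num.sqrt C' * (k%:R^-1 * rho)); last first.
    by rewrite qE; field; rewrite !gt_eqF// ltr0n.
  rewrite [leRHS](_ : _ = 10 * (2 * K / c') * e * Num.sqrt Kp * Num.sqrt C' * (2 * K / c' / N)); last first.
    by field; rewrite !gt_eqF.
  by rewrite ler_wpM2l// !mulr_ge0 ?sqrtr_ge0 ?invr_ge0.
have D (x y v : R) : (x + y + v) * e / N = x * e / N + y * e / N + v * e / N by ring.
by rewrite t1 /el_const D; exact: lerD (lerD (lexx _) t2) t3.
Qed.

End expansion.

Lemma regular_bounds {R : realType} (m : nat -> nat) (W : forall n, 'M[R]_(m n)) :
  regular_seq W -> exists c C : R, [/\ 0 < c, 0 < C,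
    forall n x, c * vnorm x ^+ 2 <= dotv x (W n *m x) &
    forall n x, dotv x (W n *m x) <= C * vnorm x ^+ 2].
Proof.
move=> [c [C [c0 H]]]; exists c, (Num.max C c).
suff K n x : c * vnorm x ^+ 2 <= dotv x (W n *m x) <= Num.max C c * vnorm x ^+ 2.
  by split=> //; [rewrite lt_max c0 orbT|move=> n x; case/andP: (K n x)..].
have [x0|x0] := eqVneq (vnorm x) 0.
  by rewrite x0 (vnorm_eq0 x0) dotv0l expr0n !mulr0 lexx.
have x1 : vnorm ((vnorm x)^-1 *: x) = 1.
  by rewrite vnormZ normfV ger0_norm ?vnorm_ge0// mulVf.
have := H n _ x1; rewrite -mulmxA dotvE -scalemxAr dotvZl dotvZr mulrA -invfM -expr2.
have p : 0 < vnorm x ^+ 2 by rewrite exprn_gt0// lt_def x0 vnorm_ge0.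
rewrite mulrC ler_pdivlMr// ler_pdivrMr// => /andP[-> h]/=.
by rewrite (le_trans h)// ler_pM2r// le_max lexx.
Qed.

Section L2_coordinates.
Context {R : realType} {dz} {Zt : measurableType dz} (Q : probability Zt R).

Lemma L2_coord r (V : Zt -> 'cV[R]_r) i : cmeas V ->
  Q.-integrable setT (fun z => (vnorm (V z) ^+ 2)%:E) -> L2 Q (fun z => V z i 0).
Proof.
move=> mV iV; split; first exact: mV.
exact: eq_integrable (integrable_coord2 mV iV i i).
Qed.

Lemma integral_sum_sqr d' (T' : measurableType d') (mu : probability T' R) k (F : 'I_k -> T' -> R) (b : 'I_k -> R) :
  (forall i, mu.-integrable setT (EFin \o (fun w => F i w ^+ 2)) /\
    \int[mu]_w F i w ^+ 2 = b i) ->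
  mu.-integrable setT (EFin \o (fun w => \sum_i F i w ^+ 2)) /\
  \int[mu]_w (\sum_i F i w ^+ 2) = \sum_i b i.
Proof.
move=> H; have [] := Rint_lincomb (index_enum 'I_k) (fun=> 1) (fun i => (H i).1).
have -> : (fun w => \sum_(i < k) 1 * F i w ^+ 2) = (fun w => \sum_(i < k) F i w ^+ 2).
  by apply/funext => w; apply: eq_bigr => i _; rewrite mul1r.
move=> i1 ->; split=> //.
by apply: eq_bigr => i _; rewrite mul1r (H i).2.
Qed.

End L2_coordinates.

(** * Probabilistic form of the expansion *)

Section master.
Context {R : realType} {d dz : measure_display}
  {Omega : measurableType d} {Zt : measurableType dz}
  (P : probability Omega R) (Q : probability Zt R)
  (Zs : nat -> Omega -> Zt) (r : nat) (psi : 'I_r -> Zt -> R)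
  (u : nat -> Zt -> R) (m : nat -> nat) (phi0 : 'I_r -> Zt -> R).
Hypothesis HZ : iid P Q Zs.
Hypothesis minf : forall K : nat, exists N, forall n, (N <= n)%N -> (K <= m n)%N.
Hypothesis lu : forall i, L2 Q (u i).
Hypothesis lpsi : forall a, L2 Q (psi a).
Hypothesis u0 : forall i, \int[Q]_z u i z = 0.
Hypothesis uW : forall n, Wmat Q u (m n) \in unitmx.
Variables (c C : R).
Hypotheses (c0 : 0 < c) (C0 : 0 < C).
Hypothesis Wlow : forall n x, c * vnorm x ^+ 2 <= dotv x (Wmat Q u (m n) *m x).
Hypothesis Whigh : forall n x, dotv x (Wmat Q u (m n) *m x) <= C * vnorm x ^+ 2.
Hypothesis h1 : o_p P (fun n w => \big[Num.max/0]_(j < n) vnorm (uvec u (m n) (Zs j w)))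
        (fun n => Num.sqrt n%:R / ((m n)%:R * Num.sqrt (m n)%:R)).
Hypothesis h2 : o_p P (fun n w => opnorm (Wbar u Zs (m n) n w - Wmat Q u (m n)))
        (fun n => (m n)%:R^-1).
Hypothesis h3 : o_p P (fun n w => frob (cross_dev Q psi u Zs (m n) n w))
        (fun n => (Num.sqrt (m n)%:R)^-1).
Hypothesis pphi : forall k, is_proj Q u (psi k) (phi0 k).

Let A n : 'M[R]_(r, m n) := \matrix_(a, i) EQ Q (fun z => psi a z * u i z).

(** The expected square of the norm is the trace of [Wmat] divided by [n]. Each diagonal entry is
    the quadratic form at a unit coordinate vector, so the trace is at most [C * m n]; Markov's
    inequality concludes, [C + 1] giving the strict inequality. *)
Lemma ubar_small (dl : R) : 0 < dl -> exists2 K, 0 <= K & wpd P dl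
  (fun n => [set w | vnorm (ubar (fun j : 'I_n => uvec u (m n) (Zs j w))) <=
     K * Num.sqrt (m n)%:R / Num.sqrt n%:R]).
Proof.
move=> dl0; pose L := (C + 1) / dl.
have L0 : 0 < L by rewrite divr_gt0// addr_gt0.
have [N1 HN1] := minf 1.
exists (Num.sqrt L); first exact: sqrtr_ge0.
pose Y n w := \sum_(i < m n) amean Zs (u i) n w ^+ 2.
have YE n w : vnorm (ubar (fun j : 'I_n => uvec u (m n) (Zs j w))) = Num.sqrt (Y n w).
  congr Num.sqrt; apply: eq_bigr => i _; rewrite /ubar /amean !mxE summxE.
  by congr ((_ * _) ^+ 2); apply: eq_bigr => j _; rewrite mxE.
apply: (@wpd_sub _ _ _ _ _ (fun n => [set w | Y n w <= L * ((m n)%:R / n%:R)])).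
  exists 0%N => n _ w /= h; rewrite YE.
  rewrite (le_trans (ler_wsqrtr h))// sqrtrM ?(ltW L0)// -mulrA.
  by rewrite ler_wpM2l// sqrtrM// sqrtrV.
apply: wpd_markov => //; exists (maxn N1 1) => n; rewrite geq_max => /andP[n1 n2].
have m0 := HN1 _ n1.
have a0 : 0 < L * ((m n)%:R / n%:R) by rewrite mulr_gt0// divr_gt0 ?ltr0n.
have [iY EY] := integral_sum_sqr (fun i : 'I_(m n) => second_moment_amean HZ n (lu i) (u0 i)).
split=> //; first by move=> w; apply: sumr_ge0 => i _; exact: sqr_ge0.
rewrite EY (_ : dl * _ = (C + 1) * ((m n)%:R / n%:R)); last first.
  by rewrite /L; field; rewrite !gt_eqF// ltr0n.
rewrite (@le_lt_trans _ _ (C * ((m n)%:R / n%:R)))//; last first.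
  by rewrite ltr_pM2r ?ltrDl// divr_gt0// ltr0n.
rewrite -mulr_sumr mulrA mulrC ler_wpM2r ?invr_ge0//.
rewrite (@le_trans _ _ (\sum_(i < m n) C))//; last first.
  by rewrite sumr_const card_ord -[leLHS]mulr_natr.
apply: ler_sum => i _.
have := Whigh (delta_mx i 0).
have -> : vnorm (delta_mx i 0 : 'cV[R]_(m n)) ^+ 2 = 1.
  rewrite sqr_vnorm /dotv (bigD1 i)//= big1 ?mxE ?eqxx ?mulr1 ?addr0// => j ji.
  by rewrite mxE (negbTE ji) mul0r.
rewrite -ip_comb_comb// mulr1 => /(le_trans _); apply.
rewrite le_eqVlt; apply/orP; left; apply/eqP.
have -> // : comb u (delta_mx i 0) = u i :> (Zt -> R).
apply/funext => z; rewrite combE (bigD1 i)//= big1 ?mxE ?eqxx ?mul1r ?addr0// => j ji.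
by rewrite mxE (negbTE ji) mul0r.
Qed.

Lemma psi_bounded (dl : R) : 0 < dl -> exists Kp, wpd P dl
  (fun n => [set w | n%:R^-1 * \sum_(j < n) vnorm (fvec psi (Zs j w)) ^+ 2 <= Kp]).
Proof.
move=> dl0; pose M := \int[Q]_z vnorm (fvec psi z) ^+ 2; exists ((M + 1) / dl).
have M0 : 0 <= M by apply: Rintegral_ge0 => z _; rewrite sqr_ge0.
have E : (fun z => vnorm (fvec psi z) ^+ 2) = (fun z => \sum_a psi a z ^+ 2).
  by apply/funext => z; rewrite sqr_vnorm; apply: eq_bigr => a _; rewrite mxE expr2.
have iM : Q.-integrable setT (EFin \o (fun z => vnorm (fvec psi z) ^+ 2)).
  by rewrite E; case: (integral_sum_sqr (fun a => conj (lpsi a).2 erefl)).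
apply: wpd_markov => //; exists 1%N => n n1.
have [iA EA] := integrable_amean HZ n (integrable_measurable iM) iM.
split=> //.
- by rewrite divr_gt0// ltr_wpDl.
- by move=> w; rewrite mulr_ge0 ?invr_ge0//; apply: sumr_ge0 => j _; exact: sqr_ge0.
- rewrite (EA n1) mulrC divfK ?gt_eqF// ltrDl//.
Qed.

(** The rows of [A n] collect the inner products of one [psi a] with the [u i]; [cross_coord_bound]
    controls their squares uniformly in the growing dimension. *)
Lemma A_bounded : exists2 Ka, 0 <= Ka & forall n, frob (A n) <= Ka.
Proof.
exists (Num.sqrt (\sum_a C * ip Q (psi a) (psi a))); first exact: sqrtr_ge0.
move=> n; apply: ler_wsqrtr; apply: ler_sum => a _.
rewrite (le_trans _ (cross_coord_bound lu C0 (@Whigh n) (lpsi a)))//.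
by apply: ler_sum => i _; rewrite mxE.
Qed.

Let lphi a : L2 Q (phi0 a). Proof. by case: (is_proj_span lu (pphi a)). Qed.

(** A finite combination close to [phi0 a] uses finitely many [u i], eventually among the first
    [m n]; the finite projection is at least as close. *)
Lemma proj_cvg a (eps : R) : 0 < eps -> exists N, forall n, (N <= n)%N ->
  ip Q (fun z => comb u (pcoef Q u (m n) (psi a)) z - phi0 a z)
       (fun z => comb u (pcoef Q u (m n) (psi a)) z - phi0 a z) < eps.
Proof.
move=> e0; have [_ sp og] := is_proj_span lu (pphi a).
have [k [b kb]] := sp _ e0; have [N HN] := minf k; exists N => n Nn.
by apply: le_lt_trans kb; apply: best_approx => //; exact: HN.
Qed.

Definition proj_mean n w : 'cV[R]_r :=
  \col_a amean Zs (comb u (pcoef Q u (m n) (psi a))) n w.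

(** By symmetry of [Wmat], the rows of [A n *m invmx (Wmat Q u (m n))] are the transposed projection
    coefficients [pcoef]. *)
Lemma proj_meanE n w : A n *m (invmx (Wmat Q u (m n)) *m
    ubar (fun j : 'I_n => uvec u (m n) (Zs j w))) = proj_mean n w.
Proof.
apply/colP => a; rewrite mulmxA [LHS]mxE [RHS]mxE.
set b := pcoef Q u (m n) (psi a); set U := ubar _.
have rb : row a (A n) *m invmx (Wmat Q u (m n)) = b^T.
  rewrite /b /pcoef trmx_mul trmx_inv Wmat_sym; congr (_ *m _).
  by apply/rowP => i; rewrite !mxE.
have -> : \sum_j (A n *m invmx (Wmat Q u (m n))) a j * U j 0 = dotv b U.
  apply: eq_bigr => i _; congr (_ * _).
  have -> : b i 0 = b^T 0 i by rewrite [RHS]mxE.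
  by rewrite -rb -row_mul [RHS]mxE.
by rewrite /U /ubar dotvZr dotvC dotv_suml; congr (_ * _); apply: eq_bigr => j _; rewrite dotvC.
Qed.

(** The summands are centred, so [n] times the second moment of their mean is the squared L2
    distance between the finite projection and [phi0], which tends to 0. *)
Lemma proj_mean_cvg (dl e : R) : 0 < dl -> 0 < e -> wpd P dl
  (fun n => [set w | vnorm (proj_mean n w - smean phi0 Zs n w) <= e / Num.sqrt n%:R]).
Proof.
move=> dl0 e0.
pose f n a z := comb u (pcoef Q u (m n) (psi a)) z - phi0 a z.
have lf n a : L2 Q (f n a) by apply: L2B => //; exact: L2_comb.
have f0 n a : \int[Q]_z f n a z = 0.
  have [_ sp _] := is_proj_span lu (pphi a).
  rewrite RintegralB//.
  - by rewrite (mean_comb lu u0) (span_mean0 lu u0 (lphi a) sp) subrr.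
  - exact: L2_integrable (L2_comb lu _).
  - exact: L2_integrable (lphi a).
pose Y n w := \sum_a amean Zs (f n a) n w ^+ 2.
have YE n w : vnorm (proj_mean n w - smean phi0 Zs n w) = Num.sqrt (Y n w).
  congr Num.sqrt; apply: eq_bigr => a _; rewrite !mxE summxE -mulrBr -sumrB.
  by congr ((_ * _) ^+ 2); apply: eq_bigr => j _; rewrite mxE.
apply: (@wpd_sub _ _ _ _ _ (fun n => [set w | Y n w <= e ^+ 2 / n%:R])).
  exists 0%N => n _ w /= h; rewrite YE (le_trans (ler_wsqrtr h))//.
  by rewrite sqrtrM ?sqr_ge0// sqrtrV// sqrtr_sqr ger0_norm// ltW.
apply: wpd_markov => //.
(* Dividing by [r.+1] makes the sum over the [r] coordinates strictly smaller than [dl * e ^+ 2] and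
   avoids division by zero when [r = 0]. *)
have t0 : 0 < dl * e ^+ 2 / r.+1%:R by rewrite divr_gt0// mulr_gt0// exprn_gt0.
have /choice [N HN] a := proj_cvg a t0.
exists (maxn 1 (\max_a N a)) => n; rewrite geq_max => /andP[n1 n2].
have nR : 0 < n%:R :> R by rewrite ltr0n.
have [iY EY] := integral_sum_sqr (fun a => second_moment_amean HZ n (lf n a) (f0 n a)).
split=> //.
- by rewrite divr_gt0// exprn_gt0.
- by move=> w; apply: sumr_ge0 => i _; exact: sqr_ge0.
rewrite EY -mulr_sumr mulrA mulrC ltr_pM2r ?invr_gt0//.
rewrite (@le_lt_trans _ _ (\sum_(a < r) (dl * e ^+ 2 / r.+1%:R)))//.
  apply: ler_sum => a _; apply: ltW; apply: HN.
  by rewrite (leq_trans _ n2)//; exact: (leq_bigmax a).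
rewrite sumr_const card_ord -[ltLHS]mulr_natr mulrAC -mulrA gtr_pMr//.
  by rewrite ltr_pdivrMr// mul1r ltr_nat.
by rewrite mulr_gt0// exprn_gt0.
Qed.

(** Each of six events is allowed to fail with probability below [dl / 6]; on their intersection the
    deterministic results for one sample apply. The error [eps] is split evenly between the
    expansion and the convergence of the projections. *)
Lemma el_master (dl eps : R) : 0 < dl -> 0 < eps -> wpd P dl
  (fun n => [set w | (exists! z : 'cV[R]_(m n), zcond u Zs n w z) /\
    forall z : 'cV[R]_(m n), zcond u Zs n w z ->
    vnorm (est_form psi u Zs n w z - (smean psi Zs n w - smean phi0 Zs n w)) <= eps / Num.sqrt n%:R]).
Proof.
move=> dl0 eps0; pose d6 := dl / 6; have d60 : 0 < d6 by rewrite divr_gt0.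
have [K K0 HK] := ubar_small d60.
have [Kp HKp] := psi_bounded d60.
have [Ka Ka0 HA] := A_bounded.
have eps2 : 0 < eps / 2 by rewrite divr_gt0.
have Hp := proj_mean_cvg d60 eps2.
pose c' := c / 2; have c'0 : 0 < c' by rewrite divr_gt0.
pose Kst := el_const c C K Ka Kp.
have K1 : 0 < K + 1 by rewrite ltr_wpDl.
have C1 : 0 < C + c' by rewrite addr_gt0.
have S1 : 0 < `|Kst| + 1 by rewrite ltr_wpDl.
(* [K + 1] in place of [K] keeps the divisors below positive when [K = 0]. *)
pose q := 2 * (K + 1) / c'; have q0 : 0 < q by rewrite divr_gt0// mulr_gt0.
have q1 : 0 < 10 * q * (C + c') by apply: (mulr_gt0 _ C1); apply: (mulr_gt0 _ q0).
(* The four entries guarantee, in order, coercivity of the empirical matrix, weights bounded away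
   from 0, the contraction factor 1/2, and an expansion error of at most [eps / 2]. As [K], [Kp] and
   [Ka] are already fixed, (i)-(iii) can be invoked with this [e]. *)
pose e := Num.min (Num.min c' (2^-1 / q))
  (Num.min (2^-1 * c' / (10 * q * (C + c'))) (eps / 2 / (`|Kst| + 1))).
have e0 : 0 < e.
  rewrite !lt_min c'0 (divr_gt0 _ q0)// (divr_gt0 eps2 S1).
  by rewrite (divr_gt0 _ q1)// mulr_gt0.
have : e <= e by []; rewrite {2}/e !le_min => /andP[/andP[e1 e2'] /andP[e3' e4']].
rewrite ler_pdivlMr// in e2'; rewrite ler_pdivlMr// in e3'.
rewrite ler_pdivlMr// in e4'.
have qK : 2 * e * K / c' <= e * q.
  rewrite [leLHS](_ : _ = 2 * e / c' * K); last by ring.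
  rewrite [leRHS](_ : _ = 2 * e / c' * (K + 1)); last by rewrite /q; ring.
  by rewrite ler_wpM2l ?lerDl// ltW// divr_gt0// mulr_gt0.
have e2 := le_trans qK e2'.
have e3 : 10 * (2 * e * K / c') * (C + c') <= 2^-1 * c'.
  apply: le_trans e3'; rewrite [leRHS](_ : _ = 10 * (e * q) * (C + c')); last by ring.
  by rewrite ler_pM2r// ler_pM2l.
have e4 : Kst * e <= eps / 2.
  apply: le_trans e4'; rewrite mulrC ler_pM2l// (le_trans (ler_norm _))//.
  by rewrite lerDl.
have /o_pP/(_ e e0)/(_ d6 d60) H1 := h1.
have /o_pP/(_ e e0)/(_ d6 d60) H2 := h2.
have /o_pP/(_ e e0)/(_ d6 d60) H3 := h3.
have := wpdI H1 (wpdI H2 (wpdI H3 (wpdI HK (wpdI HKp Hp)))).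
have -> : d6 + (d6 + (d6 + (d6 + (d6 + d6)))) = dl by rewrite /d6; field.
apply: wpd_sub; have [N1 HN1] := minf 1.
exists (maxn N1 1) => n; rewrite geq_max => /andP[n1 n2] w.
move=> [/= w1 [/= w2 [/= w3 [/= w4 [/= w5 /= w6]]]]].
have m0 := HN1 _ n1.
pose U (j : 'I_n) := uvec u (m n) (Zs j w).
pose PS (j : 'I_n) := fvec psi (Zs j w).
have ule j : vnorm (U j) <= e * (Num.sqrt n%:R / ((m n)%:R * Num.sqrt (m n)%:R)).
  apply: le_trans w1; rewrite (le_trans _ (ler_norm _))//.
  exact: (le_bigmax_cond _ (fun j : 'I_n => vnorm (U j))).
have wle : opnorm (wbar U - Wmat Q u (m n)) <= e * (m n)%:R^-1.
  exact: le_trans (ler_norm _) w2.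
have cle : frob (n%:R^-1 *: \sum_j (PS j *m (U j)^T - A n)) <= e * (Num.sqrt (m n)%:R)^-1.
  exact: le_trans (ler_norm _) w3.
have zc z : zcond u Zs n w z <-> (forall j, 0 < 1 + dotv (U j) z) /\
    n%:R^-1 *: \sum_j ((1 + dotv (U j) z)^-1 *: U j) = 0.
  by rewrite /zcond; under eq_bigr do rewrite dotvE; split=> -[a b]; split=> // j; have := a j; rewrite dotvE.
have C0' := ltW C0; have e0' := ltW e0.
have [z [zr [pz ez]] uz] := el_exists_unique n2 m0 c0 C0' K0 e0' (@Wlow n) (@Whigh n) ule wle w4 e1 e2 e3.
split.
  by exists z; split; [exact/zc|move=> z' /zc[pz' ez']; rewrite (uz z')].
move=> z' /zc[pz' ez'].
have := el_expansion n2 m0 c0 C0' K0 Ka0 e0' (@Wlow n) (@Whigh n) ule wle cle w4 w5 (HA n) e1 e2 e3 pz' ez'.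
rewrite proj_meanE -/Kst => B.
have -> : est_form psi u Zs n w z' = n%:R^-1 *: \sum_j ((1 + dotv (U j) z')^-1 *: PS j).
  by rewrite /est_form; under eq_bigr do rewrite dotvE.
have E (x y t s : 'cV[R]_r) : x - (y - t) = (x - (y - s)) - (s - t).
  by rewrite !opprB !addrA; apply/colP => i; rewrite !mxE; ring.
rewrite (E _ _ _ (proj_mean n w)) (le_trans (vnormD _ _))// vnormN.
rewrite [eps]splitr mulrDl lerD//; apply: le_trans B _.
by rewrite ler_wpM2r// invr_ge0.
Qed.

End master.

(** * The multivariate limit theorem with the Gaussian density *)

Section multivariate_clt.
Context {R : realType} {d dz : measure_display}
  {Omega : measurableType d} {Zt : measurableType dz}
  (P : probability Omega R) (Q : probability Zt R) (Zs : nat -> Omega -> Zt)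
  {r : nat} (V : Zt -> 'cV[R]_r) (S : 'M[R]_r).
Hypothesis HZ : iid P Q Zs.
Hypothesis lV : forall a, L2 Q (fun z => V z a 0).
Hypothesis V0 : forall a, \int[Q]_z V z a 0 = 0.
Hypothesis VS : forall a b, \int[Q]_z (V z a 0 * V z b 0) = S a b.
Hypothesis uS : S \in unitmx.

Lemma cov_sym : S^T = S.
Proof.
apply/matrixP => a b; rewrite mxE -!VS; apply: eq_Rintegral => z _.
by rewrite mulrC.
Qed.

(** The quadratic form is the second moment of [dotv x (V z)]. If it vanishes, Cauchy-Schwarz gives
    [S *m x = 0], and invertibility gives [x = 0]. *)
Lemma cov_posdef : posdef S.
Proof.
move=> x x0; rewrite -mulmxA dotvE.
pose X z := \sum_i x i 0 * V z i 0.
have lX : L2 Q X by apply: L2_sum => i; exact: L2Z.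
have VX a : ip Q (fun z => V z a 0) X = (S *m x) a 0.
  rewrite ipC (ip_suml (index_enum 'I_r) (fun i => x i 0) (fun i => lV i) (lV a)) mxE.
  by apply: eq_bigr => i _; rewrite -VS mulrC ipC.
have XX : ip Q X X = dotv x (S *m x).
  rewrite {1}/X (ip_suml (index_enum 'I_r) (fun i => x i 0) (fun i => lV i) lX).
  by apply: eq_bigr => i _; rewrite VX.
rewrite lt_def -XX ip_ge0 andbT; apply/eqP => X0; move/eqP: x0; apply.
rewrite -[x]mul1mx -(mulVmx uS) -mulmxA.
have -> : S *m x = 0; last by rewrite mulmx0.
apply/colP => a; rewrite -VX mxE; apply/eqP; rewrite -sqrf_eq0 eq_le sqr_ge0 andbT.
by rewrite (le_trans (ip_cauchy_schwarz (lV a) lX))// X0 mulr0.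
Qed.

Variable X : nat -> Omega -> 'cV[R]_r.
Hypothesis mX : forall n, cmeas (X n).
Hypothesis XV : o_p P (fun n w =>
  vnorm (X n w - (Num.sqrt n%:R)^-1 *: \sum_(j < n) V (Zs j w))) (fun=> 1).

Lemma clt_conv_gauss : conv_gauss P X S.
Proof.
have mV : cmeas V by move=> a; case: (lV a).
have iV : Q.-integrable setT (EFin \o (fun z => vnorm (V z) ^+ 2)).
  have E : (fun z => vnorm (V z) ^+ 2) = (fun z => \sum_a V z a 0 ^+ 2).
    by apply/funext => z; rewrite sqr_vnorm; apply: eq_bigr => a _; rewrite expr2.
  by rewrite E; case: (integral_sum_sqr (fun a => conj (lV a).2 erefl)).
have mZ j : measurable_fun setT (Zs j) by case: HZ.
have [us usS usE] := iter_int_gauss cov_sym cov_posdef.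
have VS' a b : \int[Q]_z (V z a 0 * V z b 0) = outer us a b by rewrite VS usS.
pose Y n w := \sum_(j < n.+1) svec V n (Zs j w).
have mS n : cmeas (svec V n) by apply: cmeasZ => //; exact: measurable_cst.
have mY n : cmeas (Y n).
  by apply: cmeas_sum => j; apply: (cmeas_comp (mS n)); exact: mZ.
have XY (e : R) : 0 < e -> forall dl : R, 0 < dl -> exists N, forall n, (N <= n)%N ->
  exists A, measurable A /\ [set w | e < vnorm (X n.+1 w - Y n w)] `<=` A /\ (P A < dl%:E)%E.
  move=> e0 dl dl0; have [N HN] := XV e0 dl0; exists N => n Nn.
  have [A [mA [sA PA]]] := HN n.+1 (leqW Nn); exists A; split=> //; split=> //.
  apply: subset_trans sA => w /= h; rewrite mulr1 ger0_norm ?vnorm_ge0//.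
  by rewrite scaler_sumr.
have wY g : blip g -> weak_lim P Y us g.
  move=> bg e e0; have [N HN] := clt_blip mV iV V0 VS' bg e0; exists N => n Nn.
  have bmg : bm g.
    by have [[M bM] [L lL]] := bg; split; [exact: lip_meas_col lL|exists M].
  rewrite (_ : \int[P]_w g (Y n w) = iter n.+1 (avg Q (svec V n)) g 0); first exact: HN.
  rewrite -(Rintegral_sum_avg HZ (mS n) n.+1 0 bmg).
  by apply: eq_Rintegral => w _; rewrite add0r.
have wX g : blip g -> weak_lim P (fun n => X n.+1) us g.
  move=> bg; exact: (slutsky (fun n => mX n.+1) mY XY bg (wY _ bg)).
move=> h bh; have H := weak_bounded_cont (fun n => mX n.+1) wX bh.
have [[M bM] ch] := bh; have mh := econt_meas_col ch.
have bmh : bm h by split=> //; exists M.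
have -> : gauss_expect S h = gall us h 0.
  rewrite -usE// /gauss_expect; congr iter_int; apply/funext => x.
  by rewrite subr0.
have iX n : P.-integrable setT (EFin \o (fun w => h (X n w))).
  apply: (bdd_integrable P (M := M)); last by move=> w; exact: bM.
  exact: meas_col_comp.
apply/fine_cvgP; split; first by apply: nearW => n; exact: integrable_fin_num (iX n).
(* The comparison was carried out for samples of size [n.+1]; a shift of the index does not change
   the limit. *)
rewrite -cvg_shiftS; apply/cvgrPdist_le => e e0.
have [N HN] := H e e0; exists N => // n /= Nn.
by rewrite distrC; exact: HN.
Qed.

End multivariate_clt.

Section limit_covariance.
Context {R : realType} {dz} {Zt : measurableType dz} (Q : probability Zt R).
Variables (r : nat) (u : nat -> Zt -> R) (psi phi0 : 'I_r -> Zt -> R).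
Hypothesis lu : forall i, L2 Q (u i).
Hypothesis u0 : forall i, \int[Q]_z u i z = 0.
Hypothesis lpsi : forall a, L2 Q (psi a).
Hypothesis pphi : forall a, is_proj Q u (psi a) (phi0 a).

Lemma proj_L2 a : L2 Q (phi0 a).
Proof. by case: (pphi a). Qed.

Lemma proj_mean0 a : \int[Q]_z phi0 a z = 0.
Proof.
have [_ sp _] := is_proj_span lu (pphi a).
exact: (span_mean0 lu u0 (proj_L2 a) sp).
Qed.

(** The influence function of the estimator. *)
Definition resid (z : Zt) : 'cV[R]_r :=
  \col_a (psi a z - phi0 a z - mean_vec Q psi a 0).

Let lpp a : L2 Q (fun z => psi a z - phi0 a z).
Proof. exact: L2B (lpsi a) (proj_L2 a). Qed.

Let Epp a : \int[Q]_z (psi a z - phi0 a z) = mean_vec Q psi a 0.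
Proof.
rewrite RintegralB//; [|exact: L2_integrable|exact: L2_integrable (proj_L2 a)].
by rewrite proj_mean0 subr0 mxE.
Qed.

Lemma residE a : (fun z => resid z a 0) = (fun z => psi a z - phi0 a z - mean_vec Q psi a 0).
Proof. by apply/funext => z; rewrite mxE. Qed.

Lemma resid_L2 a : L2 Q (fun z => resid z a 0).
Proof. by rewrite residE; apply: L2B => //; exact: L2_cst. Qed.

Lemma resid_mean0 a : \int[Q]_z resid z a 0 = 0.
Proof.
rewrite residE RintegralB//; last exact: L2_integrable (L2_cst Q _).
  by rewrite Epp Rint_prob_cst subrr.
exact: L2_integrable.
Qed.

Let ip_cst f c : L2 Q f -> ip Q f (fun=> c) = c * \int[Q]_z f z.
Proof.
move=> lf; rewrite -RintegralZl//; last exact: L2_integrable.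
by apply: eq_Rintegral => z _; rewrite mulrC.
Qed.

(** Each [psi a - phi0 a] is orthogonal to every [phi0 b], which lies in the closed span, so the
    mixed moments of [psi] and [phi0] equal those of [phi0] and the covariances subtract. *)
Lemma resid_cov a b : \int[Q]_z (resid z a 0 * resid z b 0) =
  (cov_mat Q psi - cov_mat Q phi0) a b.
Proof.
have orth c e : ip Q (fun z => psi c z - phi0 c z) (phi0 e) = 0.
  have [_ _ og] := is_proj_span lu (pphi c); have [lg sp _] := is_proj_span lu (pphi e).
  exact: (span_orth lu).
have E : ip Q (fun z => resid z a 0) (fun z => resid z b 0) =
  ip Q (psi a) (psi b) - ip Q (phi0 a) (phi0 b) - mean_vec Q psi a 0 * mean_vec Q psi b 0.
  have lc c : L2 Q (fun=> c) by exact: L2_cst.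
  rewrite !residE (ipBl (lpp a) (lc _)); last exact: L2B.
  rewrite (ipBr (lpp b) (lc _) (lpp a)) (ipBr (lpp b) (lc _) (lc _)).
  rewrite (ip_cst _ (lpp a)) (ipC Q (fun=> mean_vec Q psi a 0) (fun z => psi b z - phi0 b z)) (ip_cst _ (lpp b)).
  rewrite (ip_cst _ (lc _)) !Epp Rint_prob_cst.
  rewrite (ipBr (lpsi b) (proj_L2 b) (lpp a)) orth subr0.
  rewrite (ipBl (lpsi a) (proj_L2 a) (lpsi b)).
  have := orth b a; rewrite ipC (ipBr (lpsi b) (proj_L2 b) (proj_L2 a)).
  by move=> /eqP; rewrite subr_eq0 => /eqP ->; ring.
rewrite -[LHS]/(ip Q _ _) E !mxE -/(ip Q (psi a) (psi b)).
have -> : EQ Q (phi0 a) = 0 by exact: proj_mean0.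
by rewrite mul0r subr0 addrAC.
Qed.

End limit_covariance.

Theorem theorem3 (R : realType) (d dz : measure_display)
  (Omega : measurableType d) (Zt : measurableType dz)
  (P : probability Omega R) (Q : probability Zt R)
  (Zs : nat -> Omega -> Zt) (r : nat) (psi : 'I_r -> Zt -> R)
  (u : nat -> Zt -> R) (m : nat -> nat)
  (phi0 : 'I_r -> Zt -> R) (thetat : nat -> Omega -> 'cV[R]_r) :
  iid P Q Zs ->
  (forall k, measurable_fun setT (psi k)) ->
  Q.-integrable setT (fun z => (vnorm (fvec psi z) ^+ 2)%:E) ->
  (forall i, measurable_fun setT (u i)) ->
  (forall K : nat, exists N, forall n, (N <= n)%N -> (K <= m n)%N) ->
  (forall n, Q.-integrable setT (fun z => (vnorm (uvec u (m n) z) ^+ 2)%:E)) ->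
  (forall n (i : 'I_(m n)), (\int[Q]_z (u i z)%:E = 0)%E) ->
  (forall n, Wmat Q u (m n) \in unitmx) ->
  @regular_seq R m (fun n => Wmat Q u (m n)) ->
  (* (i) *)
  o_p P (fun n w => \big[Num.max/0]_(j < n) vnorm (uvec u (m n) (Zs j w)))
        (fun n => Num.sqrt n%:R / ((m n)%:R * Num.sqrt (m n)%:R)) ->
  (* (ii) *)
  o_p P (fun n w => opnorm (Wbar u Zs (m n) n w - Wmat Q u (m n)))
        (fun n => (m n)%:R^-1) ->
  (* (iii) *)
  o_p P (fun n w => frob (cross_dev Q psi u Zs (m n) n w))
        (fun n => (Num.sqrt (m n)%:R)^-1) ->
  (* phi0 = Pi(psi | [u_oo]) componentwise *)
  (forall k, is_proj Q u (psi k) (phi0 k)) ->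
  (* thetat is (a measurable version of) the estimator on the event where
     the unique zeta-tilde exists *)
  (forall n k, measurable_fun setT (fun w => thetat n w k 0)) ->
  (forall n w (zeta : 'cV[R]_(m n)),
      (exists! z : 'cV[R]_(m n), zcond u Zs n w z) ->
      zcond u Zs n w zeta ->
      thetat n w = est_form psi u Zs n w zeta) ->
  wpto P (fun n => [set w | exists! zeta : 'cV[R]_(m n), zcond u Zs n w zeta])
  /\ o_p P (fun n w => vnorm (thetat n w - (smean psi Zs n w - smean phi0 Zs n w)))
           (fun n => (Num.sqrt n%:R)^-1)
  /\ (let Sigma0 := cov_mat Q psi - cov_mat Q phi0 in
      Sigma0 \in unitmx ->
      conv_gauss P (fun n w => Num.sqrt n%:R *: (thetat n w - mean_vec Q psi))
                 Sigma0).
Proof.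
move=> HZ mpsi ipsi mu minf iu u0E uW /regular_bounds[c [C [c0 C0 Wlow Whigh]]] h1 h2 h3 pphi mth hth.
(* The moment assumptions concern indices below some [m n]; as [m n] tends to infinity, every [i] is
   such an index. *)
have lu i : L2 Q (u i).
  have [N HN] := minf i.+1; have iN := HN N (leqnn N).
  have mV : cmeas (fun z => uvec u (m N) z).
    by move=> a; rewrite (_ : (fun z => _) = u a)//; apply/funext => z; rewrite mxE.
  have := L2_coord (Ordinal iN) mV (iu N).
  by rewrite (_ : (fun z => _) = u i)//; apply/funext => z; rewrite mxE.
have u0 i : \int[Q]_z u i z = 0.
  have [N HN] := minf i.+1; have iN := HN N (leqnn N).
  by rewrite /Rintegral (u0E N (Ordinal iN)).
have lpsi a : L2 Q (psi a).
  have mV : cmeas (fun z => fvec psi z).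
    by move=> b; rewrite (_ : (fun z => _) = psi b)//; apply/funext => z; rewrite mxE.
  have := L2_coord a mV ipsi.
  by rewrite (_ : (fun z => _) = psi a)//; apply/funext => z; rewrite mxE.
have M dl eps := @el_master R d dz Omega Zt P Q Zs r psi u m phi0 HZ minf lu lpsi
  u0 uW c C c0 C0 Wlow Whigh h1 h2 h3 pphi dl eps.
have E2 : o_p P (fun n w => vnorm (thetat n w - (smean psi Zs n w - smean phi0 Zs n w)))
    (fun n => (Num.sqrt n%:R)^-1).
  apply/o_pP => eps e0 dl dl0; apply: wpd_sub (M dl eps dl0 e0).
  exists 0%N => n _ w /= [ex H]; rewrite ger0_norm ?vnorm_ge0//.
  have [z [zc _]] := ex.
  by rewrite (hth n w z ex zc); exact: H.
split.
  move=> dl dl0; apply: wpd_sub (M dl 1 dl0 ltr01).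
  by exists 0%N => n _ w /= [].
split=> // S0 uS.
pose V := resid Q psi phi0.
apply: (@clt_conv_gauss _ _ _ _ _ P Q Zs r V S0 HZ).
- by move=> a; exact: (resid_L2 lpsi pphi).
- by move=> a; exact: (resid_mean0 lu u0 lpsi pphi).
- by move=> a b; exact: (resid_cov lu u0 lpsi pphi).
- exact: uS.
- move=> n; apply: cmeasZ; last exact: measurable_cst.
  by apply: cmeasD; [exact: mth|exact: cmeas_cst].
apply/o_pP => eps e0 dl dl0.
have /o_pP/(_ eps e0)/(_ dl dl0) := E2.
apply: wpd_sub; exists 1%N => n n1 w /=; rewrite !ger0_norm ?vnorm_ge0// mulr1 => h.
have nR : 0 < Num.sqrt n%:R :> R by rewrite sqrtr_gt0 ltr0n.
(* The normalised sum of residuals is the square root of [n] times the leading term of the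
   expansion, centred at the mean of [psi]; its distance to the normalised estimator is therefore
   the expansion error multiplied by that square root. *)
have VE : (Num.sqrt n%:R)^-1 *: \sum_(j < n) V (Zs j w) =
    Num.sqrt n%:R *: (smean psi Zs n w - smean phi0 Zs n w - mean_vec Q psi).
  have -> : \sum_(j < n) V (Zs j w) = \sum_(j < n) fvec psi (Zs j w)
      - \sum_(j < n) fvec phi0 (Zs j w) - n%:R *: mean_vec Q psi.
    rewrite scaler_nat -[X in _ *+ X]card_ord -sumr_const -!sumrB.
    by apply: eq_bigr => j _; apply/colP => a; rewrite !mxE.
  rewrite /smean !scalerBr !scalerA.
  have n2 : n%:R = Num.sqrt n%:R ^+ 2 :> R by rewrite sqr_sqrtr.
  have -> : Num.sqrt n%:R * n%:R^-1 = (Num.sqrt n%:R)^-1 :> R.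
    by rewrite {2}n2 expr2 invfM mulrA mulfV ?gt_eqF// mul1r.
  have -> // : (Num.sqrt n%:R)^-1 * n%:R = Num.sqrt n%:R :> R.
  by rewrite {2}n2 expr2 mulrA mulVf ?gt_eqF// mul1r.
rewrite VE -scalerBr opprB addrA subrK vnormZ gtr0_norm//.
by rewrite mulrC -ler_pdivlMr.
Qed.
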